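(* Let $\widetilde{\mathrm{SL}_2(\mathbb R)}$ be the universal cover of $\mathrm{SL}_2(\mathbb R)$, treated as a topological group. The Bohr compactification of $\widetilde{\mathrm{SL}_2(\mathbb R)}$ is trivial, whereas its generalized Bohr compactification is non-trivial and has as a homomorphic image the group $$\mathbb Z^*/({\mathbb Z^*}^{00}+\mathbb Z)\;\cong\;(\mathbb Z^*/{\mathbb Z^*}^{00})\big/\big(({\mathbb Z^*}^{00}+\mathbb Z)/{\mathbb Z^*}^{00}\big),$$ which is the Bohr compactification of the discrete group $\mathbb Z$ divided by a dense subgroup which is a copy of $\mathbb Z$.
   Context: The Bohr compactification of a topological group $G$ is the universal continuous homomorphism with dense image from $G$ to a compact Hausdorff group (or this compact group itself). ${\mathbb Z^*}$ is the interpretation of $\mathbb Z$ in a monster model ($\kappa$-saturated, strongly $\kappa$-homogeneous elementary extension, $\kappa$ a sufficiently large strong limit cardinal) of the expansion of $(\mathbb Z,+)$ by predicates for all subsets of $\mathbb Z$, and ${\mathbb Z^*}^{00}$ is the smallest subgroup of $\mathbb Z^*$ of bounded index (i.e. $<\kappa$) which is type-definable over $\mathbb Z$ in this language. Generalized Bohr compactification (in the sense of Glasner) of a topological group $G$: let $(G,S,s_0)$ be the universal $G$-ambit (an ambit is a compact Hausdorff space with a continuous $G$-action and a distinguished point with dense orbit). $S$ is a semigroup with $p*q=\lim g_iq$ for any net $(g_i)$ in $G$ with $g_is_0\to p$. Let $\mathcal M$ be a minimal left ideal of $S$ and $u\in\mathcal M$ an idempotent; then $u\mathcal M$ is a group (the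 Ellis group). For $p\in S$ and $A\subseteq S$ let $p\circ A$ be the set of all limits of convergent nets $g_ia_i$ with $g_i\in G$, $a_i\in A$ and $g_is_0\to p$. The $\tau$-topology on $u\mathcal M$ is the topology with closure operator $\mathrm{cl}_\tau(A)=u\mathcal M\cap(u\circ A)$. Let $H(u\mathcal M)$ be the intersection of the $\tau$-closures of all $\tau$-neighborhoods of the identity in $u\mathcal M$. Then $u\mathcal M/H(u\mathcal M)$ with the quotient topology is a compact Hausdorff topological group, called the generalized Bohr compactification of $G$ (up to isomorphism it does not depend on $\mathcal M$ and $u$). *)

(* Defs.v *)
From HB Require Import structures.
From mathcomp Require Import all_boot all_order all_algebra.
From mathcomp Require Import all_classical all_reals all_analysis.

Set Implicit Arguments.
Unset Strict Implicit.
Unset Printing Implicit Defensive.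

Import Order.TTheory GRing.Theory Num.Theory.
Import numFieldNormedType.Exports.

Local Open Scope classical_set_scope.
Local Open Scope ring_scope.
Local Open Scope quotient_scope.

Notation "{ 'quot' I }" := (Quotient.quot I) : type_scope.

HB.mixin Record Topological_isTopologicalGroup G & Topological G & Group G := {
  mulg_continuous : continuous (fun x : G * G => (x.1 * x.2)%g) ;
  invg_continuous : continuous (fun x : G => x^-1%g)
}.

#[short(type="topologicalGroupType")]
HB.structure Definition TopologicalGroup :=
  {G of Topological G & Group G & Topological_isTopologicalGroup G}.

(** [int] with its addition written multiplicatively, as [groupType] demands. *)
Definition discreteZ : Type := int.

HB.instance Definition _ := Group.copy discreteZ (Algebra.to_multiplicative int).
HB.instance Definition _ := Topological.copy discreteZ (discrete_topology int).

Lemma discreteZ_open (A : set discreteZ) : open A.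
Proof. exact: (@discrete_open (discrete_topology int) A). Qed.

Lemma discreteZ_mul_continuous :
  continuous (fun x : discreteZ * discreteZ => (x.1 * x.2)%g).
Proof.
move=> [x y] A /= /nbhs_singleton /= Axy.
exists ([set x], [set y]) => /=.
  by split; apply: open_nbhs_nbhs; split=> //; exact: discreteZ_open.
by move=> [a b] /= [-> ->].
Qed.

Lemma discreteZ_inv_continuous :
  continuous (fun x : discreteZ => x^-1%g).
Proof. by apply/continuousP => A _; exact: discreteZ_open. Qed.

HB.instance Definition _ := Topological_isTopologicalGroup.Build discreteZ
  discreteZ_mul_continuous discreteZ_inv_continuous.

Record SL2 (R : realType) := MkSL2 {
  SL2val :> 'M[R]_2 ;
  _ : \det SL2val == 1
}.

HB.instance Definition _ (R : realType) := [isSub for @SL2val R].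
HB.instance Definition _ (R : realType) := [Choice of SL2 R by <:].

Section SL2.
Variable R : realType.
Implicit Types A B : SL2 R.

Lemma SL2_det A : \det (val A) = 1.
Proof. by apply/eqP; case: A. Qed.

Lemma SL2_unit A : val A \in unitmx.
Proof. by rewrite unitmxE SL2_det unitr1. Qed.

Fact SL2_one_subproof : \det (1%:M : 'M[R]_2) == 1.
Proof. by rewrite det1. Qed.

Fact SL2_mul_subproof A B : \det (val A *m val B) == 1.
Proof. by rewrite det_mulmx !SL2_det mulr1. Qed.

Fact SL2_inv_subproof A : \det (invmx (val A)) == 1.
Proof. by rewrite det_inv SL2_det invr1. Qed.

Definition SL2_one := MkSL2 SL2_one_subproof.
Definition SL2_mul A B := MkSL2 (SL2_mul_subproof A B).
Definition SL2_inv A := MkSL2 (SL2_inv_subproof A).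

Fact SL2_mulA : associative SL2_mul.
Proof. by move=> A B C; apply: val_inj; rewrite /= mulmxA. Qed.

Fact SL2_mul1 : left_id SL2_one SL2_mul.
Proof. by move=> A; apply: val_inj; rewrite /= mul1mx. Qed.

Fact SL2_mulr1 : right_id SL2_one SL2_mul.
Proof. by move=> A; apply: val_inj; rewrite /= mulmx1. Qed.

Fact SL2_mulV : left_inverse SL2_one SL2_inv SL2_mul.
Proof. by move=> A; apply: val_inj; rewrite /= mulVmx // SL2_unit. Qed.

Fact SL2_mulrV : right_inverse SL2_one SL2_inv SL2_mul.
Proof. by move=> A; apply: val_inj; rewrite /= mulmxV // SL2_unit. Qed.

HB.instance Definition _ := isGroup.Build (SL2 R)
  SL2_mulA SL2_mul1 SL2_mulr1 SL2_mulV SL2_mulrV.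

HB.instance Definition _ :=
  Topological.copy (SL2 R) (initial_topology (@SL2val R)).

End SL2.

Definition evenly_covered (E X : topologicalType) (p : E -> X) (U : set X) :=
  exists (I : Type) (V : I -> set E),
    [/\ trivIset setT V,
        p @^-1` U = \bigcup_i V i,
        forall i, open (V i),
        forall i, set_bij (V i) U p &
        forall i W, open W -> W `<=` V i -> open (p @` W)].

Definition covering_map (E X : topologicalType) (p : E -> X) :=
  [/\ continuous p, range p = setT &
      forall x, exists U, [/\ open U, U x & evenly_covered p U]].

Section SimplyConnected.
Variables (R : realType) (T : topologicalType).

Definition unit_interval : set R := `[0, 1].

Definition path_connected :=
  forall x y : T, exists f : R -> T,
    [/\ {within unit_interval, continuous f}, f 0 = x & f 1 = y].

Definition null_homotopic (f : R -> T) :=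
  exists h : R * R -> T,
    [/\ {within unit_interval `*` unit_interval, continuous h},
        forall t, unit_interval t -> h (0, t) = f t,
        forall t, unit_interval t -> h (1, t) = f 0 &
        forall s, unit_interval s -> h (s, 0) = f 0 /\ h (s, 1) = f 0].

Definition simply_connected :=
  path_connected /\
  forall f : R -> T, {within unit_interval, continuous f} -> f 0 = f 1 ->
    null_homotopic f.

End SimplyConnected.

Definition is_universal_cover_SL2 (R : realType) (G : topologicalGroupType)
    (p : G -> SL2 R) :=
  [/\ {morph p : x y / (x * y)%g}, covering_map p & simply_connected R G].

Definition compact_hausdorff (T : topologicalType) :=
  compact [set: T] /\ hausdorff_space T.

Definition is_compactification (G B : topologicalGroupType) (b : G -> B) :=
  [/\ compact_hausdorff B, continuous b, {morph b : x y / (x * y)%g} &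
      dense (range b)].

Definition is_Bohr_compactification (G B : topologicalGroupType) (b : G -> B) :=
  is_compactification b /\
  forall (C : topologicalGroupType) (c : G -> C), is_compactification c ->
    exists! f : B -> C,
      [/\ continuous f, {morph f : x y / (x * y)%g} & f \o b = c].

Definition is_ambit (G : topologicalGroupType) (S : topologicalType)
    (act : G -> S -> S) (s0 : S) :=
  [/\ compact_hausdorff S,
      forall x, act 1%g x = x,
      forall g h x, act (g * h)%g x = act g (act h x),
      continuous (fun y : G * S => act y.1 y.2) &
      dense (range (act ^~ s0))].

Definition is_universal_ambit (G : topologicalGroupType) (S : topologicalType)
    (act : G -> S -> S) (s0 : S) :=
  is_ambit act s0 /\
  forall (X : topologicalType) (actX : G -> X -> X) (x0 : X),
    is_ambit actX x0 ->
    exists! f : S -> X,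
      [/\ continuous f, forall g x, f (act g x) = actX g (f x) & f s0 = x0].

(** Nets are rendered by filters: a net [(g_i)] in [G] by a proper filter on
    [G], and a net of pairs [(g_i, a_i)] by a proper filter on [G * S]. *)
Section Ellis.
Variables (G : topologicalGroupType) (S : topologicalType).
Variables (act : G -> S -> S) (s0 : S).
Implicit Types (p q r u : S) (A M U V : set S).

Definition amb_mul p q : S :=
  xget s0 [set r | forall F : set_system G, ProperFilter F ->
                     act^~ s0 @ F --> p -> act^~ q @ F --> r].

Definition left_ideal M :=
  M !=set0 /\ forall p q, M q -> M (amb_mul p q).

Definition minimal_left_ideal M :=
  left_ideal M /\ forall M', left_ideal M' -> M' `<=` M -> M' = M.

Definition amb_circ p A : set S :=
  [set r | exists F : set_system (G * S),
     [/\ ProperFilter F, F [set y | A y.2],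
         (fun y => act y.1 s0) @ F --> p &
         (fun y => act y.1 y.2) @ F --> r]].

Definition Ellis_group M u : set S := amb_mul u @` M.

Definition tau_closure M u A : set S := Ellis_group M u `&` amb_circ u A.

Definition tau_closed M u A :=
  A `<=` Ellis_group M u /\ tau_closure M u A = A.

Definition tau_open M u U :=
  U `<=` Ellis_group M u /\ tau_closed M u (Ellis_group M u `\` U).

(** The identity of the Ellis group is [u]. *)
Definition tau_nbhs1 M u V :=
  V `<=` Ellis_group M u /\ exists U, [/\ tau_open M u U, U u & U `<=` V].

Definition tau_H M u : set S :=
  \bigcap_(V in tau_nbhs1 M u) tau_closure M u V.

(** [B], with the map [pi] restricted to the Ellis group, is the quotient of the
    Ellis group by [tau_H M u], as a group and as a topological space. *)
Definition is_Ellis_quotient M u (B : topologicalGroupType) (pi : S -> B) :=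
  [/\ {in Ellis_group M u &, {morph pi : p q / amb_mul p q >-> (p * q)%g}},
      pi @` Ellis_group M u = setT,
      forall p, Ellis_group M u p -> (pi p = 1%g <-> tau_H M u p) &
      forall C : set B,
        closed C <-> tau_closed M u (Ellis_group M u `&` pi @^-1` C)].

End Ellis.

Definition is_generalized_Bohr_compactification (G B : topologicalGroupType) :=
  exists (S : topologicalType) (act : G -> S -> S) (s0 : S)
         (M : set S) (u : S) (pi : S -> B),
    [/\ is_universal_ambit act s0,
        minimal_left_ideal act s0 M,
        M u, amb_mul act s0 u u = u &
        is_Ellis_quotient act s0 M u pi].

Inductive term (V : Type) : Type :=
| Var of V
| Add of term V & term V.

(** [V] is the type of free variables; [All] binds the variable [None].  A
    formula with free variables [V] and parameters in [B] is evaluated by sending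
    the elements of [B] to themselves, so [form B] is also the type of sentences
    with parameters in [B]. *)
Inductive form (V : Type) : Type :=
| Eq of term V & term V
| In of set int & term V
| Bot
| Imp of form V & form V
| All of form (option V).

Arguments Bot {V}.

Section Satisfaction.
Variables (M : zmodType) (P : set int -> set M).

Fixpoint eval (V : Type) (e : V -> M) (t : term V) : M :=
  match t with
  | Var v => e v
  | Add t1 t2 => eval e t1 + eval e t2
  end.

Fixpoint sat (V : Type) (e : V -> M) (phi : form V) {struct phi} : Prop :=
  match phi with
  | Eq t1 t2 => eval e t1 = eval e t2
  | In A t => P A (eval e t)
  | Bot => False
  | Imp phi1 phi2 => sat e phi1 -> sat e phi2
  | All phi1 => forall a, sat (oapp e a) phi1
  end.

End Satisfaction.

(** In [embP] all integers are allowed as parameters.  An elementary extension of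
    the group (Z,+) is an abelian group, so nothing is lost in taking its carrier
    to be a [zmodType]. *)
Record elementary_extension := ElementaryExtension {
  ext_sort :> zmodType ;
  ext_pred : set int -> set ext_sort ;
  emb : int -> ext_sort ;
  embP : forall phi : form int,
    sat (fun A : set int => A) id phi <-> sat ext_pred emb phi
}.
Arguments ext_pred {e}.
Arguments emb {e}.

Definition card_lt (T U : Type) (A : set T) (B : set U) : Prop := ~~ (B #<= A)%card.

Section Monster.
Variables (K : Type) (N : elementary_extension).

Definition small (B : set N) := card_lt B [set: K].

(** The set of realizations in [N] of a set of formulas in one variable, [None],
    with parameters in [B]. *)
Definition realizations (B : set N) (Phi : set (form (option B))) : set N :=
  [set a | forall phi, Phi phi ->
     sat ext_pred (oapp (fun b : B => \val b) a) phi].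

Definition saturated :=
  forall (B : set N) (Phi : set (form (option B))), small B ->
    (forall Psi, Psi `<=` Phi -> finite_set Psi -> realizations Psi !=set0) ->
    realizations Phi !=set0.

Definition automorphism (s : N -> N) :=
  [/\ bijective s, {morph s : x y / x + y} &
      forall A x, ext_pred A (s x) <-> ext_pred A x].

Definition strongly_homogeneous :=
  forall (B : set N) (f : B -> N), small B ->
    (forall phi : form B,
       sat ext_pred (fun b : B => \val b) phi <-> sat ext_pred f phi) ->
    exists2 s, automorphism s & forall b : B, s (\val b) = f b.

(** "Sufficiently large" is read as larger than the language, whose cardinality
    is that of [set int].  The cardinals below that of [K] are those of subsets
    of [K]. *)
Definition large_strong_limit :=
  card_lt [set: set int] [set: K] /\
  forall A : set K, card_lt A [set: K] -> card_lt [set: set A] [set: K].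

Definition is_monster :=
  [/\ large_strong_limit, saturated & strongly_homogeneous].

Definition type_definable_over (B X : set N) :=
  exists Phi : set (form (option B)), X = realizations Phi.

Definition bounded_index (H : zmodClosed N) :=
  card_lt [set: {quot H}] [set: K].

(** The component written N^00: the intersection of the family of which it is the
    smallest member (see [comp00_smallest]). *)
Definition comp00 : {pred N} := fun x =>
  `[< forall H : zmodClosed N,
        type_definable_over (range emb) [set` H] -> bounded_index H -> x \in H >].

Fact comp00_zmod_closed : zmod_closed comp00.
Proof.
split=> [|x y /asboolP Hx /asboolP Hy]; apply/asboolP => H tH bH.
  exact: rpred0.
by apply: rpredB; [exact: Hx|exact: Hy].
Qed.

HB.instance Definition _ := GRing.isZmodClosed.Build N comp00 comp00_zmod_closed.

Lemma comp00_smallest (H : zmodClosed N) :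
  type_definable_over (range emb) [set` H] -> bounded_index H ->
  (forall H' : zmodClosed N, type_definable_over (range emb) [set` H'] ->
     bounded_index H' -> {subset H <= H'}) ->
  comp00 =i H.
Proof.
move=> tH bH minH x; apply/idP/idP => [/asboolP|xH]; first exact.
by apply/asboolP => H' tH' bH'; exact: minH.
Qed.

Lemma emb_is_zmod_morphism : zmod_morphism (@emb N).
Proof.
move=> m n.
have /(embP N) /= /eqP : sat (fun A : set int => A) id
  (Eq (Var m) (Add (Var (m - n)) (Var n))) by rewrite /= subrK.
by rewrite -subr_eq eq_sym => /eqP.
Qed.

HB.instance Definition _ :=
  GRing.isZmodMorphism.Build int N (@emb N) emb_is_zmod_morphism.

Definition comp00Z : {pred N} := fun x => `[< exists n, x - emb n \in comp00 >].

Fact comp00Z_zmod_closed : zmod_closed comp00Z.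
Proof.
split=> [|x y /asboolP[m xm] /asboolP[n yn]]; apply/asboolP.
  by exists 0; rewrite raddf0 subr0 rpred0.
exists (m - n); rewrite raddfB /= opprB.
by have -> : x - y + (emb n - emb m) = (x - emb m) - (y - emb n);
  [rewrite opprB addrACA [- y + _]addrC addrACA [emb n + _]addrC|exact: rpredB].
Qed.

HB.instance Definition _ :=
  GRing.isZmodClosed.Build N comp00Z comp00Z_zmod_closed.

Definition comp00Z_mod : {pred {quot comp00}} := fun c =>
  `[< exists2 x, x \in comp00Z & c = \pi x >].

Fact comp00Z_mod_zmod_closed : zmod_closed comp00Z_mod.
Proof.
split=> [|_ _ /asboolP[x xZ ->] /asboolP[y yZ ->]]; apply/asboolP.
  by exists 0; [exact: rpred0|rewrite piE].
by exists (x - y); [exact: rpredB|rewrite !piE].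
Qed.

HB.instance Definition _ :=
  GRing.isZmodClosed.Build {quot comp00} comp00Z_mod comp00Z_mod_zmod_closed.

Definition logic_closed (C : set {quot comp00}) :=
  exists2 B : set N, small B &
    type_definable_over B [set x | C (\pi x)].

End Monster.

Arguments comp00 K N : clear implicits.
Arguments comp00Z K N : clear implicits.
Arguments comp00Z_mod K N : clear implicits.

(* Main.v *)
(** Call an integer set "Bohr" if it belongs to a family of syndetic sets in which
    every [E] contains [E' - E'] for some member [E'].  Saturation and elementarity
    show that [Z^*00] is the intersection of the sets [D^*] with [D] Bohr.  The images
    of these sets are neighbourhoods of [0] for the logic topology on [Z^*/Z^*00];
    saturation gives compactness, and homomorphisms from [Z] to a compact group
    extend by taking standard parts.

    Let [p : G -> SL2(R)] be the universal cover.  In a compact group a nontrivial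
    element cannot be conjugated arbitrarily close to [1]; lifts of small unipotents
    can, and they generate [G], so [G] has no nontrivial compactification.

    The angle of the first column of [p g] lifts to [theta : G -> R], a quasi-morphism
    of defect less than [pi] that moves uniformly little under left translation by
    elements near [1].  If [p g0] is the rotation by [pi/2], then [theta g0 <> 0] and
    [psi = floor (theta / theta g0)] is an integer quasi-morphism with
    [psi (g0 ^ n) = n].  Bounded Lipschitz functions of [theta] extend continuously to
    the universal ambit, so a point [lim g_i s0] determines [lim psi (g_i)] in
    [Z^*/Z^*00] up to a bounded integer, that is, an element of [Z^*/(Z^*00 + Z)].
    The bounded errors vanish in this quotient, so the resulting map is
    multiplicative; it is onto already on the Ellis group [uM], and it kills
    [H(uM)] because, for each Bohr set [D], the points of [uM] whose limits lie
    within a fixed distance of [D] contain a tau-neighbourhood of [u]. *)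
Require Import Defs.
From HB Require Import structures.
From mathcomp Require Import all_boot all_order all_algebra.
From mathcomp Require Import all_classical all_reals all_analysis.
From mathcomp Require Import ring lra zify.

Set Implicit Arguments.
Unset Strict Implicit.
Unset Printing Implicit Defensive.

Import Order.TTheory GRing.Theory Num.Theory.
Import numFieldNormedType.Exports.

Local Open Scope classical_set_scope.
Local Open Scope ring_scope.
Local Open Scope quotient_scope.

(** * Topological groups and compactness *)

(** The universal ambit is known only through its universal property, so everything about it comes
    from closures of orbits in compact sets on which [G] acts: [S] itself yields the product, and a
    compact set of functions yields the extensions of functions of [theta]. The obstacle is that the
    integer-valued [psi] is not continuous and has no extension to [S]: a point of [S] determines no
    single element of [Z^*]. The proof works instead with the relation [same_limit] and with
    closures of level sets of [psi]. Two such closures may meet, but not when the sets of integers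
    are further apart than a constant [k]. Each estimate is then a count of multiples of [k], and an
    error is harmless as soon as its bound does not depend on the Bohr set. The lifted angle has a
    similar defect, being known pointwise only modulo [2 * pi]. Pointwise information excludes two
    values, and connectedness of paths turns the exclusion into a bound. Non-triviality of the
    generalized compactification needs an element of [Z^*] outside [Z^*00 + Z]; one is obtained from
    the 3-adic integer -1/2. *)

Lemma filter_seq_all (T : Type) (I : eqType) (H : set_system T) (s : seq I)
    (F : I -> set T) : Filter H ->
  (forall i, i \in s -> H (F i)) -> H [set x | forall i, i \in s -> F i x].
Proof.
move=> FH; elim: s => [|i s IH] HF; first by apply: filterS filterT => x _ i.
have Hi : H (F i) by apply: HF; rewrite inE eqxx.
have /IH Hs j : j \in s -> H (F j) by move=> js; apply: HF; rewrite inE js orbT.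
apply: filterS (filterI Hi Hs) => x [Fix xs] j.
by rewrite inE => /orP[/eqP->|/xs].
Qed.

(** Otherwise the sets of points missed by finite subfamilies would form a filter base on [A], and a
    cluster point would lie in the interior of some [U i]. *)
Lemma compact_seq_cover (T : topologicalType) (I : eqType) (A : set T)
    (U : I -> set T) : compact A -> (forall x, A x -> exists i, nbhs x (U i)) ->
  exists s : seq I, forall x, A x -> exists2 i, i \in s & U i x.
Proof.
move=> cA AU; apply: contrapT => /forallNP ns.
pose V (s : seq I) := [set x | A x /\ forall i, i \in s -> ~ U i x].
have V0 s : V s !=set0.
  have /existsNP[x /not_implyP[Ax nx]] := ns s.
  by exists x; split=> // i si Ux; apply: nx; exists i.
have FF : ProperFilter (filter_from setT V).
  apply: filter_from_proper => [|s _]; last exact: V0.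
  apply: filter_from_filter; first by exists [::].
  move=> s t _ _; exists (s ++ t) => // x [Ax nst].
  by split; split=> // i si; apply: nst; rewrite mem_cat si ?orbT.
have [|x [Ax Fx]] := cA _ FF; first by exists [::] => // x [].
have [i Ui] := AU x Ax.
have [|y [[_ nUy] Uy]] := Fx (V [:: i]) _ _ Ui; first by exists [:: i].
by apply: nUy Uy; rewrite inE.
Qed.

Section TopologicalGroups.
Variable G : topologicalGroupType.
Implicit Types (a b : G) (U V : set G).

Lemma cvgMg (T : Type) (F : set_system T) {FF : Filter F} (f g : T -> G) a b :
  f @ F --> a -> g @ F --> b -> (f x * g x)%g @[x --> F] --> (a * b)%g.
Proof.
move=> fa gb; apply: (@continuous2_cvg T G G G F FF f g (fun x y => (x * y)%g)) fa gb.
exact: (@mulg_continuous G (a, b)).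
Qed.

Lemma cvgVg (T : Type) (F : set_system T) {FF : Filter F} (f : T -> G) a :
  f @ F --> a -> (f x)^-1%g @[x --> F] --> a^-1%g.
Proof. by move=> fa; apply: (continuous_cvg _ (@invg_continuous G a)). Qed.

Lemma nbhs_lmul a b U : nbhs (a * b)%g U -> nbhs b [set x | U (a * x)%g].
Proof.
have ca : a @[x --> b] --> a by exact: cvg_cst.
have cb : x @[x --> b] --> b by exact: cvg_id.
by move=> Uab; exact: (cvgMg ca cb Uab).
Qed.

Lemma nbhs_rmul a b U : nbhs (a * b)%g U -> nbhs a [set x | U (x * b)%g].
Proof.
have cb : b @[x --> a] --> b by exact: cvg_cst.
have ca : x @[x --> a] --> a by exact: cvg_id.
by move=> Uab; exact: (cvgMg ca cb Uab).
Qed.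

Lemma nbhs_mulg a b U : nbhs (a * b)%g U -> exists V W,
  [/\ nbhs a V, nbhs b W & forall x y, V x -> W y -> U (x * y)%g].
Proof.
move=> /(@mulg_continuous G (a, b))[[V W] /= [Va Wb] VWU].
by exists V, W; split=> // x y Vx Wy; exact: (VWU (x, y)).
Qed.

Lemma nbhs1_div U : nbhs (1%g : G) U ->
  exists2 V, nbhs (1%g : G) V & forall x y, V x -> V y -> U (x * y^-1)%g.
Proof.
rewrite -[in nbhs _ U](mulg1 1%g) => /nbhs_mulg[V [W [V1 W1 VWU]]].
exists (V `&` [set x | W x^-1%g]) => [|x y [Vx _] [_ Wy]]; last exact: VWU.
apply: filterI => //; apply: (@invg_continuous G (1%g : G)) => /=.
by rewrite invg1.
Qed.

End TopologicalGroups.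

(** * Identities in abelian groups *)

Inductive zmod_expr :=
| ZVar of nat
| ZZero
| ZAdd of zmod_expr & zmod_expr
| ZOpp of zmod_expr.

Fixpoint zmod_eval (V : zmodType) (l : seq V) (e : zmod_expr) : V :=
  match e with
  | ZVar i => l`_i
  | ZZero => 0
  | ZAdd e1 e2 => zmod_eval l e1 + zmod_eval l e2
  | ZOpp e1 => - zmod_eval l e1
  end.

Fixpoint zmod_coef (e : zmod_expr) (i : nat) : int :=
  match e with
  | ZVar j => (i == j)%:R
  | ZZero => 0
  | ZAdd e1 e2 => zmod_coef e1 i + zmod_coef e2 i
  | ZOpp e1 => - zmod_coef e1 i
  end.

Lemma zmod_evalE (V : zmodType) (l : seq V) e :
  zmod_eval l e = \sum_(i < size l) l`_i *~ zmod_coef e i.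
Proof.
elim: e => [j||e1 IH1 e2 IH2|e IH] /=.
- have [jl|lj] := ltnP j (size l).
    rewrite (bigD1 (Ordinal jl)) //= eqxx big1 ?addr0 // => i /negPf ij.
    by rewrite (_ : (i == j :> nat) = false) //.
  rewrite nth_default // big1 // => i _.
  by rewrite (_ : (i == j :> nat) = false) // ltn_eqF // (leq_trans (ltn_ord i)).
- by rewrite big1.
- by rewrite IH1 IH2 -big_split; apply: eq_bigr => i _; rewrite mulrzDr.
- by rewrite IH -sumrN; apply: eq_bigr => i _; rewrite mulrNz.
Qed.

Lemma zmod_eval_eq (V : zmodType) (l : seq V) e f :
  all (fun i => zmod_coef e i == zmod_coef f i) (iota 0 (size l)) ->
  zmod_eval l e = zmod_eval l f.
Proof.
move=> /allP ef; rewrite !zmod_evalE; apply: eq_bigr => i _.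
by rewrite (eqP (ef i _)) // mem_iota ltn_ord.
Qed.

Ltac zmod_vars l t :=
  match t with
  | ?a + ?b => let l' := zmod_vars l a in zmod_vars l' b
  | - ?a => zmod_vars l a
  | 0 => l
  | _ => lazymatch l with context [cons t _] => l | _ => constr:(t :: l) end
  end.

Ltac zmod_index t l :=
  lazymatch l with
  | t :: _ => constr:(0%N)
  | _ :: ?l' => let n := zmod_index t l' in constr:(S n)
  end.

Ltac zmod_quote l t :=
  match t with
  | ?a + ?b =>
    let e := zmod_quote l a in let f := zmod_quote l b in constr:(ZAdd e f)
  | - ?a => let e := zmod_quote l a in constr:(ZOpp e)
  | 0 => constr:(ZZero)
  | _ => let i := zmod_index t l in constr:(ZVar i)
  end.

(** Decides equations in the language of abelian groups by comparing integer
    coefficients. *)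
Ltac zmod :=
  match goal with |- @eq ?V ?a ?b =>
    let l0 := zmod_vars (@nil V) a in
    let l := zmod_vars l0 b in
    let e := zmod_quote l a in
    let f := zmod_quote l b in
    exact: (@zmod_eval_eq _ l e f)
  end.

(** * Cardinals and transfer *)

(** Zorn's lemma gives a maximal graph of a partial injection. It is total or onto, since otherwise
    a pair of missed points could be added. *)
Lemma injective_total (T U : Type) :
  (exists f : T -> U, injective f) \/ (exists f : U -> T, injective f).
Proof.
pose P (g : set (T * U)) :=
  (forall x y y', g (x, y) -> g (x, y') -> y = y') /\
  (forall x x' y, g (x, y) -> g (x', y) -> x = x').
have [F FP tF|g [[gf gi] gmax]] := @Zorn_bigcup _ P.
  have FF X Y a b : F X -> F Y -> X a -> Y b -> exists Z, [/\ F Z, Z a & Z b].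
    by move=> FX FY Xa Yb; have [/(_ _ Xa)|/(_ _ Yb)] := tF _ _ FX FY; [exists Y|exists X].
  by split=> [x y y'|x x' y] [X FX Xa] [Y FY Yb];
    have [Z [FZ Za Zb]] := FF _ _ _ _ FX FY Xa Yb; have [Z1 Z2] := FP _ FZ;
    [exact: Z1 Za Zb|exact: Z2 Za Zb].
have [dom|/existsNP[x0 nx0]] := pselect (forall x, exists y, g (x, y)).
  left; have [f fP] := choice dom; exists f => x x' xx'.
  by apply: gi (fP x) _; rewrite xx'.
have [rng|/existsNP[y0 ny0]] := pselect (forall y, exists x, g (x, y)).
  right; have [f fP] := choice rng; exists f => y y' yy'.
  by apply: gf (fP y) _; rewrite yy'.
exfalso; apply: (gmax (g `|` [set (x0, y0)])).
  split=> [z gz|/(_ (x0, y0))]; first by left.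
  by move=> /(_ (or_intror erefl)) g0; apply: nx0; exists y0.
split=> [x y y'|x x' y].
  case=> [g1|[ex ey]] [g2|[ex' ey']]; [exact: gf g1 g2| | |by rewrite ey].
    by case: nx0; exists y; rewrite -ex'.
  by case: nx0; exists y'; rewrite -ex.
case=> [g1|[ex ey]] [g2|[ex' ey']]; [exact: gi g1 g2| | |by rewrite ex].
  by case: ny0; exists x; rewrite -ey'.
by case: ny0; exists x'; rewrite -ey.
Qed.

Lemma card_le_setTP (T U : Type) :
  ([set: T] #<= [set: U])%card <-> exists f : T -> U, injective f.
Proof.
split=> [/card_leP[f]|[f fi]].
  exists (fun x => \val (f (SigSub (mem_setT x)))) => x y /val_inj fxy.
  by have := inj (mem_setT _) (mem_setT _) fxy; move/(congr1 val).
apply/card_leP/injfunPex.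
exists (fun x : [set: T] => SigSub (mem_setT (f (val x)))) => //.
by move=> x y _ _ /(congr1 val) /= /fi /val_inj.
Qed.

Lemma card_lt_inj (T U K : Type) (f : T -> U) : injective f ->
  card_lt [set: U] [set: K] -> card_lt [set: T] [set: K].
Proof.
move=> fi /negP UK; apply/negP => /card_le_setTP[g gi]; apply: UK.
by apply/card_le_setTP; exists (f \o g); exact: inj_comp.
Qed.

Lemma card_lt_set_type (T K : Type) (B : set T) :
  card_lt B [set: K] <-> card_lt [set: B] [set: K].
Proof. by rewrite /card_lt (card_le_eqr (card_setT B)). Qed.

(** The strong limit condition speaks of subsets of [K] only. By comparability [T] injects into [K],
    and the power set of its image receives that of [T]. *)
Lemma card_lt_set (T K : Type) :
  (forall A : set K, card_lt A [set: K] -> card_lt [set: set A] [set: K]) ->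
  card_lt [set: T] [set: K] -> card_lt [set: set T] [set: K].
Proof.
move=> limit TK; have [[f fi]|[g gi]] := injective_total T K; last first.
  by move/negP: TK => []; apply/card_le_setTP; exists g.
have /limit : card_lt (range f) [set: K].
  by rewrite /card_lt (card_le_eqr (inj_card_eq (in2W fi))).
pose F (X : set T) : set (range f) := [set y | (f @` X) (val y)].
have mf t : f t \in range f by apply/mem_set; exists t.
apply: (@card_lt_inj _ _ _ F) => X Y /(congr1 (fun Z => Z (SigSub (mf _)))) XY.
apply/seteqP; split=> t Xt.
  by have : F X (SigSub (mf t)) by [exists t]; rewrite XY => -[u Yu /fi <-].
by have : F Y (SigSub (mf t)) by [exists t]; rewrite -XY => -[u Xu /fi <-].
Qed.


Fixpoint rename_term (V W : Type) (f : V -> W) (t : term V) : term W :=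
  match t with
  | Var v => Var (f v)
  | Add t1 t2 => Add (rename_term f t1) (rename_term f t2)
  end.

Fixpoint rename (V W : Type) (f : V -> W) (phi : Defs.form V) {struct phi} : Defs.form W :=
  match phi with
  | Eq t1 t2 => Eq (rename_term f t1) (rename_term f t2)
  | In A t => In A (rename_term f t)
  | Bot => Bot
  | Imp phi1 phi2 => Imp (rename f phi1) (rename f phi2)
  | All phi1 => All (rename (omap f) phi1)
  end.

Lemma eval_rename (M : zmodType) (V W : Type) (f : V -> W) (e : W -> M) t :
  Defs.eval e (rename_term f t) = Defs.eval (e \o f) t.
Proof. by elim: t => //= t1 -> t2 ->. Qed.

Lemma sat_rename (M : zmodType) (P : set int -> set M) (V W : Type)
    (f : V -> W) (e : W -> M) (phi : Defs.form V) :
  sat P e (rename f phi) <-> sat P (e \o f) phi.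
Proof.
elim: phi W f e => [{}V t1 t2|{}V A t|{}V|{}V p1 IH1 p2 IH2|{}V p IH] W f e /=.
- by rewrite !eval_rename.
- by rewrite eval_rename.
- by [].
- by split=> H /IH1 /H /IH2.
- have E a : oapp e a \o omap f = oapp (e \o f) a by apply/funext => -[].
  by split=> H a; have := H a; rewrite -E IH.
Qed.

Definition Conj (V : Type) (p q : Defs.form V) := Imp (Imp p (Imp q Bot)) Bot.

Definition Ex (V : Type) (p : Defs.form (option V)) := Imp (All (Imp p Bot)) Bot.

Lemma sat_Conj (M : zmodType) (P : set int -> set M) (V : Type) (e : V -> M) p q :
  sat P e (Conj p q) <-> sat P e p /\ sat P e q.
Proof.
split=> /= [H|[Hp Hq]]; last exact.
by split; apply: contrapT => nH; apply: H.
Qed.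

Lemma sat_Ex (M : zmodType) (P : set int -> set M) (V : Type) (e : V -> M) p :
  sat P e (Ex p) <-> exists a, sat P (oapp e a) p.
Proof.
split=> /= [H|[a Ha] H]; last exact: H Ha.
by apply: contrapT => nH; apply: H => a Ha; apply: nH; exists a.
Qed.

Section Transfer.
Variable N : elementary_extension.
Implicit Types (A B C : set int) (x y : N).

Lemma star_emb A n : ext_pred A (emb n : N) <-> A n.
Proof. exact: iff_sym (embP N (In A (Var n))). Qed.

(** Here and below transfer means one explicit sentence given to [embP]. Bound variables are de
    Bruijn indices: [None] belongs to the innermost quantifier, [Some None] to the next one. *)
Lemma starBr A B C : (forall m n, A (m + n) -> B n -> C m) ->
  forall x y, ext_pred A (x + y) -> ext_pred B y -> ext_pred C x.
Proof.
move=> ABC x y Axy By.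
have := (embP N (All (All (Imp (In A (Add (Var (Some None)) (Var None)))
  (Imp (In B (Var None)) (In C (Var (Some None)))))))).1.
by move=> /= /(_ ABC x y); exact.
Qed.

Lemma starD A B C : (forall m n, A m -> B n -> C (m + n)) ->
  forall x y, ext_pred A x -> ext_pred B y -> ext_pred C (x + y).
Proof.
move=> ABC x y Ax By.
have := (embP N (All (All (Imp (In A (Var (Some None)))
  (Imp (In B (Var None)) (In C (Add (Var (Some None)) (Var None)))))))).1.
by move=> /= /(_ ABC x y); exact.
Qed.

Lemma starS A B : A `<=` B -> forall x, ext_pred A x -> ext_pred B x.
Proof.
move=> AB x; have := (embP N (All (Imp (In A (Var None)) (In B (Var None))))).1.
by move=> /= /(_ AB x); exact.
Qed.

Lemma starI A B x : ext_pred (A `&` B) x <-> ext_pred A x /\ ext_pred B x.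
Proof.
split=> [ABx|[Ax Bx]]; first by split; apply: starS ABx => ? [].
have := (embP N (All (Imp (In A (Var None)) (Imp (In B (Var None))
  (In (A `&` B) (Var None)))))).1.
by move=> /= /(_ (fun _ a b => conj a b) x); exact.
Qed.

Lemma star0 x : ~ ext_pred set0 x.
Proof. exact: (embP N (All (Imp (In set0 (Var None)) Bot))).1 (fun _ => id) x. Qed.

Lemma starT x : ext_pred [set: int] x.
Proof. exact: (embP N (All (In setT (Var None)))).1 (fun _ => I) x. Qed.

Lemma starC A x : ext_pred (~` A) x <-> ~ ext_pred A x.
Proof.
split=> [nAx Ax|nAx].
  by apply: (@star0 x); rewrite -(setICr A); apply/starI.
exact: (embP N (All (Imp (Imp (In A (Var None)) Bot)
  (In (~` A) (Var None))))).1 (fun _ => id) x nAx.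
Qed.

Lemma starN0 A x : ext_pred A x -> A !=set0.
Proof.
by move=> Ax; apply/set0P/eqP => A0; apply: (@star0 x); rewrite -A0.
Qed.

Lemma star_shift A n x :
  ext_pred [set m | A (m + n)] x <-> ext_pred A (x + emb n).
Proof.
pose phi := In A (Add (Var None) (Var (Some n))).
pose psi := In [set m | A (m + n)] (Var (@None int)).
have H1 := (embP N (All (Imp phi psi))).1 (fun _ => id) x.
have H2 := (embP N (All (Imp psi phi))).1 (fun _ => id) x.
by split.
Qed.

Lemma star_shiftB A n x :
  ext_pred [set m | A (m - n)] x <-> ext_pred A (x - emb n).
Proof. by rewrite star_shift raddfN. Qed.

Lemma star_all (I : eqType) (s : seq I) (A : I -> set int) x :
  (forall i, i \in s -> ext_pred (A i) x) ->
  ext_pred [set m | forall i, i \in s -> A i m] x.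
Proof.
elim: s => [|i s IH] H; first by apply: starS (starT x) => m _ i.
have /IH Hs j : j \in s -> ext_pred (A j) x by move=> js; apply: H; rewrite inE js orbT.
have /H Hi : i \in i :: s by rewrite inE eqxx.
apply: (starS _ (iffRL (starI _ _ _) (conj Hi Hs))) => m [/= Aim Hm] j.
by rewrite inE => /orP[/eqP->|/Hm].
Qed.

Lemma star_exB A B C : (forall m, A m -> exists2 n, B n & C (m - n)) ->
  forall x, ext_pred A x -> exists2 y, ext_pred B y & ext_pred C (x - y).
Proof.
move=> ABC x Ax.
(* Terms have no subtraction, so the difference is a second quantified variable [z] with
   [x = z + y]. *)
pose psi : Defs.form (option int) := Ex (Conj (In B (Var None))
  (Ex (Conj (Eq (Var (Some (Some None))) (Add (Var None) (Var (Some None))))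
            (In C (Var None))))).
have psiP m : A m -> sat (fun A : set int => A) (oapp id m) psi.
  move=> /ABC[n Bn Cmn]; apply: (iffRL (@sat_Ex int _ _ _ _)); exists n.
  apply: (iffRL (@sat_Conj int _ _ _ _ _)); split=> //.
  apply: (iffRL (@sat_Ex int _ _ _ _)); exists (m - n).
  by apply: (iffRL (@sat_Conj int _ _ _ _ _)); split=> //=; rewrite subrK.
have : sat ext_pred (oapp emb x) psi.
  exact: (embP N (All (Imp (In A (Var None)) psi))).1 psiP x Ax.
rewrite sat_Ex => -[y]; rewrite sat_Conj => -[By]; rewrite sat_Ex => -[z].
rewrite sat_Conj => -[/= xE Cz].
by exists y => //; rewrite xE addrK.
Qed.

(** Every subset of [int] has a predicate, in particular the set that [phi] defines there; the
    equivalence of the two is a sentence and transfers. *)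
Lemma sat_star (phi : Defs.form (option int)) (x : N) :
  sat ext_pred (oapp emb x) phi <->
  ext_pred [set m | sat (fun A : set int => A) (oapp id m) phi] x.
Proof.
set A := [set m | _].
have H1 := (embP N (All (Imp phi (In A (Var None))))).1 (fun _ => id) x.
have H2 := (embP N (All (Imp (In A (Var None)) phi))).1 (fun _ => id) x.
by split.
Qed.

End Transfer.

(** * Saturation *)

Section Saturation.
Variables (K : Type) (N : elementary_extension).
Hypothesis monster : is_monster K N.

Lemma small_range (T : Type) (f : T -> N) :
  card_lt [set: T] [set: K] -> small K (range f).
Proof.
move=> TK; apply/card_lt_set_type.
have pre (y : range f) : exists t, f t = val y.
  by have /set_mem[t _ <-] := valP y; exists t.
have [g gP] := choice pre; apply: (card_lt_inj (f := g)) TK => x y gxy.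
by apply: val_inj; rewrite -!gP gxy.
Qed.

Lemma card_lt_Pint : card_lt [set: set int] [set: K].
Proof. by have [[]] := monster. Qed.

Lemma card_lt_PPint : card_lt [set: set (set int)] [set: K].
Proof. by have [[PK lim] _ _] := monster; exact: card_lt_set. Qed.

Lemma card_lt_int : card_lt [set: int] [set: K].
Proof.
apply: (card_lt_inj (f := @set1 int)) card_lt_Pint => m n.
by move=> /(congr1 (fun A => A m)) /= <-.
Qed.

(** The larger set injects into the subsets of [B], elements of [B] going to singletons and a new
    element to the empty set; the strong limit condition bounds the latter. *)
Lemma small_setU1 (B : set N) (a : N) : small K B -> small K (B `|` [set a]).
Proof.
move=> BK; apply/card_lt_set_type.
have /card_lt_set_type/(card_lt_set (proj2 (let: And3 p _ _ := monster in p))) := BK.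
apply: (card_lt_inj (f := fun x : set_type (B `|` [set a]) =>
  [set y : B | val y = val x])) => x y xy.
apply: val_inj; have [xB|nxB] := pselect (B (val x)).
  have /= E := congr1 (fun Z => Z (SigSub (mem_set xB))) xy.
  by have : val x = val y by rewrite -E.
have [yB|nyB] := pselect (B (val y)).
  have /= E := congr1 (fun Z => Z (SigSub (mem_set yB))) xy.
  by have : val y = val x by rewrite E.
by have /set_mem[|/= ->] := valP x; have /set_mem[|/= ->] := valP y.
Qed.

Definition definable (B X : set N) := exists phi : Defs.form (option B),
  forall a, X a <-> sat ext_pred (oapp (fun b : B => \val b) a) phi.

(** Saturation restated for an indexed family of definable sets. A finite set of formulas becomes a
    finite list of indices by choosing, for each formula, an index whose set it defines. *)
Lemma saturation_fip (B : set N) (I : eqType) (D : set I) (F : I -> set N) :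
  small K B -> (forall i, D i -> definable B (F i)) ->
  (forall s : seq I, (forall i, i \in s -> D i) ->
     exists x, forall i, i \in s -> F i x) ->
  exists x, forall i, D i -> F i x.
Proof.
move=> smB defF fip; have [_ sat_N _] := monster.
have [[i0 Di0]|noi] := pselect (exists i, D i); last first.
  have [|x _] := fip [::]; first by [].
  by exists x => i Di; case: noi; exists i.
pose Phi : set (Defs.form (option B)) := [set phi | exists2 i, D i &
  forall a, F i a <-> sat ext_pred (oapp (fun b : B => \val b) a) phi].
have [Psi PsiPhi finPsi|x xP] := sat_N B Phi smB; last first.
  by exists x => i Di; have [phi phiP] := defF i Di; apply/phiP/xP; exists i.
have [s sP] : exists s : seq {classic Defs.form (option B)}, Psi = [set` s].
  exact/finite_seqP.
have : forall phi : {classic Defs.form (option B)}, exists i, phi \in s -> D i /\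
    forall a, F i a <-> sat ext_pred (oapp (fun b : B => \val b) a) phi.
  move=> phi; have [sphi|nphi] := pselect (phi \in s).
    have /PsiPhi[i Di iP] : Psi phi by rewrite sP.
    by exists i.
  by exists i0.
move=> /choice[i iP].
have [j|x xP] := fip (map i s); first by move=> /mapP[phi /iP[Di _] ->].
exists x => phi; rewrite sP => /= sphi.
by apply/(iP _ sphi).2/xP/map_f.
Qed.


Lemma saturation_filter (B : set N) (I : eqType) (D : set I) (F : I -> set N)
    (H : set_system N) : ProperFilter H ->
  small K B -> (forall i, D i -> definable B (F i)) ->
  (forall i, D i -> H (F i)) ->
  exists x, forall i, D i -> F i x.
Proof.
move=> HP smB defF HF; apply: saturation_fip smB defF _ => s sD.
have : H [set x | forall i, i \in s -> F i x].
  by apply: filter_seq_all => i /sD /HF.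
by move=> /filter_ex.
Qed.

Lemma definable_shift (B : set N) (b : N) (A : set int) :
  B b -> definable B [set x | ext_pred A (x - b)].
Proof.
move=> Bb; pose b' : B := SigSub (mem_set Bb).
(* Membership of [x - b] is expressed by quantifying over the solutions of [z + b = x]. *)
exists (All (Imp (Eq (Add (Var None) (Var (Some (Some b')))) (Var (Some None)))
  (In A (Var None)))) => a /=.
split=> [Aab c e|]; last by apply; rewrite subrK.
by move: Aab; rewrite -e addrK.
Qed.

Lemma definable_star (B : set N) (A : set int) :
  definable B (ext_pred A).
Proof. by exists (In A (Var None)). Qed.

Lemma definable_emb (X : set N) :
  definable (range emb) X -> exists A : set int, X = ext_pred A.
Proof.
move=> [phi phiP].
have pre (y : range (emb : int -> N)) : exists n : int, emb n = val y.
  by have /set_mem[n _ <-] := valP y; exists n.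
have [g gP] := choice pre.
exists [set m | sat (fun A : set int => A) (oapp id m) (rename (omap g) phi)].
apply/seteqP; split=> x.
  move/phiP => phix; apply/sat_star; apply/sat_rename.
  have -> // : oapp emb x \o omap g = oapp (fun b => \val b) x.
  by apply/funext => -[b|] //=.
move/sat_star/sat_rename => phix; apply/phiP.
have -> // : oapp (fun b => \val b) x = oapp emb x \o omap g.
by apply/funext => -[b|] //=; rewrite gP.
Qed.

End Saturation.

(** * Bohr sets and the connected component *)

Definition syndetic (E : set int) :=
  exists s : seq int, forall m, exists2 k, k \in s & E (m - k).

Definition bohr_family (F : set (set int)) := forall E, F E ->
  syndetic E /\ exists2 E', F E' & forall m n, E' m -> E' n -> E (m - n).

(** The neighbourhoods of [0] in the topology that [int] inherits from its Bohr
    compactification. *)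
Definition bohr (D : set int) := exists2 F, bohr_family F & F D.

Lemma syndetic_star (N : elementary_extension) (E : set int) (s : seq int) :
  (forall m, exists2 k, k \in s & E (m - k)) ->
  forall x : N, exists2 k, k \in s & ext_pred E (x - emb k).
Proof.
move=> sP x; apply: contrapT => nE.
have [|m mP] := starN0 (@star_all N int s (fun k => ~` [set m | E (m - k)]) x _).
  by move=> k ks; apply/starC => /star_shiftB Ek; apply: nE; exists k.
by have [k ks Ek] := sP m; apply: (mP k ks).
Qed.

Lemma starB (N : elementary_extension) (A B C : set int) (x y : N) :
  (forall m n, A m -> B n -> C (m - n)) ->
  ext_pred A x -> ext_pred B y -> ext_pred C (x - y).
Proof.
move=> ABC Ax By; apply: (starBr (A := A) (B := B) _ _ By); last by rewrite subrK.
by move=> m n Amn Bn; rewrite -(addrK n m); exact: ABC.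
Qed.

Lemma star_opp (N : elementary_extension) (A : set int) (x : N) :
  ext_pred [set m | A (- m)] x <-> ext_pred A (- x).
Proof.
suff H B y : ext_pred B y -> ext_pred [set m | B (- m)] (- y : N).
  split=> [/H|/H]; last by rewrite opprK.
  by apply: starS => m /=; rewrite opprK.
move=> By.
have := (embP N (All (All (Imp (Eq (Add (Var None) (Var (Some None)))
  (Var (Some (Some 0)))) (Imp (In B (Var (Some None)))
  (In [set m | B (- m)] (Var None))))))).1.
move=> /= /(_ _ y (- y) _ By); apply; last by rewrite addNr raddf0.
by move=> m n /eqP; rewrite addr_eq0 => /eqP->; rewrite opprK.
Qed.

Lemma bohr_syndetic D : bohr D -> syndetic D.
Proof. by move=> [F FP /FP[]]. Qed.

Lemma bohr_half D : bohr D ->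
  exists2 D', bohr D' & forall m n, D' m -> D' n -> D (m - n).
Proof. by move=> [F FP /FP[_ [E' FE' E'D]]]; exists E' => //; exists F. Qed.

Lemma bohr0 D : bohr D -> D 0.
Proof.
move=> /bohr_half[E /bohr_syndetic[s /(_ 0)[k _ Ek]] ED].
by rewrite -(subrr (0 - k)); exact: ED.
Qed.

Lemma bohrS D E : D `<=` E -> bohr D -> bohr E.
Proof.
move=> DE [F FP FD]; exists [set X | exists2 Y, F Y & Y `<=` X]; last by exists D.
move=> X [Y FY YX]; have [[s sP] [Y' FY' Y'Y]] := FP Y FY; split.
  by exists s => m; have [k ks /YX] := sP m; exists k.
by exists Y' => [|m n Ym Yn]; [exists Y'|exact/YX/Y'Y].
Qed.

(** Each cell [(k + D') `&` (l + E')] lies in a single translate of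
    [D `&` E]. *)
Lemma syndeticI (D E D' E' : set int) :
  (forall m n, D' m -> D' n -> D (m - n)) ->
  (forall m n, E' m -> E' n -> E (m - n)) ->
  syndetic D' -> syndetic E' -> syndetic (D `&` E).
Proof.
move=> DD EE [s sP] [t tP].
have /choice[c cP] : forall kl : int * int, exists c : int,
    forall m, D' (m - kl.1) -> E' (m - kl.2) -> (D `&` E) (m - c).
  move=> [k l]; have [[c [Dc Ec]]|nc] :=
    pselect (exists c, D' (c - k) /\ E' (c - l)); last first.
    by exists 0 => m Dm Em; case: nc; exists m.
  exists c => m Dm Em; split.
    by have := DD _ _ Dm Dc; rewrite opprB addrA subrK.
  by have := EE _ _ Em Ec; rewrite opprB addrA subrK.
exists [seq c kl | kl <- allpairs pair s t] => m.
have [k ks Dk] := sP m; have [l lt El] := tP m.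
exists (c (k, l)); last exact: cP.
by apply: map_f; apply: allpairs_f.
Qed.

Lemma bohrI D E : bohr D -> bohr E -> bohr (D `&` E).
Proof.
move=> [F FP FD] [H HP HE].
exists [set X | exists2 A, F A & exists2 B, H B & X = A `&` B]; last first.
  by exists D => //; exists E.
move=> X [A FA [B HB ->]].
have [_ [A' FA' A'A]] := FP A FA; have [_ [B' HB' B'B]] := HP B HB; split.
  apply: syndeticI A'A B'B _ _; first by have [] := FP A' FA'.
  by have [] := HP B' HB'.
exists (A' `&` B') => [|m n [Am Bm] [An Bn]]; first by exists A' => //; exists B'.
by split; [exact: A'A|exact: B'B].
Qed.

Lemma bohrT : bohr setT.
Proof.
exists [set setT] => // _ ->; split; last by exists setT.
by exists [:: 0] => m; exists 0; rewrite ?inE.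
Qed.

Lemma bohr_dvd (d : int) : d != 0 -> bohr [set m | (d %| m)%Z].
Proof.
move=> d0; exists [set [set m | (d %| m)%Z]] => // _ ->; split; last first.
  by exists [set m | (d %| m)%Z] => // m n; exact: rpredB.
exists [seq (Posz k) | k <- iota 0 `|d|%N] => m.
exists (m %% d)%Z; last by rewrite /= {1}(divz_eq m d) addrK dvdz_mull.
have := ltz_mod m d0; have := modz_ge0 m d0.
case: (m %% d)%Z => // k _ kd; apply: map_f; rewrite mem_iota add0n /=.
by rewrite -ltz_nat.
Qed.

Lemma bohr_quarter_star (N : elementary_extension) D : bohr D ->
  exists2 D', bohr D' & forall a b c d : N, ext_pred D' a -> ext_pred D' b ->
    ext_pred D' c -> ext_pred D' d -> ext_pred D (a + b - c - d).
Proof.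
move=> /bohr_half[E /bohr_half[F bF FE] ED]; exists F => // a b c d Fa Fb Fc Fd.
have -> : a + b - c - d = (a - c) - (d - b).
  by zmod.
by apply: starB ED _ _; exact: starB FE _ _.
Qed.

(** An integer translate of [E] contains [x], and then also [y] because the translate is named by a
    predicate. This is what bounds indices: cosets are separated by types over the integers. *)
Lemma same_type_bohr (N : elementary_extension) (D : set int) (x y : N) :
  bohr D -> (forall A : set int, ext_pred A x -> ext_pred A y) ->
  ext_pred D (x - y).
Proof.
move=> /bohr_half[E /bohr_syndetic[s sP] ED] xy.
have [k _ Exk] := syndetic_star sP x.
have /xy/star_shiftB Eyk : ext_pred [set m | E (m - k)] x by apply/star_shiftB.
by have := starB ED Exk Eyk; rewrite opprB addrA subrK.
Qed.

Section Component.
Variables (K : Type) (N : elementary_extension).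
Hypothesis monster : is_monster K N.


Section Bounded.
Variable H : zmodClosed N.
Hypothesis defH : type_definable_over (range emb) [set` H].

(** Each defining formula has integer parameters and so is equivalent to a predicate [A], by
    [definable_emb]. *)
Lemma type_definable_star x :
  (forall A, [set` H] `<=` ext_pred A -> ext_pred A x) -> x \in H.
Proof.
have [Phi HPhi] := defH; move=> xP; suff : [set` H] x by [].
rewrite HPhi => phi Phi_phi.
have [|A AP] := @definable_emb N (realizations [set phi]).
  exists phi => a; split; first exact.
  by move=> aphi _ ->.
suff : realizations [set phi] x by exact.
rewrite AP; apply: xP => y; rewrite HPhi -AP => yP _ ->; exact: yP.
Qed.

(** If every [B] failed, saturation would give [x] and [y] in [H] with [x - y] outside the star of
    [A]. Saturation handles one variable at a time: first [x] is found in the projections [C B],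
    then [y] over [x]. *)
Lemma star_halving A : [set` H] `<=` ext_pred A ->
  exists2 B, [set` H] `<=` ext_pred B & forall m n, B m -> B n -> A (m - n).
Proof.
move=> HA; apply: contrapT => nB.
pose D : set (set int) := [set B | [set` H] `<=` ext_pred B].
pose C B := [set m | B m /\ exists2 n, B n & (~` A) (m - n)].
have capD (s : seq (set int)) : (forall B, B \in s -> D B) ->
    exists2 E, D E & forall B, B \in s -> E `<=` B.
  move=> sD; exists [set m | forall B, B \in s -> B m].
    move=> x Hx; apply: (@star_all _ _ s id) => B /sD; exact.
  by move=> B Bs m; exact.
have CS E B : E `<=` B -> C E `<=` C B.
  by move=> EB m [/EB Bm [n /EB Bn An]]; split=> //; exists n.
have C0 B : D B -> C B !=set0.
  move=> DB; apply: contrapT => C0; apply: nB; exists B => // m n Bm Bn.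
  by apply: contrapT => nA; apply: C0; exists m; split=> //; exists n.
have sm0 : small K (set0 : set N).
  apply/card_lt_set_type.
  apply: (card_lt_inj (f := fun=> 0)) (card_lt_int monster) => x.
  by have /set_mem := valP x.
have [|s /capD[E DE Es]|x xC] :=
    saturation_fip (F := fun B => ext_pred (C B)) (D := D) monster sm0.
- by move=> B _; exact: definable_star.
- have [m Cm] := C0 E DE; exists (emb m) => B Bs; apply/star_emb.
  exact: CS (Es B Bs) _ Cm.
have smx : small K [set x].
  by rewrite -(set0U [set x]); exact: small_setU1.
(* [None] stands for the condition that [x - y] avoids [A], rewritten in terms of [y - x] to fit
   [definable_shift]. *)
pose F (o : option (set int)) := if o is Some B then ext_pred B
  else [set y | ext_pred [set m | (~` A) (- m)] (y - x)].
pose D' : set (option (set int)) := [set u | if u is Some B then D B else True].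
have [|s sD|y yF] := saturation_fip (F := F) (D := D') monster smx.
- by move=> [B|] _; [exact: definable_star|exact: definable_shift].
- have [|E DE Es] := capD (pmap id s).
    by move=> B; rewrite mem_pmap => /mapP [u /sD + uB]; rewrite -uB.
  have [|y Ey nAxy] := @star_exB N (C E) E (~` A) _ x (xC E DE).
    by move=> m [_ [n En nA]]; exists n.
  exists y; move=> [B|] os; last by apply/(star_opp (~` A)); rewrite opprB.
  by apply: starS Ey; apply: Es; rewrite mem_pmap; apply/mapP; exists (Some B).
have xH : x \in H.
  by apply: type_definable_star => B HB; apply: starS (xC B HB) => m [].
have yH : y \in H by apply: type_definable_star => B HB; exact: (yF (Some B)).
have /(star_opp (~` A)) := yF None I; rewrite opprB => /starC; apply; apply: HA => /=.
exact: rpredB.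
Qed.

(** The translates of the star of [B] by coset representatives of [H] cover [N]. The index being
    bounded, saturation leaves finitely many translates that cover the integers. *)
Lemma bounded_syndetic (A : set int) :
  bounded_index K H -> [set` H] `<=` ext_pred A -> syndetic A.
Proof.
move=> bH /star_halving[B HB BA]; apply: contrapT => nsynd.
have smB : small K (range (fun q : {quot H} => repr q)) by exact: small_range.
have [|s _|x xP] := saturation_fip (D := setT)
    (F := fun q : {quot H} => [set x | ext_pred (~` B) (x - repr q)]) monster smB.
- by move=> q _; apply: definable_shift; exists q.
- apply: contrapT => /forallNP ns; apply: nsynd.
  (* Representatives need not be integers. If the translate at [repr q] contains an integer, any
     such integer can serve as [c q], at the cost of passing from [B] to [A]; otherwise 0 serves
     vacuously. *)
  have /choice[c cP] : forall q : {quot H}, exists c : int,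
      forall m, ext_pred B (emb m - repr q : N) -> A (m - c).
    move=> q; have [[c Bc]|nc] :=
      pselect (exists c : int, ext_pred B (emb c - repr q : N)); last first.
      by exists 0 => m Bm; case: nc; exists m.
    exists c => m Bm; apply/(star_emb N); rewrite raddfB.
    by have := starB BA Bm Bc; rewrite opprB addrA subrK.
  exists (map c s) => m; have /existsNP[q /not_implyP[qs]] := ns (emb m).
  move=> /starC /contrapT Bm; exists (c q); first exact: map_f.
  exact: cP.
have := xP (\pi x) I => /= /starC; apply; apply: HB => /=.
by rewrite Quotient.idealrBE reprK.
Qed.

Lemma bohr_bounded A :
  bounded_index K H -> [set` H] `<=` ext_pred A -> bohr A.
Proof.
move=> bH HA; exists [set B | [set` H] `<=` ext_pred B] => //= B HB.
by split; [exact: bounded_syndetic HB|exact: star_halving].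
Qed.

End Bounded.

(** The stars of a Bohr family intersect in a type-definable subgroup, of bounded index because
    elements of the same type are congruent modulo it. Conversely the sets whose stars contain a
    given subgroup of this kind are Bohr. *)
Lemma comp00P x : x \in comp00 K N <-> forall D, bohr D -> ext_pred D x.
Proof.
split=> [/asboolP xP D [F bF FD]|xP].
  pose I : {pred N} := fun x => `[< forall E, F E -> ext_pred E x >].
  have I_zmod : zmod_closed I.
    split=> [|y z /asboolP Iy /asboolP Iz]; apply/asboolP => E /[dup] FE /bF[_ [E' FE' E'E]].
      rewrite -(raddf0 (emb : int -> N)); apply/star_emb.
      have [[s /(_ 0)[k _ Ek]] _] := bF E' FE'.
      by rewrite -(subrr (0 - k)); exact: E'E.
    by apply: starB E'E _ _; [exact: Iy|exact: Iz].
  pose I_mixin := GRing.isZmodClosed.Build N I I_zmod.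
  pose H : zmodClosed N := HB.pack I I_mixin.
  suff : x \in H by move=> /asboolP xI; exact: xI.
  apply: xP.
    exists [set In E (Var None) | E in F]; apply/seteqP; split=> y.
      by move=> /asboolP Iy _ [E FE <-] /=; exact: Iy.
    move=> yP; apply/asboolP => E FE.
    by have := yP (In E (Var None)); apply; exists E.
  apply: (card_lt_inj (f := fun q : {quot H} => [set A | ext_pred A (repr q : N)])).
    move=> q r qr; rewrite -[q]reprK -[r]reprK; apply/eqP.
    rewrite -Quotient.idealrBE; apply/asboolP => E FE.
    apply: same_type_bohr => [|A]; first by exists F.
    by move=> Aq; have : [set A | ext_pred A (repr r : N)] A by rewrite -qr.
  exact: (card_lt_PPint monster).
apply/asboolP => H defH bH; apply: type_definable_star => // A HA.
by apply/xP/(@bohr_bounded H).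
Qed.

End Component.

(** * The Bohr compactification of the integers *)

Section BohrZ.
Variables (K : Type) (N : elementary_extension).
Hypothesis monster : is_monster K N.

Local Notation Q := {quot comp00 K N}.

Lemma pi_comp00P (x y : N) : \pi_Q x = \pi_Q y <-> x - y \in comp00 K N.
Proof. by rewrite Quotient.idealrBE; split=> [->|/eqP]. Qed.

Lemma bohr0_star (D : set int) : bohr D -> ext_pred D (0 : N).
Proof. by move=> /bohr0 D0; rewrite -(raddf0 (emb : int -> N)); apply/star_emb. Qed.

Lemma pi_bohr (D : set int) (x y : N) :
  bohr D -> \pi_Q x = \pi_Q y -> ext_pred D (x - y).
Proof. by move=> bD /pi_comp00P /(comp00P monster); exact. Qed.

(** The hypothesis is an argument of the type because the axioms of its topology
    depend on it. *)
Definition bohrZ of is_monster K N : Type := Q.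

Local Notation B := (bohrZ monster).

HB.instance Definition _ := Group.copy B (Algebra.to_multiplicative Q).

Lemma bohrZ_mulE (q r : Q) : ((q : B) * (r : B))%g = q + r.
Proof. by []. Qed.

(** The star of [D] is not a union of cosets, hence the quantification over all representatives. A
    change of representative lies in the star of every Bohr set and is absorbed by shrinking [D]. *)
Definition bohrZ_nbhs (q : B) : set_system B := [set A | exists2 D, bohr D &
  forall x y : N, \pi_Q x = q -> ext_pred D (y - x) -> A (\pi_Q y)].

HB.instance Definition _ := hasNbhs.Build B bohrZ_nbhs.

Lemma bohrZ_nbhs_singleton (q : B) (A : set B) : nbhs q A -> A q.
Proof.
move=> [D bD DA]; rewrite -[q]reprK; apply: (DA (repr (q : Q))); rewrite ?reprK //.
by apply: pi_bohr bD _.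
Qed.

Lemma bohrZ_nbhs_filter (q : B) : ProperFilter (nbhs q).
Proof.
split; first by move=> /bohrZ_nbhs_singleton.
split=> [|P R [D bD DP] [E bE ER]|P R PR [D bD DP]].
- by exists setT => //; exact: bohrT.
- exists (D `&` E) => [|x y xq /starI[Dx Ex]]; first exact: bohrI.
  by split; [exact: DP Dx|exact: ER Ex].
- by exists D => // x y xq Dx; exact/PR/(DP x).
Qed.

Lemma bohrZ_nbhs_nbhs (q : B) (A : set B) : nbhs q A -> nbhs q (nbhs^~ A).
Proof.
move=> [D bD DA]; have [E bE ED] := bohr_quarter_star N bD; exists E => // x y xq Ey.
exists E => // z w zy Ew; apply: (DA x _ xq).
(* The term [y - z] is the change of representative of one class. *)
have -> : w - x = (w - z) + (y - x) - (y - z) - 0 by zmod.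
by apply: ED => //; [apply: pi_bohr|apply: bohr0_star].
Qed.

HB.instance Definition _ := Nbhs_isNbhsTopological.Build B
  bohrZ_nbhs_filter bohrZ_nbhs_singleton bohrZ_nbhs_nbhs.

Definition bohr_ball (D : set int) (q : Q) : set B :=
  [set s | exists2 y, \pi_Q y = s & ext_pred D (y - repr q)].

Lemma nbhs_bohr_ball (D : set int) (q : B) : bohr D -> nbhs q (bohr_ball D q).
Proof.
move=> bD; exists D => // x y xq Dy; exists (y - x + repr (q : Q)); last by rewrite addrK.
apply/pi_comp00P; have -> : y - x + repr (q : Q) - y = repr (q : Q) - x by zmod.
by apply/pi_comp00P; rewrite reprK.
Qed.

Lemma bohrZ_mul_continuous : continuous (fun x : B * B => (x.1 * x.2)%g).
Proof.
move=> [q r] A [D bD DA]; have [E bE ED] := bohr_quarter_star N bD.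
exists (bohr_ball E q, bohr_ball E r) => /=; first by split; exact: nbhs_bohr_ball.
move=> [_ _] /= [[y <- Ey] [z <- Ez]].
have -> : ((\pi_Q y : B) * (\pi_Q z : B))%g = \pi_Q (y + z) by rewrite raddfD.
apply: (DA (repr (q : Q) + repr (r : Q))); first by rewrite raddfD /= !reprK.
have -> : y + z - (repr (q : Q) + repr (r : Q)) =
  (y - repr (q : Q)) + (z - repr (r : Q)) - 0 - 0 by zmod.
by apply: ED => //; exact: bohr0_star.
Qed.

Lemma bohrZ_inv_continuous : continuous (fun x : B => x^-1%g).
Proof.
move=> q A [D bD DA]; have [E bE ED] := bohr_half bD.
exists E => // x y xq Ey; suff : A (\pi_Q (- y)) by rewrite raddfN.
apply: (DA (- x)); first by rewrite raddfN /= xq.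
have -> : - y - - x = 0 - (y - x) by zmod.
by apply: starB ED _ _ => //; exact: bohr0_star.
Qed.

HB.instance Definition _ := Topological_isTopologicalGroup.Build B
  bohrZ_mul_continuous bohrZ_inv_continuous.

Lemma bohrZ_hausdorff : hausdorff_space B.
Proof.
move=> q r qr; rewrite -[q]reprK -[r]reprK; apply/pi_comp00P/(comp00P monster) => D bD.
have [E bE ED] := bohr_quarter_star N bD.
have [_ [[y <- Ey] [z zy Ez]]] := qr _ _ (nbhs_bohr_ball q bE) (nbhs_bohr_ball r bE).
have -> : repr (q : Q) - repr (r : Q) =
  (z - repr (r : Q)) + 0 - (y - repr (q : Q)) - (z - y) by zmod.
by apply: ED => //; [exact: bohr0_star|exact: pi_bohr].
Qed.

(** For every Bohr set [D], an ultrafilter contains one of finitely many integer translates covering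
    the group. The chosen translates have a common point by saturation, and its class is the
    limit. *)
Lemma bohrZ_compact : compact [set: B].
Proof.
rewrite compact_ultra => F UF _.
have /choice[c cP] : forall D : set int, exists m, bohr D ->
    F [set q : B | forall y, \pi_Q y = q -> ext_pred D (y - emb m)].
  move=> D; have [bD|nD] := pselect (bohr D); last by exists 0.
  have [E bE ED] := bohr_half bD; have [s sP] := bohr_syndetic bE.
  have [//|nF] := pselect (exists m, bohr D ->
    F [set q : B | forall y, \pi_Q y = q -> ext_pred D (y - emb m)]).
  have /filter_ex[q qP] : F [set q | forall m, m \in s ->
      ~ forall y, \pi_Q y = q -> ext_pred D (y - emb m)].
    apply: filter_seq_all => m _.
    have [Fm|//] := in_ultra_setVsetC [set q : B | forall y, \pi_Q y = q ->
      ext_pred D (y - emb m)] UF.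
    by case: nF; exists m.
  exfalso; have [m ms Em] := syndetic_star sP (repr (q : Q)).
  apply: (qP m ms) => y yq.
  have -> : y - emb m = (repr (q : Q) - emb m) - (repr (q : Q) - y) by zmod.
  by apply: starB ED _ _ => //; apply: pi_bohr; rewrite ?reprK.
have [|||x xP] := saturation_filter (I := set int) (D := bohr)
    (F := fun D => [set y : N | ext_pred D (y - emb (c D))])
    (H := filter_from F (fun A => \pi_Q @^-1` A)) monster _
    (small_range emb (card_lt_int monster)).
- apply: filter_from_proper => [|A /filter_ex[q Aq]]; last first.
    by exists (repr (q : Q)); rewrite /= reprK.
  apply: filter_from_filter; first by exists setT; exact: filterT.
  by move=> A A' FA FA'; exists (A `&` A'); first exact: filterI.
- by move=> D _; apply: definable_shift; exists (c D).
- by move=> D bD; exists [set q : B | forall y, \pi_Q y = q -> ext_pred D (y - emb (c D))];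
    [exact: cP|move=> y /= /(_ y erefl)].
exists (\pi_Q x : B); split=> // A [D bD DA].
have [E bE ED] := bohr_half bD; apply: filterS (cP E bE) => q qP.
rewrite -[q]reprK; apply: (DA x) => //.
have -> : repr (q : Q) - x = (repr (q : Q) - emb (c E)) - (x - emb (c E)) by zmod.
by apply: starB ED _ _; [apply: qP; rewrite reprK|exact: xP].
Qed.

End BohrZ.

(** * Comparison with the logic topology, and the universal property *)

Section LogicTopology.
Variables (K : Type) (N : elementary_extension).
Hypothesis monster : is_monster K N.

Local Notation Q := {quot comp00 K N}.
Local Notation B := (bohrZ monster).

Lemma card_lt_bohrZ : card_lt [set: Q] [set: K].
Proof.
apply: (card_lt_inj (f := fun q : Q => [set A | ext_pred A (repr q : N)])).
  move=> q r qr; rewrite -[q]reprK -[r]reprK.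
  apply/pi_comp00P/(comp00P monster) => D bD; apply: same_type_bohr => // A.
  by move=> Aq; have : [set A | ext_pred A (repr r : N)] A by rewrite -qr.
exact: (card_lt_PPint monster).
Qed.

Lemma definableS (A A' X : set N) : A `<=` A' -> definable A X -> definable A' X.
Proof.
move=> AA' [phi phiP].
pose incl (b : A) : A' := SigSub (mem_set (AA' _ (set_mem (valP b)))).
exists (rename (omap incl) phi) => a; rewrite phiP sat_rename.
suff -> : oapp (fun b : A' => \val b) a \o omap incl = oapp (fun b : A => \val b) a by [].
by apply/funext => -[].
Qed.

(** A class outside a closed [C] has a Bohr ball missing [C], and the complement of that ball is
    definable over the representative of the class. Conversely, for [q] in the closure, saturation
    over [A] and a representative [a] of [q] realizes [Phi] inside all Bohr balls around [a]. *)
Lemma bohrZ_closedP (C : set B) : closed C <-> logic_closed (C : set Q).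
Proof.
split=> [clC|[A smA [Phi CPhi]] q Cq].
  exists (range (fun q : Q => repr q)); first exact: small_range card_lt_bohrZ.
  exists [set phi | [set x | C (\pi x)] `<=` realizations [set phi]].
  apply/seteqP; split=> x; first by move=> Cx phi; apply.
  move=> xP; apply: contrapT => /= nCx.
  have /existsNP[U /not_implyP[[D bD DU] CU]] : ~ closure C (\pi_Q x : B).
    by move/clC.
  have [|phi phiP] := @definable_shift N (range (fun q : Q => repr q))
    (repr (\pi_Q x)) (~` D); first by exists (\pi_Q x).
  have /xP/phiP/starC : [set x | C (\pi x)] `<=` realizations [set phi].
    move=> y Cy _ ->; apply/phiP/starC => Dy; apply: CU.
    exists (\pi_Q y : B); split=> //.
    by apply: (DU (repr (\pi_Q x))) => //; rewrite reprK.
  by apply; apply: (pi_bohr monster) => //; rewrite reprK.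
pose a : N := repr (q : Q).
pose F : set (set N) := [set X | (exists2 phi, Phi phi & X = realizations [set phi])
  \/ exists2 D, bohr D & X = [set x | ext_pred D (x - a)]].
have [|||x xP] := saturation_filter (I := set N) (B := A `|` [set a]) (D := F)
    (F := id) (H := filter_from bohr (fun D => [set x : N | C (\pi x) /\ ext_pred D (x - a)]))
    monster _ (small_setU1 monster a smA).
- apply: filter_from_proper => [|D bD].
    apply: filter_from_filter; first by exists setT; exact: bohrT.
    move=> D E bD bE; exists (D `&` E); first exact: bohrI.
    by move=> x [Cx /starI[]].
  have [z [Cz [x xz Dx]]] := Cq _ (nbhs_bohr_ball q bD).
  by exists x; split=> //; have : C (\pi_Q x) by rewrite xz.
- move=> X [[phi Phi_phi ->]|[D bD ->]].
    apply: (@definableS A); first by move=> y; left.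
    by exists phi => y; split=> [|yP _ ->] //; exact.
  by apply: definable_shift; right.
- move=> X [[phi Phi_phi ->]|[D bD ->]].
    exists setT; first exact: bohrT.
    move=> y [Cy _] _ ->; have : [set x | C (\pi x)] y by [].
    by rewrite CPhi; exact.
  by exists D => // y [].
have <- : \pi_Q x = q.
  rewrite -[q]reprK; apply/pi_comp00P/(comp00P monster) => D bD.
  by apply: (xP [set x | ext_pred D (x - a)]); right; exists D.
have : realizations Phi x.
  by move=> phi ?; apply: (xP (realizations [set phi])) => //; left; exists phi.
by rewrite -CPhi.
Qed.

Lemma nbhs_bohrZ_emb (q : B) (A : set B) :
  nbhs q A -> exists n : int, A (\pi_Q (emb n)).
Proof.
move=> [D bD DA]; have [E bE ED] := bohr_half bD.
have [s sP] := bohr_syndetic bE.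
have [n _ En] := syndetic_star sP (repr (q : Q)).
exists n; apply: (DA (repr (q : Q))); first exact: reprK.
have -> : emb n - repr (q : Q) = 0 - (repr (q : Q) - emb n) by zmod.
by apply: starB ED _ _ => //; exact: bohr0_star.
Qed.


Section Extension.
Variables (C : topologicalGroupType) (c : discreteZ -> C).
Hypothesis cC : is_compactification c.

Let c_int : int -> C := c.

Let c_mul (m n : int) : c_int (m + n) = (c_int m * c_int n)%g.
Proof. by have [_ _ /(_ m n)] := cC. Qed.

Let c_div (m n : int) : c_int (m - n) = (c_int m * (c_int n)^-1)%g.
Proof. by have := c_mul (m - n) n; rewrite subrK => ->; rewrite mulgK. Qed.

(** Compactness covers [C] by finitely many translates of a neighbourhood of 1, and density puts the
    translating elements in the range of [c]; hence preimages are syndetic. *)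
Lemma bohr_preimage (U : set C) : nbhs 1%g U -> bohr (c_int @^-1` U).
Proof.
move=> U1; exists [set c_int @^-1` V | V in nbhs (1%g : C)]; last by exists U.
move=> _ [V V1 <-]; split; last first.
  have [W W1 WV] := nbhs1_div V1; exists (c_int @^-1` W); first by exists W.
  by move=> m n Wm Wn; rewrite /= c_div; exact: WV.
have [[cptC _] _ _ denseC] := cC.
pose O (k : int) : set C := [set y | nbhs (y * (c_int k)^-1)%g V].
have [y _|s sP] := compact_seq_cover (U := O) cptC.
  have [||z [Vz [k _ kz]]] := denseC [set z | nbhs (y * z^-1)%g V].
  - by exists y; rewrite /= mulgV.
  - rewrite openE => z /= /nbhs_interior.
    by apply: (cvgMg (cvg_cst y) (cvgVg cvg_id)).
  exists k; rewrite /O /= -[c_int k]/(c k) kz.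
  by have /nbhs_interior/nbhs_rmul := Vz.
by exists s => m; have [k Dk /nbhs_singleton Vk] := sP (c_int m) I;
  exists k => //; rewrite /= c_div.
Qed.

(** The type of [x] is an ultrafilter on [int]. Its image in [C] has a cluster point by compactness,
    which by [starC] is a limit. *)
Lemma standard_part (x : N) : exists t : C, forall U, nbhs t U ->
  ext_pred (c_int @^-1` U) x.
Proof.
have [[cptC _] _ _ _] := cC.
pose F := [set U : set C | ext_pred (c_int @^-1` U) x].
have FF : ProperFilter F.
  split; first exact: star0.
  split=> [|U V FU FV|U V UV]; first exact: starT.
    by rewrite /F /= preimage_setI; apply/starI.
  by apply: starS => m /UV.
have [t [_ Ft]] := cptC F FF filterT; exists t => U Ut.
apply: contrapT => /starC nU.
by have [y [nUy Uy]] := Ft (~` U) U nU Ut.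
Qed.

Lemma standard_part_unique (x : N) (s t : C) :
  (forall U, nbhs s U -> ext_pred (c_int @^-1` U) x) ->
  (forall U, nbhs t U -> ext_pred (c_int @^-1` U) x) -> s = t.
Proof.
have [[_ hausC] _ _ _] := cC; move=> sP tP; apply: hausC => U V /sP Ux /tP Vx.
by have [m [Um Vm]] := starN0 (iffRL (starI _ _ _) (conj Ux Vx)); exists (c_int m).
Qed.

Lemma bohrZ_extension : exists! f : B -> C,
  [/\ continuous f, {morph f : x y / (x * y)%g} &
      f \o (fun n : discreteZ => \pi_Q (emb n)) = c].
Proof.
have [st stP] := choice standard_part.
have stE x t : (forall U, nbhs t U -> ext_pred (c_int @^-1` U) x) -> st x = t.
  by move=> tP; apply: standard_part_unique tP; exact: stP.
have stD x y : st (x + y) = (st x * st y)%g.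
  apply: stE => U /(@mulg_continuous C (st x, st y))[[V W] /= [Vx Wy] VWU].
  apply: starD (stP x V Vx) (stP y W Wy) => m n Vm Wn /=.
  by rewrite c_mul; exact: (VWU (_, _)).
have st0 x : x \in comp00 K N -> st x = 1%g.
  by move=> /(comp00P monster) x0; apply: stE => U /bohr_preimage /x0.
have st_pi x y : \pi_Q x = \pi_Q y -> st x = st y.
  by move=> /pi_comp00P /st0 xy; rewrite -(subrK y x) stD xy mul1g.
have st_emb n : st (emb n) = c n.
  by apply: stE => U /nbhs_singleton Un; apply/star_emb.
pose f (q : B) := st (repr (q : Q)).
have fpi x : f (\pi_Q x) = st x by apply: st_pi; rewrite reprK.
have fC : continuous f.
  move=> q U /= Uq; have : nbhs (1%g * f q)%g U by rewrite mul1g.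
  move=> /nbhs_rmul /nbhs1_div[V V1 VU].
  exists (c_int @^-1` V); first exact: bohr_preimage.
  move=> x y xq Vyx; rewrite /= fpi -(subrK x y) stD -(fpi x) xq.
  (* The standard part of [y - x] need only be in the closure of [V]. An integer [m] with [c m] in
     [V] and close to it writes it as a quotient of two elements of [V]. *)
  have [|m [Vm Wm]] := @starN0 N (c_int @^-1` (V `&` [set z | V ((st (y - x))^-1 * z)%g])) (y - x).
    rewrite preimage_setI; apply/starI; split=> //; apply: stP.
    by apply: nbhs_lmul; rewrite mulVg.
  by have := VU _ _ Vm Wm; rewrite /= invgM invgK mulgA mulgV mul1g.
exists f; split.
  split=> //.
  - move=> q r; rewrite /f -stD; apply: st_pi; rewrite raddfD /= !reprK.
    by [].
  - by apply/funext => n /=; rewrite fpi st_emb.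
move=> g [gC gM gc]; apply/funext => q.
have [[_ hausC] _ _ _] := cC; apply: hausC => U V Uf Vg.
have fU : nbhs q (f @^-1` U) := fC q U Uf.
have gV : nbhs q (g @^-1` V) := gC q V Vg.
have [n [Un Vn]] := nbhs_bohrZ_emb (filterI fU gV).
have := congr1 (fun h => h n) gc; rewrite /= => gn.
by exists (c n); split; [rewrite -st_emb -fpi|rewrite -gn].
Qed.

End Extension.

Lemma bohrZ_is_Bohr_compactification :
  is_Bohr_compactification (fun n : discreteZ => \pi_Q (emb n) : B).
Proof.
split; last by move=> C c cC; exact: bohrZ_extension.
split.
- by split; [exact: bohrZ_compact|exact: bohrZ_hausdorff].
- by apply/continuousP => A _; exact: discreteZ_open.
- by move=> m n; rewrite bohrZ_mulE -raddfD -raddfD.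
- move=> U [q Uq] oU; have [n Un] := nbhs_bohrZ_emb (open_nbhs_nbhs (conj oU Uq)).
  by exists (\pi_Q (emb n)); split=> //; exists n.
Qed.

End LogicTopology.

(** * Quotients by the integers *)

Section Quotients.
Variables (K : Type) (N : elementary_extension).
Hypothesis monster : is_monster K N.

Local Notation Q := {quot comp00 K N}.
Local Notation QZ := {quot comp00Z K N}.
Local Notation QQ := {quot comp00Z_mod K N}.

Lemma comp00Z_emb (x : N) (n : int) : x - emb n \in comp00 K N -> x \in comp00Z K N.
Proof. by move=> xn; apply/asboolP; exists n. Qed.

Lemma comp00_sub (x : N) : x \in comp00 K N -> x \in comp00Z K N.
Proof. by move=> x0; apply: (@comp00Z_emb x 0); rewrite raddf0 subr0. Qed.

Lemma mem_comp00Z_mod (x : N) : (\pi_Q x \in comp00Z_mod K N) = (x \in comp00Z K N).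
Proof.
apply/idP/idP => [/asboolP[y yZ /pi_comp00P xy]|xZ]; last by apply/asboolP; exists x.
by rewrite -(subrK y x) rpredD // comp00_sub.
Qed.

Lemma third_isomorphism : exists f : QZ -> QQ, {morph f : x y / x + y} /\ bijective f.
Proof.
have eqZ (x y : N) : \pi_QQ (\pi_Q x) = \pi_QQ (\pi_Q y) <-> \pi_QZ x = \pi_QZ y.
  split=> /eqP; rewrite -Quotient.idealrBE => H; apply/eqP; rewrite -Quotient.idealrBE.
    by rewrite -mem_comp00Z_mod raddfB.
  by rewrite -raddfB mem_comp00Z_mod.
pose f (q : QZ) : QQ := \pi_QQ (\pi_Q (repr q)).
have fpi x : f (\pi_QZ x) = \pi_QQ (\pi_Q x) by apply/eqZ; rewrite reprK.
exists f; split=> [q r|].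
  by rewrite -[q]reprK -[r]reprK -raddfD !fpi !raddfD.
exists (fun r : QQ => \pi_QZ (repr (repr r : Q))) => [q|r]; last by rewrite fpi !reprK.
by rewrite -[RHS]reprK; apply/eqZ; rewrite !reprK.
Qed.

(** For nonzero [n] the multiples of [2 * n] form a Bohr set that misses [n]. *)
Lemma emb_comp00 (n : int) : (emb n : N) \in comp00 K N -> n = 0.
Proof.
move=> /(comp00P monster) n0; apply/eqP/negPn/negP => nn0.
have /star_emb /= : ext_pred [set m | (2 * n %| m)%Z] (emb n : N).
  by apply/n0/bohr_dvd; rewrite mulf_neq0.
move=> /dvdzP[q nq]; have /eqP : n * (2 * q - 1) = 0.
  by rewrite mulrBr mulr1 [n * _]mulrC mulrAC -mulrA [n in _ - n]nq; ring.
by rewrite mulf_eq0 (negPf nn0) /= => /eqP; lia.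
Qed.

Lemma copy_of_Z : exists g : int -> Q, [/\ {morph g : m n / m + n}, injective g &
  range g = [set` comp00Z_mod K N]].
Proof.
exists (fun n => \pi_Q (emb n)); split.
- by move=> m n; rewrite !raddfD.
- move=> m n /pi_comp00P; rewrite -raddfB => /emb_comp00 /eqP.
  by rewrite subr_eq0 => /eqP.
- apply/seteqP; split=> [_ [n _ <-]|q] /=.
    by rewrite mem_comp00Z_mod (@comp00Z_emb _ n) // subrr rpred0.
  rewrite -[q]reprK mem_comp00Z_mod => /asboolP[n qn].
  by exists n => //; apply/esym/pi_comp00P.
Qed.

(** A realization of [x = -1/2] in the 3-adic completion. *)
Lemma comp00Z_proper : exists x : N, x \notin comp00Z K N.
Proof.
pose A (k : nat) := [set m : int | (3 ^+ k %| 2 * m + 1)%Z].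
have A0 k : A k !=set0.
  (* As [3 ^ k] is odd, this is [(3 ^ k - 1) / 2]. *)
  pose m : int := ((3 ^ k)./2)%:Z.
  suff e : 3 ^+ k = 2 * m + 1 :> int by exists m; rewrite /A /= e dvdzz.
  have -> : (3 : int) ^+ k = (3 ^ k)%N%:Z by rewrite -natz natrX.
  have := odd_double_half (3 ^ k); rewrite oddX orbT /m; lia.
have AS k : A k.+1 `<=` A k.
  by move=> m; rewrite /A /= exprS; apply: dvdz_trans; rewrite dvdz_mull.
have [|s _|x xA] := saturation_fip (I := nat) (D := setT) (F := fun k => ext_pred (A k))
    monster (small_range (emb : int -> N) (card_lt_int monster)).
- by move=> k _; exact: definable_star.
- have AS' k j : A (k + j)%N `<=` A k.
    by elim: j => [|j IH]; rewrite ?addn0 // addnS; apply: subset_trans IH; exact: AS.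
  have [m Am] := A0 (\max_(k <- s) k)%N; exists (emb m) => k ks; apply/star_emb.
  apply: (AS' k ((\max_(j <- s) j) - k)%N); rewrite subnKC //.
  by rewrite (big_rem k) //= leq_maxl.
- exists x; apply/negP => /asboolP[n /(comp00P monster) xn].
  (* [3 ^+ k] exceeds the absolute value of [2 * n + 1], which is odd and so nonzero, and cannot
     divide it. *)
  pose k : nat := `|(2 * n + 1)%R|%N.
  have k3 : (3 ^+ k : int) != 0 by rewrite expf_neq0.
  have [m [Am]] := starN0 (iffRL (starI _ _ _) (conj (xA k I)
    (iffRL (star_shiftB [set m | (3 ^+ k %| m)%Z] n x) (xn _ (bohr_dvd k3))))).
  move=> /= dmn; have : (3 ^+ k %| 2 * n + 1)%Z.
    have -> : 2 * n + 1 = (2 * m + 1) - 2 * (m - n) by ring.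
    by apply: rpredB => //; exact: dvdz_mull.
  rewrite dvdzE abszX => /dvdn_leq; rewrite absz_gt0 leqNgt ltn_expl //.
  by have /[swap]/[apply] : 2 * n + 1 != 0 by lia.
Qed.

End Quotients.

(** * Universal ambits *)

Lemma nbhs_set_typeP (T : topologicalType) (A : set T) (x : A) (U : set A) :
  nbhs x U <-> exists2 W : set T, nbhs (val x) W & val @^-1` W `<=` U.
Proof.
split=> [[_ /= [[W oW <-] Wx WU]]|[W Wx WU]].
  by exists W => //; apply: open_nbhs_nbhs.
by apply: filterS WU _; exact: (@initial_continuous A T set_val x W Wx).
Qed.

Lemma compact_set_type (T : topologicalType) (A : set T) :
  compact A -> compact [set: A].
Proof.
move=> cA F FF _.
have FA : F [set x : A | A (val x)].
  by apply: filterS filterT => x _; exact: set_mem (valP x).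
have [t [At Ft]] := cA (@set_val _ A @ F) _ FA.
exists (SigSub (mem_set At)); split=> // X U FX /nbhs_set_typeP[W /= Wt WU].
have FX' : F [set x : A | (@set_val T A @` X) (set_val x)].
  by apply: filterS FX => x Xx; exists x.
have [_ [[x Xx <-] Wx]] := Ft (@set_val T A @` X) W FX' Wt.
by exists x; split=> //; exact: WU.
Qed.

Lemma hausdorff_set_type (T : topologicalType) (A : set T) :
  hausdorff_space T -> hausdorff_space A.
Proof.
move=> hT x y xy; apply/val_inj/hT => U V Ux Vy.
have [||z [Uz Vz]] := xy (val @^-1` U) (val @^-1` V).
- by apply/nbhs_set_typeP; exists U.
- by apply/nbhs_set_typeP; exists V.
by exists (val z).
Qed.

Section UniversalAmbit.
Variables (G : topologicalGroupType) (S : topologicalType).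
Variables (act : G -> S -> S) (s0 : S).
Hypothesis univ : is_universal_ambit act s0.

(** The orbit closure, made into a type, is an ambit. The action is constrained on [Y] only, which
    admits translation of functions on an equicontinuous set. *)
Lemma orbit_closure_map (T : topologicalType) (actT : G -> T -> T) (Y : set T)
    (y0 : T) : hausdorff_space T -> compact Y -> Y y0 ->
  (forall g y, Y y -> Y (actT g y)) ->
  (forall y, Y y -> actT 1%g y = y) ->
  (forall g h y, Y y -> actT (g * h)%g y = actT g (actT h y)) ->
  (forall g y U, Y y -> nbhs (actT g y) U -> exists V W,
     [/\ nbhs g V, nbhs y W & forall h z, V h -> W z -> Y z -> U (actT h z)]) ->
  exists2 f : S -> T, continuous f & forall g, f (act g s0) = actT g y0.
Proof.
move=> hT cY Yy0 Yact act1 actM actC.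
pose Z := closure (range (actT ^~ y0)).
have ZY : Z `<=` Y.
  move=> z Zz; apply: (compact_closed hT cY); apply: closureS Zz => _ [g _ <-].
  exact: Yact.
have Zact g z : Z z -> Z (actT g z).
  move=> Zz U /(actC _ _ _ (ZY _ Zz))[V [W [Vg Wz VWU]]].
  have [_ [[h _ <-] Wh]] := Zz W Wz.
  exists (actT g (actT h y0)); split; first by exists (g * h)%g; rewrite ?actM.
  by apply: VWU => //; [exact: nbhs_singleton|exact: Yact].
pose act' g (z : Z) : Z := SigSub (mem_set (Zact g _ (set_mem (valP z)))).
have Z0 : Z y0.
  by apply: subset_closure; exists 1%g => //; rewrite act1.
pose z0 : Z := SigSub (mem_set Z0).
have YZ (z : Z) : Y (val z) by exact/ZY/set_mem/valP.
have ambZ : is_ambit act' z0.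
  split.
  - split; last exact: hausdorff_set_type.
    apply: compact_set_type; apply: subclosed_compact cY ZY.
    exact: closed_closure.
  - by move=> z; apply: val_inj; rewrite /= (act1 _ (YZ z)).
  - by move=> g h z; apply: val_inj; rewrite /= (actM _ _ _ (YZ z)).
  - move=> [g z] U /nbhs_set_typeP[W /= /(actC _ _ _ (YZ z))[V [X [Vg Xz VXW]]] WU].
    exists (V, val @^-1` X) => /=; first by split=> //; apply/nbhs_set_typeP; exists X.
    by move=> [h y] /= [Vh Xy]; apply: WU; exact: VXW.
  - move=> U [z Uz] oU.
    have /nbhs_set_typeP[W Wz WU] := open_nbhs_nbhs (conj oU Uz).
    have [_ [[g _ <-] Wg]] := set_mem (valP z) W Wz.
    by exists (act' g z0); split; [exact: WU|exists g].
have [_ /(_ _ _ _ ambZ)[f [[fC fM f0] _]]] := univ.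
exists (fun s => val (f s)).
  move=> s U Us; apply: (fC s [set z | U (val z)]).
  by apply/nbhs_set_typeP; exists U.
by move=> g; rewrite fM f0.
Qed.

Let ambS : is_ambit act s0. Proof. by have [] := univ. Qed.

Let hS : hausdorff_space S. Proof. by have [[]] := ambS. Qed.

Let cS : compact [set: S]. Proof. by have [[]] := ambS. Qed.

Let act1 x : act 1%g x = x. Proof. by have [] := ambS. Qed.

Let actM g h x : act (g * h)%g x = act g (act h x). Proof. by have [] := ambS. Qed.

Lemma nbhs_act g x (U : set S) : nbhs (act g x) U -> exists V W,
  [/\ nbhs g V, nbhs x W & forall h y, V h -> W y -> U (act h y)].
Proof.
have [_ _ _ actC _] := ambS => /(actC (g, x))[[V W] /= [Vg Wx] VWU].
by exists V, W; split=> // h y Vh Wy; exact: (VWU (h, y)).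
Qed.

Lemma act_continuous g : continuous (act g).
Proof.
move=> x U /nbhs_act[V [W [Vg Wx VWU]]].
by apply: filterS Wx => y; apply: VWU; exact: nbhs_singleton.
Qed.

Lemma nbhs_orbit (x : S) (U : set S) : nbhs x U -> exists g, U (act g s0).
Proof.
have [_ _ _ _ dS] := ambS => Ux.
have [||y [Uy [g _ gy]]] := dS (interior U).
- by exists x.
- exact: open_interior.
by exists g; rewrite gy; exact: interior_subset.
Qed.

Lemma eq_on_orbit (f h : S -> S) : continuous f -> continuous h ->
  (forall g, f (act g s0) = h (act g s0)) -> f =1 h.
Proof.
move=> fC hC fh x; apply: hS => U V Ux Vx.
have Ufx : nbhs x (f @^-1` U) := fC x U Ux.
have Vhx : nbhs x (h @^-1` V) := hC x V Vx.
have [g [Ug Vg]] := nbhs_orbit (filterI Ufx Vhx).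
by exists (f (act g s0)); split=> //; rewrite fh.
Qed.

Local Notation "p ** q" := (amb_mul act s0 p q) (at level 40, left associativity).

(** The value picked by [xget] is forced: the extension [f] of the orbit map of [q] gives a limit
    along every admissible filter, and the trace on the orbit of the neighbourhoods of [p] is one
    such filter. *)
Lemma amb_mul_extension q : exists2 f : S -> S, continuous f &
  (forall g, f (act g s0) = act g q) /\ forall p, p ** q = f p.
Proof.
have [||||f fC fE] := @orbit_closure_map S act setT q hS cS I; [by []|by []|by []| |].
  move=> g y U _ /nbhs_act[V [W [Vg Wy VWU]]]; exists V, W.
  by split=> // h z Vh Wz _; exact: VWU.
exists f => //; split=> // p.
have fcvg H : ProperFilter H -> act^~ s0 @ H --> p -> act^~ q @ H --> f p.
  move=> HP Hp; have -> : act^~ q = f \o act^~ s0.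
    by apply/funext => g; rewrite /= fE.
  exact: (cvg_comp _ _ Hp (fC p)).
apply: xget_unique => [H|r rP]; first exact: fcvg.
pose H := filter_from (nbhs p) (fun U => [set g | U (act g s0)]).
have HP : ProperFilter H.
  apply: filter_from_proper => [|U /nbhs_orbit[g Ug]]; last by exists g.
  apply: filter_from_filter; first by exists setT; exact: filterT.
  by move=> U V Up Vp; exists (U `&` V) => //; exact: filterI.
have Hp : act^~ s0 @ H --> p by move=> U Up; exists U.
exact: (cvg_unique hS (rP H HP Hp) (fcvg H HP Hp)).
Qed.

Lemma amb_mul_continuous q : continuous (amb_mul act s0 ^~ q).
Proof. by have [f fC [_ fE]] := amb_mul_extension q; rewrite (funext fE). Qed.

Lemma amb_mul_orbit g q : act g s0 ** q = act g q.
Proof. by have [f _ [fg ->]] := amb_mul_extension q; exact: fg. Qed.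

Lemma amb_mul_act g q r : act g q ** r = act g (q ** r).
Proof.
apply: (eq_on_orbit (f := fun q => act g q ** r) (h := fun q => act g (q ** r))).
- by move=> x; exact: (continuous_comp (@act_continuous g x) (@amb_mul_continuous r (act g x))).
- by move=> x; exact: (continuous_comp (@amb_mul_continuous r x) (@act_continuous g (x ** r))).
- by move=> h; rewrite -actM !amb_mul_orbit actM.
Qed.

Lemma amb_mulA p q r : p ** (q ** r) = p ** q ** r.
Proof.
apply: (eq_on_orbit (f := fun p => p ** (q ** r)) (h := fun p => p ** q ** r)).
- exact: amb_mul_continuous.
- by move=> x; exact: (continuous_comp (@amb_mul_continuous q x) (@amb_mul_continuous r (x ** q))).
- by move=> g; rewrite !amb_mul_orbit amb_mul_act.
Qed.

Lemma amb_circP p (A : set S) r : amb_circ act s0 p A r <->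
  forall U V, nbhs p U -> nbhs r V -> exists g a, [/\ A a, U (act g s0) & V (act g a)].
Proof.
split=> [[F [FP FA Fp Fr]] U V Up Vr|H].
  have FU : F [set y | U (act y.1 s0)] := Fp U Up.
  have FV : F [set y | V (act y.1 y.2)] := Fr V Vr.
  by have [[g a] [Aa [Ug Va]]] := filter_ex (filterI FA (filterI FU FV)); exists g, a.
pose b (UV : set S * set S) :=
  [set y : G * S | [/\ A y.2, UV.1 (act y.1 s0) & UV.2 (act y.1 y.2)]].
pose D := [set UV : set S * set S | nbhs p UV.1 /\ nbhs r UV.2].
exists (filter_from D b); split.
- apply: filter_from_proper => [|[U V] [Up Vr]]; last first.
    by have [g [a [Aa Ug Va]]] := H U V Up Vr; exists (g, a).
  apply: filter_from_filter; first by exists (setT, setT); split; exact: filterT.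
  move=> [U V] [U' V'] [Up Vr] [Up' Vr']; exists (U `&` U', V `&` V').
    by split; exact: filterI.
  by move=> [g a] [/= Aa [Ug U'g] [Va V'a]].
- by exists (setT, setT) => [|[g a] []]; first by split; exact: filterT.
- by move=> U Up; exists (U, setT) => [|[g a] []]; first by split=> //; exact: filterT.
- by move=> V Vr; exists (setT, V) => [|[g a] []]; first by split=> //; exact: filterT.
Qed.

Lemma amb_circ_mul p (A : set S) q : A q -> amb_circ act s0 p A (p ** q).
Proof.
move=> Aq; apply/amb_circP => U V Up Vpq.
have Vp : nbhs p [set x | V (x ** q)] := @amb_mul_continuous q p V Vpq.
have [g [Ug Vg]] := nbhs_orbit (filterI Up Vp).
by exists g, q; split=> //; rewrite -amb_mul_orbit.
Qed.

(** First [g] is chosen, then [h] and [a] depending on it, by continuity of [act g]. For [p = q = u]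
    this makes the tau-closure idempotent. *)
Lemma amb_circ_circ p q (A : set S) :
  amb_circ act s0 p (amb_circ act s0 q A) `<=` amb_circ act s0 (p ** q) A.
Proof.
move=> r /amb_circP rP; apply/amb_circP => U V /nbhs_interior Upq /nbhs_interior Vr.
have [g [b [/amb_circP bP Ug Vb]]] := rP _ _ (@amb_mul_continuous q p _ Upq) Vr.
move: Ug; rewrite /= amb_mul_orbit => Ug.
have [h [a [Aa Uh Va]]] := bP _ _ (@act_continuous g q _ Ug) (@act_continuous g b _ Vb).
by exists (g * h)%g, a; split=> //; rewrite actM.
Qed.

End UniversalAmbit.

(** * The Ellis group *)

Definition thick (C : set int) (j : nat) : set int :=
  [set m | exists2 n, C n & (`|(m - n)%R| <= j)%N].

Lemma bohr_quarter D : bohr D -> exists2 E, bohr E &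
  forall a b c d, E a -> E b -> E c -> E d -> D (a + b - c - d).
Proof.
move=> /bohr_half[E /bohr_half[F bF FE] ED]; exists F => // a b c d Fa Fb Fc Fd.
have -> : a + b - c - d = (a - c) - (d - b) by zmod.
by apply: ED; exact: FE.
Qed.

Section Thick.
Variables (K : Type) (N : elementary_extension).
Hypothesis monster : is_monster K N.

(** If [x - emb i] left [comp00] for every integer [i] of absolute value at most [j], these finitely
    many failures would be witnessed by Bohr sets whose intersection contradicts the hypothesis. *)
Lemma thick_comp00Z (x : N) (j : nat) :
  (forall D, bohr D -> ext_pred (thick D j) x) -> x \in comp00Z K N.
Proof.
move=> xD; apply: contrapT => /negP nx.
pose s : seq int := [seq (i%:Z - j%:Z) | i <- iota 0 (j + j).+1].
have /choice[E EP] : forall i : int, exists D, bohr D /\ ~ ext_pred D (x - emb i).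
  move=> i; apply: contrapT => /forallNP nD; move/negP: nx; apply.
  apply: (@comp00Z_emb K N x i); apply/(comp00P monster) => D bD.
  by apply: contrapT => nDx; apply: (nD D).
have bE (t : seq int) : bohr [set m | forall i, i \in t -> E i m].
  elim: t => [|i t IH].
    by apply: bohrS bohrT => m _ i.
  apply: bohrS (bohrI (EP i).1 IH) => m [Eim sm] k.
  by rewrite inE => /orP[/eqP->|/sm].
have [|m []] := starN0 (iffRL (starI _ _ _) (conj (xD _ (bE s))
    (@star_all N int s (fun i => ~` [set m | E i (m - i)]) x _))).
  by move=> i _; apply/starC => /star_shiftB; exact: (EP i).2.
move=> [n Dn mn] /(_ (m - n)) nE.
have ms : m - n \in s.
  apply/mapP; exists (`|(m - n + j%:Z)%R|%N); last by lia.
  by rewrite mem_iota; lia.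
apply: (nE ms) => /=; have -> : m - (m - n) = n by zmod.
exact: Dn.
Qed.

End Thick.

Section EllisGroup.
Variables (K : Type) (N : elementary_extension).
Hypothesis monster : is_monster K N.
Variables (G : topologicalGroupType) (S : topologicalType).
Variables (act : G -> S -> S) (s0 : S).
Hypothesis univ : is_universal_ambit act s0.
Variables (psi : G -> int) (k : nat).

(** A substitute for the preimage of [C] under an extension of [psi] to [S], which does not exist in
    general. *)
Definition level (C : set int) : set S :=
  closure [set act g s0 | g in psi @^-1` C].

Hypothesis psi_quasi : forall g h, (`|(psi (g * h)%g - psi g - psi h)%R| <= k)%N.
Hypothesis psi_surj : forall n, exists g, psi g = n.
Hypothesis level_sep : forall A B p, level A p -> level B p ->
  exists m n, [/\ A m, B n & (`|(m - n)%R| <= k)%N].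

Local Notation "p ** q" := (amb_mul act s0 p q) (at level 40, left associativity).

Implicit Types (A B C : set int) (p q r u : S) (x y z : N).

Lemma levelC C p : ~ level (~` C) p -> nbhs p [set q | exists2 U, nbhs q U &
  forall g, U (act g s0) -> C (psi g)].
Proof.
move=> /existsNP[U /not_implyP[/nbhs_interior Up CU]]; apply: filterS Up => q Uq.
exists U => // g Ug; apply: contrapT => nC; apply: CU.
by exists (act g s0); split=> //; exists g.
Qed.

Lemma level_open C p : ~ level (~` C) p -> exists2 U, nbhs p U &
  forall g, U (act g s0) -> C (psi g).
Proof. by move=> /levelC /nbhs_singleton. Qed.

Lemma levelCP C p : ~ level (~` C) p -> level C p.
Proof.
move=> /level_open[U Up UC] V Vp.
have [g [Ug Vg]] := nbhs_orbit univ (filterI Up Vp).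
by exists (act g s0); split=> //; exists g => //; exact: UC.
Qed.

Lemma level_thick C p : level C p -> ~ level (~` thick C k) p.
Proof.
move=> Cp /(level_sep Cp)[m [n [Cm nC mn]]]; apply: nC; exists m => //.
by lia.
Qed.

(** One [k] is the defect of [psi], the other the separation constant of [level_sep]. *)
Definition sumset A B : set int :=
  [set m | exists a b, [/\ A a, B b & (`|(m - a - b)%R| <= k + k)%N]].

(** Near [p] the values of [psi] are within [k] of [A]. Once [g] and [a] are fixed, [a] is replaced
    by an orbit point so close to it that [act g] still lands near [r]. *)
Lemma level_circ p (T : set S) r A B : amb_circ act s0 p T r ->
  level A p -> T `<=` level B -> level (sumset A B) r.
Proof.
move=> /amb_circP rP /level_thick /level_open[U Up UA] TB V /nbhs_interior Vr.
have [g [a [Ta Ug Va]]] := rP U _ Up Vr.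
have [_ [[h Bh <-] Vgh]] := TB a Ta _ (act_continuous univ (g := g) Va).
have [_ _ actM _ _] := univ.1.
exists (act g (act h s0)); split=> //; exists (g * h)%g; rewrite ?actM //=.
have [a' Aa' ga'] := UA g Ug; exists a', (psi h); split=> //.
by have := psi_quasi g h; lia.
Qed.

Lemma level_mul p q A B : level A p -> level B q -> level (sumset A B) (p ** q).
Proof.
move=> Ap Bq; apply: (level_circ (T := [set q])) Ap _; last by move=> _ ->.
exact: (amb_circ_mul univ).
Qed.

(** [p] and the type of [x] are limits of a common net, up to bounded error. *)
Definition same_limit p x := forall A, ext_pred A x -> level A p.

Lemma same_limit_ex p : exists x, same_limit p x.
Proof.
(* These are the sets containing [psi g] whenever [act g s0] is close enough to [p], so a single [g]
   serves finitely many of them. *)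
pose D := [set A | ~ level (~` A) p].
have smZ := small_range (emb : int -> N) (card_lt_int monster).
have [|s sD|x xP] := saturation_fip (I := set int) (D := D) (F := fun A => ext_pred A) monster smZ.
- by move=> A _; exact: definable_star.
- have /(nbhs_orbit univ)[g gs] : nbhs p [set q | forall A, A \in s ->
      exists2 U, nbhs q U & forall g, U (act g s0) -> A (psi g)].
    by apply: filter_seq_all => A /sD /levelC.
  exists (emb (psi g)) => A /gs[U Ug UA]; apply/star_emb/UA.
  exact: nbhs_singleton.
exists x => A Ax; apply: contrapT => nA.
have : ext_pred (~` A) x by apply: xP; rewrite /D /= setCK.
by move/starC.
Qed.

Lemma same_limit_surj x : exists p, same_limit p x.
Proof.
have [[cS _] _ _ _ _] := univ.1.
pose b A := [set act g s0 | g in psi @^-1` A].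
have FF : ProperFilter (filter_from [set A | ext_pred A x] b).
  apply: filter_from_proper => [|A /starN0[n An]]; last first.
    by have [g gn] := psi_surj n; exists (act g s0); exists g => //=; rewrite gn.
  apply: filter_from_filter; first by exists setT; exact: starT.
  move=> A B Ax Bx; exists (A `&` B); first exact/starI.
  by move=> _ [g [Ag Bg] <-]; split; exists g.
have [p [_ pP]] := cS _ FF filterT.
by exists p => A Ax U Up; apply: (pP _ _ _ Up); exists A.
Qed.

Lemma same_limit_thick p x A : same_limit p x -> level A p -> ext_pred (thick A k) x.
Proof.
move=> px /level_thick nA; apply: contrapT => /starC /px; exact: nA.
Qed.

Lemma same_limit_mul p q x y z : same_limit p x -> same_limit q y ->
  same_limit (p ** q) z -> z - (x + y) \in comp00Z K N.
Proof.
(* Two [k] come from [sumset], the third from [same_limit_thick]. Below, [x] and [y] are replaced by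
   integers [a] and [b] up to the Bohr set [E]. *)
move=> px qy pqz; apply: (thick_comp00Z monster (j := k + k + k)) => D /bohr_quarter[E bE ED].
have [s sP] := bohr_syndetic bE.
have [a _ /(iffRL (star_shiftB E _ _)) xa] := syndetic_star sP x.
have [b _ /(iffRL (star_shiftB E _ _)) yb] := syndetic_star sP y.
have zP := same_limit_thick pqz (level_mul (px _ xa) (qy _ yb)).
have xyP := @starD N _ _ [set m | exists c d, [/\ E c, E d & m = c + a + (d + b)]] _ x y xa yb.
apply: starB zP (xyP _) => [m n [l [c [d [/= Ec Ed lcd]]] ml] [c' [d' [Ec' Ed' ->]]]|m n /= Em En].
  exists ((c - a) + (d - b) - c' - d'); first exact: ED.
  by lia.
by exists (m - a), (n - b); rewrite !subrK.
Qed.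


Section MinimalIdeal.
Variables (M : set S) (u : S).
Hypothesis minM : minimal_left_ideal act s0 M.
Hypothesis Mu : M u.
Hypothesis uu : u ** u = u.

Local Notation E := (Ellis_group act s0 M u).

Let mulM p q : M q -> M (p ** q). Proof. by have [[_ H] _] := minM; exact: H. Qed.

Lemma Ellis_sub p : E p -> M p.
Proof. by move=> [m Mm <-]; exact: mulM. Qed.

Lemma Ellis_u : E u.
Proof. by exists u. Qed.

Lemma Ellis_mul p q : E p -> E q -> E (p ** q).
Proof.
move=> [m Mm <-] Eq; exists (m ** q); first exact/mulM/Ellis_sub.
exact: (amb_mulA univ).
Qed.

Lemma Ellis_mulu p : E p -> u ** p = p.
Proof. by move=> [m Mm <-]; rewrite (amb_mulA univ) uu. Qed.

(** The products of elements of [M] with [q] form a left ideal inside [M], which by minimality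
    contains [u]. *)
Lemma Ellis_inv q : E q -> exists2 p, E p & p ** q = u.
Proof.
move=> /[dup] Eq /Ellis_sub Mq; have [_ min] := minM.
have idl : left_ideal act s0 [set m ** q | m in M].
  split; first by exists (u ** q); exists u.
  by move=> r _ [m Mm <-]; exists (r ** m); [exact: mulM|rewrite -(amb_mulA univ)].
have [m Mm mq] : [set m ** q | m in M] u.
  by rewrite (min _ idl) // => _ [m Mm <-]; exact: mulM.
by exists (u ** m); [by exists m|rewrite -(amb_mulA univ) mq uu].
Qed.

Lemma same_limit_idem x : same_limit u x -> x \in comp00Z K N.
Proof.
move=> ux; have := same_limit_mul ux ux; rewrite uu => /(_ _ ux).
have -> : x - (x + x) = - x by zmod.
by rewrite rpredN.
Qed.

Lemma same_limit_tau_H r z :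
  tau_H act s0 M u r -> same_limit r z -> z \in comp00Z K N.
Proof.
move=> rH rz; have [x ux] := same_limit_ex u.
(* Although [u] is idempotent, bounded errors let its limit differ from 0 by an integer [n0], and
   sets attached to [u] are shifted accordingly. *)
have /asboolP[n0 /(comp00P monster) xn0] := same_limit_idem ux.
have level_u D : bohr D -> level [set m | D (m - n0)] u.
  by move=> bD; apply: ux; apply/star_shiftB; exact: xn0.
(* The total is [3 * k] from the thickening in [A], [2 * k] from [sumset], [k] from
   [same_limit_thick], and the shift [n0]. *)
apply: (thick_comp00Z monster (j := 6 * k + `|n0|)) => D0 /bohr_quarter[D bD DD0].
have [D' bD' DD] := bohr_half bD.
(* The points to be kept away from [u]. If [u] were in their tau-closure, its limit would be reached
   in two ways, with an error of [2 * k] from [sumset] and [k] from [level_sep]; hence [3 * k]. *)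
pose A : set S := E `&` ~` level (thick D (3 * k)).
have A_level : A `<=` level (~` thick D (3 * k)).
  by move=> q [_ nq]; apply: levelCP; rewrite setCK.
have nuA : ~ amb_circ act s0 u A u.
  move=> /level_circ /(_ (level_u D' bD') A_level) uD'.
  have [m [n [[a [b [Da nb mab]]] Dn mn]]] := level_sep uD' (level_u D' bD').
  apply: nb; exists (n - n0 - (a - n0)); first exact: DD.
  by lia.
pose U := E `\` tau_closure act s0 M u A.
have EU : E `\` U = tau_closure act s0 M u A.
  by rewrite setDD; apply/seteqP; split=> [q []//|q []].
have nbhsU : tau_nbhs1 act s0 M u U.
  split; first by move=> q [].
  exists U; split=> //; last by split; [exact: Ellis_u|move=> []].
  split; first by move=> q [].
  rewrite EU; split; first by move=> q [].
  apply/seteqP; split=> q [Eq qA]; split=> //.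
    rewrite -uu; apply: (amb_circ_circ univ).
    move: qA => /amb_circP qA; apply/amb_circP => V W Vu Wq.
    by have [g [a [[_ Aa] Vg Wa]]] := qA V W Vu Wq; exists g, a.
  by rewrite -(Ellis_mulu Eq); apply: (amb_circ_mul univ); split.
have [_ rU] := rH U nbhsU.
(* [A] lies in its own tau-closure because [u ** q = q] on the Ellis group. *)
have U_level : U `<=` level (thick D (3 * k)).
  move=> q [Eq nq]; apply: contrapT => nDq; apply: nq; split=> //.
  by rewrite -(Ellis_mulu Eq); apply: (amb_circ_mul univ).
have rD := level_circ rU (level_u D' bD') U_level.
apply: starS (same_limit_thick rz rD) => m [l [a [b [Da [d Dd bd] lab]]] ml].
exists (a - n0 + d - 0 - 0); last by lia.
apply: DD0 => //; try exact: bohr0.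
by rewrite -[_ - n0]subr0; apply: DD => //; exact: bohr0.
Qed.

Variables (B : topologicalGroupType) (pi : S -> B).
Hypothesis quot_pi : is_Ellis_quotient act s0 M u pi.

Let pi_mul p q : E p -> E q -> pi (p ** q) = (pi p * pi q)%g.
Proof. by have [piM _ _ _] := quot_pi; move=> Ep Eq; apply: piM; exact: mem_set. Qed.

Let pi_u : pi u = 1%g.
Proof.
have := pi_mul Ellis_u Ellis_u; rewrite uu => e.
by apply: (mulgI (pi u)); rewrite mulg1 -e.
Qed.

Lemma same_limit_quot p q x y : E p -> E q -> pi p = pi q ->
  same_limit p x -> same_limit q y -> x - y \in comp00Z K N.
Proof.
move=> Ep Eq pq px qy; have [q' Eq' q'q] := Ellis_inv Eq.
have [w qw] := same_limit_ex q'; have [v qpv] := same_limit_ex (q' ** p).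
have [t ut] := same_limit_ex u.
have vH : v \in comp00Z K N.
  apply: same_limit_tau_H qpv; have [_ _ piH _] := quot_pi.
  by apply/(piH _ (Ellis_mul Eq' Ep)); rewrite pi_mul // pq -pi_mul // q'q pi_u.
have tH := same_limit_idem ut.
have H1 := same_limit_mul qw px qpv.
have := same_limit_mul qw qy; rewrite q'q => /(_ _ ut) H2.
have -> : x - y = (t - (w + y)) - (v - (w + x)) + (v - t) by zmod.
by rewrite rpredD // rpredB.
Qed.

Lemma Ellis_quotient_hom : exists f : B -> {quot comp00Z K N},
  {morph f : x y / (x * y)%g >-> x + y} /\ range f = setT.
Proof.
have [_ piE _ _] := quot_pi.
have /choice[l lP] : forall b : B, exists px : S * N,
    [/\ E px.1, pi px.1 = b & same_limit px.1 px.2].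
  move=> b; have [p Ep pb] : (pi @` E) b by rewrite piE.
  by have [x px] := same_limit_ex p; exists (p, x).
pose f b := \pi_({quot comp00Z K N}) (l b).2.
have fP p x : E p -> same_limit p x -> f (pi p) = \pi x.
  move=> Ep px; have [El pil lx] := lP (pi p).
  by apply/eqP; rewrite -Quotient.idealrBE; exact: same_limit_quot lx px.
have lift b : exists p x, [/\ E p, pi p = b & same_limit p x].
  by exists (l b).1, (l b).2.
exists f; split=> [b c|].
  have [[p [x [Ep <- px]]] [q [y [Eq <- qy]]]] := (lift b, lift c).
  have [z pqz] := same_limit_ex (p ** q).
  rewrite -pi_mul // (fP _ _ (Ellis_mul Ep Eq) pqz) (fP _ _ Ep px) (fP _ _ Eq qy).
  rewrite -raddfD; apply/eqP; rewrite -Quotient.idealrBE.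
  exact: same_limit_mul px qy pqz.
apply/seteqP; split=> // q _; have [p px] := same_limit_surj (repr q).
(* Multiplying by [u] on both sides moves any point of [S] into the Ellis group and changes its
   limit by an element of [comp00Z] only. *)
have Mpu : M (p ** u) by exact: mulM.
have [t ut] := same_limit_ex u; have tH := same_limit_idem ut.
have [y puy] := same_limit_ex (p ** u).
have [z upuz] := same_limit_ex (u ** (p ** u)).
exists (pi (u ** (p ** u))) => //.
have Eupu : E (u ** (p ** u)) by exists (p ** u).
rewrite (fP _ _ Eupu upuz) -[q]reprK; apply/eqP; rewrite -Quotient.idealrBE.
have H1 := same_limit_mul px ut puy.
have H2 := same_limit_mul ut puy upuz.
have -> : z - repr q = (z - (t + y)) + (y - (repr q + t)) + (t + t) by zmod.
by apply: rpredD; apply: rpredD.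
Qed.

End MinimalIdeal.

End EllisGroup.

(** * Uniformly continuous functions on an ambit *)

Lemma closure_le (R : realType) (T : topologicalType) (Y : set T) (phi : T -> R)
    (a : R) : continuous phi -> (forall y, Y y -> phi y <= a) ->
  forall y, closure Y y -> phi y <= a.
Proof.
move=> phiC phia y Yy; rewrite leNgt; apply/negP => ya.
have : nbhs y (phi @^-1` [set x | a < x]).
  by apply: phiC; apply: open_nbhs_nbhs; split=> //; exact: open_gt.
by move=> /Yy[z [/phia za /=]]; rewrite ltNge za.
Qed.

Section FunctionAmbit.
Variables (R : realType) (G : topologicalGroupType) (S : topologicalType).
Variables (act : G -> S -> S) (s0 : S).
Hypothesis univ : is_universal_ambit act s0.
Variables (f : G -> R) (c : R).
Hypothesis fc : forall g, `|f g| <= c.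
Hypothesis f_unif : forall e : R, 0 < e ->
  nbhs (1%g : G) [set v | forall g, `|f (v * g)%g - f g| <= e].

Local Notation T := {ptws G -> R}.

(** Every modulus of continuity of [f] under left translation is imposed on all members. This
    equicontinuity makes right translation jointly continuous on [Y]. *)
Let Y : set T := [set F | (forall h, `|F h| <= c) /\
  forall v e, (forall w, `|f (v * w)%g - f w| <= e) ->
    forall w, `|F (v * w)%g - F w| <= e].

Let eval_continuous (h : G) : continuous (fun F : T => F h).
Proof. by move=> F; have /pointwise_cvgP/(_ h) : {ptws, nbhs F --> F} by []. Qed.

Let dist_continuous (g h : G) : continuous (fun F : T => F g - F h).
Proof.
move=> F; have Fg := @eval_continuous g F; have Fh := @eval_continuous h F.
exact: (@cvgB R R^o _ _ _ _ _ _ _ Fg Fh).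
Qed.

Let Y_closed : closed Y.
Proof.
move=> F YF; split=> [h|v e fe w].
  rewrite ler_norml; apply/andP; split.
    rewrite lerNl; apply: (closure_le (phi := fun F : T => - F h) _ _ YF) => [y|y [+ _]].
      exact: (@cvgN R R^o _ _ _ _ _ (@eval_continuous h y)).
    by move=> /(_ h); rewrite ler_norml lerNl => /andP[].
  apply: (closure_le (@eval_continuous h) _ YF) => y [+ _].
  by move=> /(_ h); rewrite ler_norml => /andP[].
rewrite ler_distl; apply/andP; split.
  rewrite lerBlDr -lerBlDl.
  apply: (closure_le (@dist_continuous w (v * w)%g) _ YF) => y [_ /(_ v e fe w)].
  by rewrite ler_distlC => /andP[_]; rewrite lerBlDl.
rewrite -lerBlDl; apply: (closure_le (@dist_continuous (v * w)%g w) _ YF) => y [_ /(_ v e fe w)].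
by rewrite ler_distl => /andP[_]; rewrite lerBlDl.
Qed.

Let Y_compact : compact Y.
Proof.
apply: (subclosed_compact Y_closed (B := [set F : T | forall h, `[- c, c]%classic (F h)])).
  apply: (@tychonoff G (fun=> R) (fun=> `[- c, c]%classic)) => _.
  exact: segment_compact.
by move=> F [Fc _] h; rewrite /= in_itv /= -ler_norml.
Qed.

(** Right translates of [f] generate an ambit of functions; the extension of [f] is the map to this
    ambit followed by evaluation at [1]. *)
Lemma uniform_extension :
  exists2 F : S -> R, continuous F & forall g, F (act g s0) = f g.
Proof.
pose actT (g : G) (F : T) : T := fun h => F (h * g)%g.
have [||||||F FC FE] := @orbit_closure_map _ _ _ _ univ T actT Y f _ Y_compact.
- by apply: hausdorff_product => _; exact: norm_hausdorff.
- by split=> [h|v e fe w]; [exact: fc|exact: fe].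
- move=> g F [Fc FY]; split=> [h|v e fe w]; first exact: Fc.
  by rewrite /actT -mulgA; exact: FY.
- by move=> F _; apply/funext => h; rewrite /actT mulg1.
- by move=> g h F _; apply/funext => x; rewrite /actT mulgA.
- move=> g F U YF UgF.
  pose H := within [set z : G * T | Y z.2] (nbhs (g, F)).
  have FH : Filter H by exact: within_filter.
  suff : {ptws, (fun z : G * T => actT z.1 z.2) @ H --> actT g F}.
    move=> /(_ U UgF)[[V W] /= [Vg WF] VWU]; exists V, W; split=> // h z Vh Wz Yz.
    exact: (VWU (h, z)).
  apply/pointwise_cvgP => h; apply/cvgrPdist_le => e e0.
  have e2 : 0 < e / 2 by rewrite divr_gt0.
  (* For [w = h * g] the product is [h * x], so a right translation near [g] is turned into a left
     translation near [1], uniformly on [Y]. *)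
  pose V := [set x | forall w, `|f (h * (x * (g^-1 * h^-1)) * w)%g - f w| <= e / 2].
  have Vg : nbhs g V.
    have := f_unif e2; rewrite -[1%g](mulgV (h * g)%g) invgM -mulgA.
    by move=> /nbhs_lmul /nbhs_rmul.
  have WF : nbhs F [set z : T | `|F (h * g)%g - z (h * g)%g| <= e / 2].
    by have /cvgrPdist_le/(_ _ e2) := @eval_continuous (h * g)%g F.
  exists (V, [set z : T | `|F (h * g)%g - z (h * g)%g| <= e / 2]) => //.
  move=> [x z] /= [Vx Wz] [_ Yz].
  have := Yz _ _ Vx (h * g)%g; rewrite -!mulgA mulKg mulVg mulg1 distrC => zxg.
  rewrite /actT /= (_ : F (h * g)%g - z (h * x)%g =
    (F (h * g)%g - z (h * g)%g) + (z (h * g)%g - z (h * x)%g)); last by zmod.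
  by rewrite [leRHS]splitr (le_trans (ler_normD _ _)) // lerD.
exists (fun s => F s 1%g).
  by move=> s; exact: (continuous_comp (FC s) (@eval_continuous 1%g (F s))).
by move=> g; rewrite FE /actT mul1g.
Qed.

End FunctionAmbit.

Section LevelSeparation.
Variables (R : realType) (A : set int).

(** The element 2 truncates the distance and gives it a value for empty [A]; it is the lower bound
    that [floor_level_sep] needs on the far set. *)
Let dist_set (t : R) : set R := [set 2] `|` [set `|t - n%:~R| | n in A].

Definition distA (t : R) : R := inf (dist_set t).

Let dist_set_lb t : has_lbound (dist_set t).
Proof. by exists 0 => _ [->|[n _ <-]]. Qed.

Let dist_set0 t : dist_set t !=set0.
Proof. by exists 2; left. Qed.

Lemma distA_ge0 t : 0 <= distA t.
Proof. by apply: lb_le_inf => // _ [->|[n _ <-]]. Qed.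

Lemma distA_le2 t : distA t <= 2.
Proof. by apply: ge_inf => //; left. Qed.

Lemma distA_le t n : A n -> distA t <= `|t - n%:~R|.
Proof. by move=> An; apply: ge_inf => //; right; exists n. Qed.

Lemma distA_ge t : (forall n, A n -> 2 <= `|t - n%:~R|) -> 2 <= distA t.
Proof. by move=> tA; apply: lb_le_inf => // _ [->|[n An <-]] //; exact: tA. Qed.

Lemma distA_lipschitz t s : `|distA t - distA s| <= `|t - s|.
Proof.
have H x y : distA x - `|x - y| <= distA y.
  apply: lb_le_inf => // _ [->|[n An <-]].
    by rewrite lerBlDr (le_trans (distA_le2 x)) // lerDl.
  rewrite lerBlDr (le_trans (distA_le x An)) //.
  have -> : x - n%:~R = (y - n%:~R) + (x - y) by zmod.
  exact: ler_normD.
by rewrite ler_distlC; have := H t s; have := H s t; rewrite distrC; lra.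
Qed.

End LevelSeparation.

(** The truncated distance from [theta] to [A] extends to [S]. Floors lose at most 1, so the
    extension is at most 1 on the level of [A], and at least 2 on that of [B] if [A] and [B] are at
    least 3 apart. *)
Lemma floor_level_sep (R : realType) (G : topologicalGroupType)
    (S : topologicalType) (act : G -> S -> S) (s0 : S) (theta : G -> R)
    (A B : set int) (p : S) : is_universal_ambit act s0 ->
  (forall e : R, 0 < e ->
    nbhs (1%g : G) [set v | forall g, `|theta (v * g)%g - theta g| <= e]) ->
  level act s0 (fun g => Num.floor (theta g)) A p ->
  level act s0 (fun g => Num.floor (theta g)) B p ->
  exists m n, [/\ A m, B n & (`|(m - n)%R| <= 2)%N].
Proof.
move=> univ theta_unif Ap Bp; apply: contrapT => nAB.
have far m n : A m -> B n -> (2 < `|(m - n)%R|)%N.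
  by move=> Am Bn; rewrite ltnNge; apply/negP => mn; apply: nAB; exists m, n.
have [||F FC FE] := uniform_extension univ (f := fun g => distA A (theta g)) (c := 2).
- by move=> g; rewrite ger0_norm ?distA_ge0 ?distA_le2.
- move=> e /theta_unif; apply: filterS => v ve g.
  by rewrite (le_trans (distA_lipschitz _ _ _)).
have FA : F p <= 1.
  apply: (closure_le FC _ Ap) => _ [g /= Ag <-]; rewrite FE.
  apply: le_trans (distA_le _ Ag) _; have := floor_itv (theta g).
  by move=> /andP[H1 H2]; rewrite ler_norml; rewrite intrD in H2; lra.
have FB : - F p <= - 2.
  apply: (@closure_le _ _ _ (fun s => - F s) _ _ _ _ Bp) => [s|_ [g /= Bg <-]].
    by apply: cvgN; exact: FC.
  rewrite FE lerN2; apply: distA_ge => n An; have := far _ _ An Bg.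
  have /andP[H1 H2] := floor_itv (theta g); rewrite intrD in H2.
  move: (Num.floor (theta g)) H1 H2 => m H1 H2 nm.
  have [mn|mn] : n + 3 <= m \/ m + 3 <= n by lia.
    have : (n + 3)%:~R <= m%:~R :> R by rewrite ler_int.
    by rewrite intrD => ?; rewrite ler_normr; apply/orP; left; lra.
  have : (m + 3)%:~R <= n%:~R :> R by rewrite ler_int.
  by rewrite intrD => ?; rewrite ler_normr; apply/orP; right; lra.
lra.
Qed.

(** * The topology of SL2 and of its cover *)

Lemma det_mx22 (F : comNzRingType) (A : 'M[F]_2) :
  \det A = A 0 0 * A 1 1 - A 0 1 * A 1 0.
Proof.
rewrite (expand_det_row _ 0) !big_ord_recl big_ord0 addr0 /cofactor !det_mx11 !mxE.
rewrite /= expr0 mul1r expr1 mulN1r mulrN.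
by congr (_ * A _ _ - A _ _ * A _ _); apply: val_inj.
Qed.

Section SL2Topology.
Variable R : realType.
Implicit Types (A B : SL2 R) (e : R).

Lemma nbhs_SL2P A (U : set (SL2 R)) : nbhs A U <->
  exists2 e : R, 0 < e & forall B, (forall i j, `|A i j - B i j| < e) -> U B.
Proof.
split=> [[_ /= [[W oW <-] WA WU]]|[e e0 eU]].
  have /nbhs_ballP[e /= e0 eW] := open_nbhs_nbhs (conj oW WA).
  by exists e => // B AB; apply/WU/eW; split=> // i j; exact: AB.
have : nbhs A (@SL2val R @^-1` ball (SL2val A) e).
  by apply: (@initial_continuous (SL2 R) _ (@SL2val R) A); exact: nbhsx_ballx.
by apply: (@filterS _ (nbhs A)) => B [_ AB]; apply: eU => i j; exact: AB.
Qed.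

Lemma SL2_entry_continuous (i j : 'I_2) : continuous (fun A : SL2 R => A i j).
Proof.
move=> A U /nbhs_ballP[e /= e0 eU]; apply/nbhs_SL2P; exists e => // B AB.
exact/eU/AB.
Qed.

Lemma cvg_SL2 (T : Type) (F : set_system T) {FF : Filter F} (f : T -> SL2 R) A :
  (forall i j, f t i j @[t --> F] --> A i j) -> f @ F --> A.
Proof.
move=> fA U /nbhs_SL2P[e e0 eU].
have H i j : F [set t | `|A i j - f t i j| < e].
  by have /cvgrPdist_lt/(_ e e0) := fA i j.
have : F [set t | forall ij, ij \in enum {: 'I_2 * 'I_2} ->
    `|A ij.1 ij.2 - f t ij.1 ij.2| < e].
  by apply: filter_seq_all => ij _; exact: H.
move=> FtP; change (F [set t | U (f t)]); apply: filterS FtP => t tP.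
by apply: eU => i j; apply: (tP (i, j)); rewrite mem_enum.
Qed.

Lemma det_SL2 A : A 0 0 * A 1 1 - A 0 1 * A 1 0 = 1.
Proof. by have := SL2_det A; rewrite det_mx22. Qed.

Lemma SL2_mulE A B i j : (A * B)%g i j = A i 0 * B 0 j + A i 1 * B 1 j.
Proof.
rewrite [LHS]mxE !big_ord_recl big_ord0 addr0.
by congr (_ + A _ _ * B _ _); apply: val_inj.
Qed.

Lemma SL2_1E i j : (1%g : SL2 R) i j = (i == j)%:R.
Proof. by rewrite [LHS]mxE. Qed.

Definition mx22 (a b c d : R) : 'M[R]_2 :=
  \matrix_(i, j) if i == 0 then (if j == 0 then a else b)
                 else (if j == 0 then c else d).

Lemma SL2_ex (a b c d : R) : a * d - b * c = 1 ->
  exists A : SL2 R, [/\ A 0 0 = a, A 0 1 = b, A 1 0 = c & A 1 1 = d].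
Proof.
move=> abcd; have det1 : \det (mx22 a b c d) == 1.
  by rewrite det_mx22 !mxE abcd.
by exists (MkSL2 det1); rewrite /= !mxE.
Qed.

Lemma ord2P (P : 'I_2 -> Prop) : P 0 -> P 1 -> forall i, P i.
Proof.
by move=> P0 P1 [[|[|//]] i2]; [move: P0|move: P1]; congr P; apply: val_inj.
Qed.

Lemma ord2_cases (i : 'I_2) : i = 0 \/ i = 1.
Proof. by move: i; apply: ord2P; [left|right]. Qed.

Lemma SL2_eqP A B : A 0 0 = B 0 0 -> A 0 1 = B 0 1 -> A 1 0 = B 1 0 ->
  A 1 1 = B 1 1 -> A = B.
Proof.
move=> h00 h01 h10 h11; apply/val_inj/matrixP => i j.
by move: i j; apply: ord2P; apply: ord2P.
Qed.

End SL2Topology.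

(** * Small paths and a local section of the cover *)

Section Clamp.
Variable R : realType.
Implicit Types t : R.

(** Precomposition with this retraction turns maps continuous on the unit interval into maps
    continuous on the line. *)
Definition clamp t : R := Num.max 0 (Num.min 1 t).

Lemma clamp_itv t : 0 <= clamp t <= 1.
Proof. by rewrite /clamp le_max lexx /= ge_max ler01 /= ge_min lexx. Qed.

Lemma clamp_id t : 0 <= t <= 1 -> clamp t = t.
Proof. by move=> /andP[t0 t1]; rewrite /clamp min_r // max_r. Qed.

Lemma clamp0 : clamp 0 = 0. Proof. by rewrite clamp_id // lexx ler01. Qed.

Lemma clamp1 : clamp 1 = 1. Proof. by rewrite clamp_id // lexx ler01. Qed.

Lemma clamp_continuous : continuous clamp.
Proof.
apply: (@max_fun_continuous _ _ R) => [t|]; first exact: cvg_cst.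
by apply: (@min_fun_continuous _ _ R) => t; [exact: cvg_cst|exact: cvg_id].
Qed.

End Clamp.

(** Three entries are interpolated linearly and the determinant forces the fourth, the upper left
    entry staying away from 0. *)
Lemma small_SL2_path (R : realType) (W : set (SL2 R)) : nbhs (1%g : SL2 R) W ->
  nbhs (1%g : SL2 R) [set A | exists f : R -> SL2 R,
    [/\ continuous f, f 0 = 1%g, f 1 = A & forall t, W (f t)]].
Proof.
move=> /nbhs_SL2P[e e0 eW]; apply/nbhs_SL2P.
(* The bound 1/4 keeps the upper left entry above 3/4, and [e / 4] leaves room for the quotient in
   the lower right entry. *)
pose e' := Num.min (4%:R^-1) (e / 4%:R).
have e'0 : 0 < e' by rewrite lt_min; apply/andP; split; lra.
have [e'4 e'e] : e' <= 4^-1 /\ e' <= e / 4 by rewrite !ge_min !lexx orbT.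
exists e' => // A AP.
have [Ha Hb Hc] : [/\ `|1 - A 0 0| < e', `|A 0 1| < e' & `|A 1 0| < e'].
  by have := (AP 0 0, AP 0 1, AP 1 0); rewrite !SL2_1E /= !sub0r !normrN => -[[]].
have detA := det_SL2 A.
move: (A 0 0) (A 0 1) (A 1 0) (A 1 1) (@SL2_eqP R A) Ha Hb Hc detA => a b c d Aeq.
move=> Ha Hb Hc detA.
have a_neq0 t : 1 + clamp t * (a - 1) != 0.
  rewrite gt_eqF //; have := clamp_itv t; move: Ha; rewrite ltr_norml; nra.
have /choice[f fP] : forall t, exists B : SL2 R, [/\ B 0 0 = 1 + clamp t * (a - 1),
    B 0 1 = clamp t * b, B 1 0 = clamp t * c &
    B 1 1 = (1 + clamp t * b * (clamp t * c)) / (1 + clamp t * (a - 1))].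
  by move=> t; apply: SL2_ex; rewrite mulrC divfK // addrK.
have c_cont (x : R) : continuous (fun t => clamp t * x).
  by move=> t; apply: cvgM; [exact: clamp_continuous|exact: cvg_cst].
have a_cont : continuous (fun t : R => 1 + clamp t * (a - 1)).
  by move=> t; apply: cvgD; [exact: cvg_cst|exact: c_cont].
have fC i j : continuous (fun t => f t i j).
  move: i j; apply: ord2P; apply: ord2P.
  - suff -> : (fun t => f t 0 0) = fun t => 1 + clamp t * (a - 1) by [].
    by apply/funext => t; have [] := fP t.
  - suff -> : (fun t => f t 0 1) = fun t => clamp t * b by [].
    by apply/funext => t; have [] := fP t.
  - suff -> : (fun t => f t 1 0) = fun t => clamp t * c by [].
    by apply/funext => t; have [] := fP t.
  - suff -> : (fun t => f t 1 1) =
      fun t => (1 + clamp t * b * (clamp t * c)) / (1 + clamp t * (a - 1)).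
      move=> t; apply: cvgM; last by apply: cvgV; [exact: a_neq0|exact: a_cont].
      by apply: cvgD; [exact: cvg_cst|apply: cvgM; exact: c_cont].
    by apply/funext => t; have [] := fP t.
exists f; split.
- by move=> t; apply: cvg_SL2 => i j; exact: fC.
- have [h00 h01 h10 h11] := fP 0; apply: SL2_eqP;
    by rewrite SL2_1E ?h00 ?h01 ?h10 ?h11 clamp0 !mul0r ?addr0 ?divr1.
- have [k00 k01 k10 k11] := fP 1; symmetry; apply: Aeq;
    rewrite ?k00 ?k01 ?k10 ?k11 clamp1 ?mul1r ?[1 + _]addrC ?subrK //.
  have a0 : a != 0 by have := a_neq0 1; rewrite clamp1 mul1r addrC subrK.
  by rewrite -detA [b * c + _]addrC subrK mulrC mulKf.
- move=> t; apply: eW; have [h00 h01 h10 h11] := fP t.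
  have := clamp_itv t; set u := clamp t in h00 h01 h10 h11 * => /andP[u0 u1].
  have small x : `|x| < e' -> `|u * x| < e'.
    by apply: le_lt_trans; rewrite normrM (ger0_norm u0) ler_piMl.
  have x_small : `|u * (a - 1)| < e' by apply: small; rewrite distrC.
  have {small} [y_small z_small] := (small _ Hb, small _ Hc).
  move: (u * (a - 1)) (u * b) (u * c) x_small y_small z_small h00 h01 h10 h11.
  move=> x y z x_small y_small z_small h00 h01 h10 h11.
  apply: ord2P; apply: ord2P; rewrite SL2_1E ?h00 ?h01 ?h10 ?h11 /=.
  + by move: x_small; rewrite !ltr_norml => /andP[]; lra.
  + by move: y_small; rewrite !ltr_norml => /andP[]; lra.
  + by move: z_small; rewrite !ltr_norml => /andP[]; lra.
  + have D0 : 3 / 4 < 1 + x by move: x_small; rewrite ltr_norml => /andP[]; lra.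
    have -> : 1 - (1 + y * z) / (1 + x) = (x - y * z) / (1 + x) by field; lra.
    have D_gt0 : 0 < 1 + x by lra.
    rewrite normrM normfV (gtr0_norm D_gt0) ltr_pdivrMr //.
    have yz : `|y * z| <= e' * e' by rewrite normrM ler_pM // ltW.
    have := ler_normB x (y * z); nra.
Qed.

Section Cover.
Variables (R : realType) (G : topologicalGroupType) (p : G -> SL2 R).
Hypothesis hG : is_universal_cover_SL2 p.

Lemma cover_mul x y : p (x * y)%g = (p x * p y)%g.
Proof. by have [+ _ _] := hG; apply. Qed.

Lemma cover_1 : p 1%g = 1%g.
Proof. by apply: (mulgI (p 1%g)); rewrite -cover_mul !mulg1. Qed.

Lemma cover_inv x : p x^-1%g = (p x)^-1%g.
Proof. by apply: (mulgI (p x)); rewrite -cover_mul !mulgV cover_1. Qed.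

Lemma cover_surj A : exists x, p x = A.
Proof.
have [_ [_ pT _] _] := hG.
by have [x _ <-] : range p A by [rewrite pT]; exists x.
Qed.

Lemma cover_continuous : continuous p.
Proof. by have [_ []] := hG. Qed.

(** On an evenly covered neighbourhood of 1, [s] inverts [p] restricted to the sheet through 1;
    sheets being mapped openly, [s] is continuous there. *)
Lemma local_section : exists s : SL2 R -> G, [/\ s 1%g = 1%g,
  nbhs (1%g : G) [set v | s (p v) = v] &
  nbhs (1%g : SL2 R) [set A | p (s A) = A /\ {for A, continuous s}]].
Proof.
have [_ [_ _ /(_ 1%g)[U [oU U1 [I [V [_ pU oV bijV openV]]]]]] _] := hG.
have [i _ Vi1] : (\bigcup_i V i) 1%g by rewrite -pU /= cover_1.
have [VU injV surjV] := bijV i.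
have /choice[s sP] : forall A, exists x, U A -> V i x /\ p x = A.
  move=> A; have [UA|nU] := pselect (U A); last by exists 1%g.
  by have [x Vx xA] := surjV A UA; exists x.
have sp v : V i v -> s (p v) = v.
  by move=> Vv; have [Vs ps] := sP _ (VU _ Vv); apply: injV; rewrite ?inE.
exists s; split.
- by rewrite -[RHS]sp // cover_1.
- by apply: filterS (open_nbhs_nbhs (conj (oV i) Vi1)) => v; exact: sp.
- apply: filterS (open_nbhs_nbhs (conj oU U1)) => A UA.
  have [VsA psA] := sP A UA; split=> // W.
  rewrite nbhsE => -[W' [oW W's W'W]].
  have : nbhs A (p @` (W' `&` V i)).
    apply: open_nbhs_nbhs; split; last by exists (s A); [split|].
    by apply: (openV i); [exact: openI|move=> x []].
  by apply: filterS => _ [v [W'v Vv] <-]; rewrite /= sp //; exact: W'W.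
Qed.

Lemma small_path (W : set (SL2 R)) : nbhs (1%g : SL2 R) W ->
  nbhs (1%g : G) [set v | exists f : R -> G,
    [/\ continuous f, f 0 = 1%g, f 1 = v & forall t, W (p (f t))]].
Proof.
move=> W1; have [s [s1 sp sc]] := local_section.
have FS : Filter (nbhs (1%g : SL2 R)) by exact: nbhs_filter.
pose Q : set (SL2 R) := [set A | exists f : R -> SL2 R,
    [/\ continuous f, f 0 = 1%g, f 1 = A & forall t,
      (W `&` [set A | p (s A) = A /\ {for A, continuous s}]) (f t)]].
have Q1 : nbhs (p 1%g) Q by rewrite cover_1; exact: small_SL2_path (filterI W1 sc).
have pv : nbhs (1%g : G) (p @^-1` Q) := @cover_continuous 1%g Q Q1.
apply: filterS (filterI sp pv) => v [spv [f [fC f0 f1 fW]]].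
exists (s \o f); split.
- by move=> t; apply: continuous_comp; [exact: fC|have [_ []] := fW t].
- by rewrite /= f0 s1.
- by rewrite /= f1.
- by move=> t /=; have [Wft [-> _]] := fW t.
Qed.

End Cover.

(** * Lifting the argument *)

Section Argument.
Variable R : realType.
Implicit Types x y a b t : R.

Definition is_arg x y a := exists r, [/\ 0 < r, x = r * cos a & y = r * sin a].

(** Real and imaginary parts of the conjugate of [x + i y] times [x' + i y']. *)
Lemma is_arg_dot x y x' y' a b : is_arg x y a -> is_arg x' y' b ->
  exists r, [/\ 0 < r, x * x' + y * y' = r * cos (b - a) &
    x * y' - y * x' = r * sin (b - a)].
Proof.
move=> [r [r0 -> ->]] [s [s0 -> ->]]; exists (r * s).
by rewrite mulr_gt0 // cosB sinB; split=> //; ring.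
Qed.

Lemma is_arg_cos x y a b : is_arg x y a -> is_arg x y b -> cos (b - a) = 1.
Proof.
move=> [r [r0 -> ->]] [s [s0 rc rs]].
have ca := cos2Dsin2 a; have cb := cos2Dsin2 b; rewrite cosB.
have rs_eq : r ^+ 2 = s ^+ 2.
  have -> : r ^+ 2 = (r * cos a) ^+ 2 + (r * sin a) ^+ 2 by rewrite !exprMn -mulrDr ca mulr1.
  by rewrite rc rs !exprMn -mulrDr cb mulr1.
have {rs_eq} rs_eq : r = s.
  by apply/eqP; rewrite -(@eqrXn2 _ 2) ?(ltW r0) ?(ltW s0) //; apply/eqP.
have r_neq0 : r != 0 by rewrite gt_eqF.
rewrite -rs_eq in rc rs.
rewrite (mulfI r_neq0 rc) (mulfI r_neq0 rs).
by rewrite -!expr2.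
Qed.

(** The signed angle from the first vector to the second, correct when their dot product is
    positive. *)
Definition ang x y x' y' : R := atan ((x * y' - y * x') / (x * x' + y * y')).

Lemma is_arg_step x y x' y' a : is_arg x y a -> 0 < x * x' + y * y' ->
  is_arg x' y' (a + ang x y x' y').
Proof.
move=> [r [r0 -> ->]]; rewrite /ang.
set D := (X in 0 < X); set E := (X in atan (X / _)) => D0.
set t := E / D; set b := atan t.
have cb : 0 < cos b by rewrite cos_atan invr_gt0 sqrtr_gt0 ltr_pwDl // sqr_ge0.
have sb : sin b = t * cos b by rewrite -[in RHS](atanK t) /tan mulrAC -mulrA mulfV ?mulr1 // gt_eqF.
have ca := cos2Dsin2 a.
have DE : E = t * D by rewrite divfK // gt_eqF.
exists (D / (r * cos b)); split; first by rewrite divr_gt0 // mulr_gt0.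
  rewrite cosD sb.
  have -> : D / (r * cos b) * (cos a * cos b - sin a * (t * cos b)) =
    (D * cos a - sin a * (t * D)) / r.
    by field; rewrite !gt_eqF.
  rewrite -DE; apply: (mulIf (_ : r != 0)); first by rewrite gt_eqF.
  rewrite divfK ?gt_eqF // /D /E -[LHS]mulr1 -ca; ring.
rewrite sinD sb.
have -> : D / (r * cos b) * (sin a * cos b + cos a * (t * cos b)) =
  (D * sin a + cos a * (t * D)) / r.
  by field; rewrite !gt_eqF.
rewrite -DE; apply: (mulIf (_ : r != 0)); first by rewrite gt_eqF.
rewrite divfK ?gt_eqF // /D /E -[LHS]mulr1 -ca; ring.
Qed.

Lemma cos_eq1 x : `|x| <= 1 -> cos x = 1 -> x = 0.
Proof.
move=> x1 cx; apply/eqP; rewrite -normr_eq0; apply/eqP.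
have pi2 := @pi_ge2 R.
apply: cos_inj; rewrite ?in_itv /= ?lexx ?pi_ge0 ?normr_ge0 ?(le_trans x1) //; first lra.
rewrite cos0; case: (ger0P x) => _ //; by rewrite cosN.
Qed.

(** The estimates on lifted angles rest on this: arguments modulo [2 * pi] only show that certain
    values are never taken, and the intermediate value theorem does the rest. *)
Lemma ivt0 (d : R -> R) (c : R) : continuous d -> d 0 = 0 -> 0 < c ->
  (forall t, 0 <= t <= 1 -> d t <> c /\ d t <> - c) ->
  forall t, 0 <= t <= 1 -> `|d t| < c.
Proof.
move=> dC d0 c0 dc t /andP[t0 t1]; rewrite ltNge; apply/negP => ct.
have dCt : {within `[0, t], continuous d} by exact: continuous_subspaceT.
have [v vc [vmin vmax]] : exists2 v, v = c \/ v = - c &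
    Num.min (d 0) (d t) <= v /\ v <= Num.max (d 0) (d t).
  rewrite d0; move: ct; rewrite ler_normr => /orP[ct|ct].
    by exists c; [left|rewrite ge_min le_max ct (ltW c0) orbT].
  have ct' : d t <= - c by rewrite lerNr.
  by exists (- c); [right|rewrite ge_min le_max ct' oppr_le0 (ltW c0) orbT].
have [|u + uv] := IVT t0 dCt (v := v); first by rewrite vmin.
rewrite in_itv /= => /andP[u0 ut].
have [|nc nNc] := dc u; first by rewrite u0 (le_trans ut).
by case: vc => vc; [apply: nc|apply: nNc]; rewrite uv vc.
Qed.

Lemma ivt_const (d : R -> R) : continuous d -> d 0 = 0 ->
  (forall t, 0 <= t <= 1 -> cos (d t) = 1) -> forall t, 0 <= t <= 1 -> d t = 0.
Proof.
move=> dC d0 dcos t t01; apply/eqP/negPn/negP => dt.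
(* On the interval from -1 to 1 the cosine is 1 at 0 only, so [d] avoids [c] and [- c]. *)
pose c := Num.min 1 `|d t|.
have c0 : 0 < c by rewrite lt_min ltr01 normr_gt0.
have c1 : `|c| <= 1 by rewrite (gtr0_norm c0) ge_min lexx.
have H u : 0 <= u <= 1 -> d u <> c /\ d u <> - c.
  move=> u01; split=> duc; have := dcos u u01;
    by rewrite duc ?cosN => /(cos_eq1 c1) c_0; rewrite c_0 ltxx in c0.
by have := ivt0 dC d0 c0 H t01; rewrite lt_min ltxx andbF.
Qed.

End Argument.

Section Lifting.
Variable R : realType.
Variables ux uy : R * R -> R.
Hypothesis ux_cont : continuous ux.
Hypothesis uy_cont : continuous uy.
Hypothesis u_neq0 : forall z, 0 < ux z * ux z + uy z * uy z.

Let dot (z w : R * R) := ux z * ux w + uy z * uy w.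

Let sq := `[0, 1]%classic `*` `[0, 1]%classic : set (R * R).

Let dot_uniform : exists2 e : R, 0 < e & forall z w, sq z ->
  `|z.1 - w.1| <= e -> `|z.2 - w.2| <= e -> 0 < dot z w.
Proof.
pose U (e : R) : set (R * R) := [set z | 0 < e /\ forall w,
  `|z.1 - w.1| <= e -> `|z.2 - w.2| <= e -> 0 < dot z w].
have [z _|s sP] := compact_seq_cover (U := U)
  (compact_setX (@segment_compact R 0 1) (@segment_compact R 0 1)).
  have : nbhs (z, z) [set y : (R * R) * (R * R) | 0 < dot y.1 y.2].
    have dC : {for (z, z), continuous (fun y : (R * R) * (R * R) => dot y.1 y.2)}.
      have C1 (f : R * R -> R) : continuous f -> f y.1 @[y --> (z, z)] --> f z.
        by move=> fC; apply: (@cvg_comp _ _ _ fst f _ (nbhs z)); [exact: cvg_fst|exact: fC].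
      have C2 (f : R * R -> R) : continuous f -> f y.2 @[y --> (z, z)] --> f z.
        by move=> fC; apply: (@cvg_comp _ _ _ snd f _ (nbhs z)); [exact: cvg_snd|exact: fC].
      by apply: cvgD; apply: cvgM; first [exact: C1|exact: C2].
    apply: (dC [set x | 0 < x]); apply: open_nbhs_nbhs; split; first exact: open_gt.
    exact: u_neq0.
  move=> [[P Q] /= [/nbhs_ballP[e1 /= e1_gt0 eP] /nbhs_ballP[e2 /= e2_gt0 eQ]] PQ].
  pose e := Num.min e1 e2; have e0 : 0 < e by rewrite lt_min e1_gt0.
  (* A third for [y] around [z] and a third for [w] around [y] keep both within [e] of [z]. *)
  exists (e / 3); apply/nbhs_ballP; exists (e / 3); first by rewrite /= divr_gt0.
  move=> y [y1 y2]; split; first by rewrite divr_gt0.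
  move=> w yw1 yw2; rewrite /ball /= in y1 y2.
  have e_le : e <= e1 /\ e <= e2 by rewrite !ge_min !lexx orbT.
  apply: (PQ (y, w)); split=> /=; [apply: eP|apply: eQ]; split; rewrite /ball /=.
  - by rewrite (lt_le_trans y1) //; lra.
  - by rewrite (lt_le_trans y2) //; lra.
  - have := ler_distD y.1 z.1 w.1; lra.
  - have := ler_distD y.2 z.2 w.2; lra.
have [e e0 es] : exists2 e : R, 0 < e & forall d, d \in s -> 0 < d -> e <= d.
  elim: {sP} s => [|d s [e e0 es]]; first by exists 1.
  have [d0|d0] := ltP 0 d; last first.
    exists e => // d'; rewrite inE => /orP[/eqP->|/es//].
    by rewrite ltNge d0.
  exists (Num.min e d); first by rewrite lt_min e0.
  move=> d'; rewrite inE => /orP[/eqP->|/es + /[dup] d'0] d''; rewrite ge_min ?lexx ?orbT //.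
  by move=> ->.
exists e => // z w sz z1 z2; have [d ds [d0 dU]] := sP z sz.
by apply: dU; [apply: le_trans z1 _|apply: le_trans z2 _]; exact: es.
Qed.

Let scale (l : R) (z : R * R) : R * R := (l * clamp z.1, l * clamp z.2).

Let scale_continuous l : continuous (scale l).
Proof.
move=> z; apply: (@cvg_pair _ _ _ _ (nbhs (l * clamp z.1)) (nbhs (l * clamp z.2))).
  apply: cvgM; first exact: cvg_cst.
  by apply: (@cvg_comp _ _ _ fst _ _ (nbhs z.1)); [exact: cvg_fst|exact: clamp_continuous].
apply: cvgM; first exact: cvg_cst.
by apply: (@cvg_comp _ _ _ snd _ _ (nbhs z.2)); [exact: cvg_snd|exact: clamp_continuous].
Qed.

Let scale_sq l z : 0 <= l <= 1 -> sq (scale l z).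
Proof.
move=> /andP[l0 l1]; have := clamp_itv z.1; have := clamp_itv z.2.
by move=> /andP[? ?] /andP[? ?]; split; rewrite /= in_itv /=; nra.
Qed.

(** The lift at [z] sums the small angles between consecutive values of [u] along the
    segment from the origin to [z]. *)
Lemma lift_square (a0 : R) : is_arg (ux (0, 0)) (uy (0, 0)) a0 ->
  exists L : R * R -> R, [/\ continuous L, L (0, 0) = a0 &
    forall s t, 0 <= s <= 1 -> 0 <= t <= 1 -> is_arg (ux (s, t)) (uy (s, t)) (L (s, t))].
Proof.
move=> arg0; have [e e0 eU] := dot_uniform.
(* With [1 / n <= e], consecutive points of the subdivided segment have values with positive dot
   product. *)
pose n := (Num.truncn (e^-1)).+1; pose m (i : nat) : R := i%:R / n%:R.
have n0 : 0 < n%:R :> R by rewrite ltr0n.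
have ne : n%:R^-1 <= e.
  by rewrite -[leRHS]invrK lef_pV2 ?posrE ?invr_gt0 //; rewrite ltW // truncnS_gt.
have m01 i : (i <= n)%N -> 0 <= m i <= 1.
  by move=> i_n; rewrite divr_ge0 ?ler0n //= ler_pdivrMr // mul1r ler_nat.
have mS i c : `|m i * clamp c - m i.+1 * clamp c| <= e.
  have /andP[c0 c1] := clamp_itv c.
  have -> : m i * clamp c - m i.+1 * clamp c = - (clamp c / n%:R).
    by rewrite /m -[in i.+1%:R]natr1; field; rewrite gt_eqF.
  rewrite normrN ger0_norm; last by rewrite divr_ge0 // ltW.
  by rewrite (le_trans _ ne) // ler_piMl // invr_ge0 ltW.
pose step i z := ang (ux (scale (m i) z)) (uy (scale (m i) z))
                     (ux (scale (m i.+1) z)) (uy (scale (m i.+1) z)).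
have step_pos i z : (i < n)%N -> 0 < dot (scale (m i) z) (scale (m i.+1) z).
  move=> i_n; apply: eU => /=; first exact/scale_sq/m01/ltnW.
    exact: mS.
  exact: mS.
pose L k z := a0 + \sum_(i < k) step i z.
have Larg k z : (k <= n)%N -> is_arg (ux (scale (m k) z)) (uy (scale (m k) z)) (L k z).
  elim: k => [_|k IH kn]; rewrite /L.
    by rewrite big_ord0 addr0 /scale /m !mul0r.
  rewrite big_ord_recr /= addrA; apply: is_arg_step; first exact/IH/ltnW.
  exact: step_pos.
have LC k : (k <= n)%N -> continuous (L k).
  elim: k => [_|k IH kn] z.
    suff -> : L 0 = cst a0 by exact: cvg_cst.
    by apply/funext => w; rewrite /L big_ord0 addr0.
  have -> : L k.+1 = fun w => L k w + step k w.
    by apply/funext => w; rewrite /L big_ord_recr /= addrA.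
  apply: cvgD; first exact/IH/ltnW.
  have C (f : R * R -> R) l : continuous f -> f (scale l w) @[w --> z] --> f (scale l z).
    by move=> fC; apply: (@cvg_comp _ _ _ (scale l) f _ (nbhs (scale l z)));
      [exact: scale_continuous|exact: fC].
  apply: (@continuous_cvg _ _ _ (nbhs z) _ _ (@atan R)); first exact: continuous_atan.
  apply: cvgM.
    by apply: cvgB; apply: cvgM; exact: C.
  apply: cvgV; first by rewrite gt_eqF //; exact: step_pos.
  by apply: cvgD; apply: cvgM; exact: C.
exists (L n); split; first exact: LC.
  rewrite /L big1 ?addr0 // => i _; rewrite /step /scale /= clamp0 !mulr0 /ang.
  by rewrite [uy _ * _]mulrC subrr mul0r atan0.
move=> s t s01 t01; have := Larg n (s, t) (leqnn n).
by rewrite /scale /m divff ?gt_eqF // !mul1r /= !clamp_id.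
Qed.

End Lifting.

Section WithinClamp.
Variables (R : realType) (T : topologicalType).

Lemma clamp_unit (t : R) : unit_interval (clamp t).
Proof. by rewrite /unit_interval /= in_itv /=; exact: clamp_itv. Qed.

Lemma within_clamp (f : R -> T) :
  {within @unit_interval R, continuous f} -> continuous (fun t => f (clamp t)).
Proof.
move=> /subspace_continuousP fC t U /(fC _ (clamp_unit t)) fU.
change (nbhs t [set s | U (f (clamp s))]).
have cl : nbhs t [set s | @unit_interval R (clamp s) -> U (f (clamp s))].
  exact: (@clamp_continuous R t _ fU).
by apply: filterS cl => s; apply; exact: clamp_unit.
Qed.

Lemma within_clamp2 (h : R * R -> T) :
  {within @unit_interval R `*` @unit_interval R, continuous h} ->
  continuous (fun z => h (clamp z.1, clamp z.2)).
Proof.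
move=> /subspace_continuousP hC z U.
have zI (w : R * R) : (@unit_interval R `*` @unit_interval R) (clamp w.1, clamp w.2).
  by split; exact: clamp_unit.
move=> /(hC _ (zI z)) hU.
have cC : continuous (fun w : R * R => (clamp w.1, clamp w.2)).
  move=> w; apply: (@cvg_pair _ _ _ _ (nbhs (clamp w.1)) (nbhs (clamp w.2))).
    by apply: (@cvg_comp _ _ _ fst _ _ (nbhs w.1)); [exact: cvg_fst|exact: clamp_continuous].
  by apply: (@cvg_comp _ _ _ snd _ _ (nbhs w.2)); [exact: cvg_snd|exact: clamp_continuous].
change (nbhs z [set w | U (h (clamp w.1, clamp w.2))]).
have cl : nbhs z [set w | (@unit_interval R `*` @unit_interval R) (clamp w.1, clamp w.2) ->
    U (h (clamp w.1, clamp w.2))] by exact: (cC z _ hU).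
by apply: filterS cl => w; apply; exact: zI.
Qed.

End WithinClamp.

(** * The lifted angle on the cover *)

Section Theta.
Variables (R : realType) (G : topologicalGroupType) (p : G -> SL2 R).
Hypothesis hG : is_universal_cover_SL2 p.

Let entry_continuous i j : continuous (fun g => p g i j).
Proof.
move=> g; apply: (@cvg_comp G (SL2 R) R p (fun A => A i j) (nbhs g) (nbhs (p g))).
  exact: (cover_continuous hG).
exact: SL2_entry_continuous.
Qed.

Lemma column_neq0 g : 0 < p g 0 0 * p g 0 0 + p g 1 0 * p g 1 0.
Proof.
rewrite lt_def addr_ge0 -?expr2 ?sqr_ge0 // andbT paddr_eq0 ?sqr_ge0 // !sqrf_eq0.
apply/negP => /andP[/eqP x0 /eqP y0]; have := det_SL2 (p g).
by rewrite x0 y0 mul0r mulr0 subr0 => /esym/eqP; rewrite oner_eq0.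
Qed.

Definition path_from_1 (f : R -> G) (x : G) :=
  [/\ continuous f, f 0 = 1%g & f 1 = x].

Definition angle_along (f : R -> G) (L : R -> R) := [/\ continuous L, L 0 = 0 &
  forall t, 0 <= t <= 1 -> is_arg (p (f t) 0 0) (p (f t) 1 0) (L t)].

Lemma is_arg_1 : is_arg (p 1%g 0 0) (p 1%g 1 0) 0.
Proof.
rewrite (cover_1 hG) !SL2_1E; exists 1; rewrite cos0 sin0 mulr0 mulr1.
by split.
Qed.

Lemma path_ex x : exists f, path_from_1 f x.
Proof.
have [_ _ [pc _]] := hG; have [f [fC f0 f1]] := pc 1%g x.
exists (fun t => f (clamp t)); split; first exact: within_clamp.
  by rewrite clamp0.
by rewrite clamp1.
Qed.

Lemma angle_along_ex f x : path_from_1 f x -> exists L, angle_along f L.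
Proof.
move=> [fC f0 f1].
have uC j : continuous (fun z : R * R => p (f z.2) j 0).
  move=> z; apply: (@cvg_comp _ _ _ snd (fun t => p (f t) j 0) _ (nbhs z.2)).
    exact: cvg_snd.
  by apply: (@cvg_comp _ _ _ f (fun g => p g j 0) _ (nbhs (f z.2)));
    [exact: fC|exact: entry_continuous].
have [||L [LC L0 LP]] := lift_square (uC 0) (uC 1) _ (a0 := 0).
- by move=> z; exact: column_neq0.
- by rewrite /= f0; exact: is_arg_1.
exists (fun t => L (0, t)); split=> //.
  move=> t; apply: (@cvg_comp _ _ _ (fun t => (0, t)) L _ (nbhs (0, t))); last exact: LC.
  by apply: (@cvg_pair _ _ _ _ (nbhs (0 : R)) (nbhs t)); [exact: cvg_cst|exact: cvg_id].
by move=> t t01; apply: (LP 0 t) => //; rewrite lexx ler01.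
Qed.

Lemma angle_along_unique f L L' : angle_along f L -> angle_along f L' -> L 1 = L' 1.
Proof.
move=> [LC L0 LP] [LC' L0' LP']; apply/eqP; rewrite -subr_eq0; apply/eqP.
apply: (ivt_const (d := fun t => L t - L' t)).
- by move=> t; apply: cvgB; [exact: LC|exact: LC'].
- by rewrite L0 L0' subr0.
- by move=> t t01; apply: is_arg_cos; [exact: LP'|exact: LP].
- by rewrite lexx ler01.
Qed.

(** The loop [f (2 t) * x^-1 * f' (2 - 2 t)], with clamped arguments, runs along [f]
    and then back along [f']. *)
Lemma angle_along_indep f f' x L L' : path_from_1 f x -> path_from_1 f' x ->
  angle_along f L -> angle_along f' L' -> L 1 = L' 1.
Proof.
move=> [fC f0 f1] [f'C f'0 f'1] fL f'L'.
pose l t := (f (clamp (t + t)) * x^-1 * f' (clamp (2 - (t + t))))%g.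
have lC : continuous l.
  have dC : continuous (fun t : R => t + t) by move=> t; apply: cvgD; exact: cvg_id.
  have eC : continuous (fun t : R => 2 - (t + t)).
    by move=> t; apply: cvgB; [exact: cvg_cst|exact: dC].
  have comp (g h : R -> R) (k : R -> G) : continuous g -> continuous h ->
      continuous k -> continuous (fun t => k (h (g t))).
    move=> gC hC kC t; apply: (@cvg_comp _ _ _ g (fun t => k (h t)) _ (nbhs (g t))).
      exact: gC.
    by apply: (@cvg_comp _ _ _ h k _ (nbhs (h (g t)))); [exact: hC|exact: kC].
  move=> t; apply: cvgMg; last exact: (comp _ _ _ eC (@clamp_continuous R) f'C).
  apply: cvgMg; last exact: cvg_cst.
  exact: (comp _ _ _ dC (@clamp_continuous R) fC).
have clamp_ge1 (t : R) : 1 <= t -> clamp t = 1 by move=> t1; rewrite /clamp min_l // max_r.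
have l0 : l 0 = 1%g.
  by rewrite /l addr0 subr0 clamp0 clamp_ge1 ?ler1n // f0 f'1 mul1g mulVg.
have l1 : l 1 = 1%g.
  rewrite /l (_ : 2 - (1 + 1) = 0 :> R); last by lra.
  by rewrite clamp0 clamp_ge1 ?lerDl // f1 f'0 mulg1 mulgV.
have [_ _ [_ sc]] := hG.
have [|h [hC h_l h_1 h_st]] := sc l _ (etrans l0 (esym l1)).
  exact: continuous_subspaceT.
pose k z := h (clamp z.1, clamp z.2).
have kC : continuous k by exact: within_clamp2.
have uC j : continuous (fun z : R * R => p (k z) j 0).
  by move=> z; apply: (@cvg_comp _ _ _ k (fun g => p g j 0) _ (nbhs (k z)));
    [exact: kC|exact: entry_continuous].
have I01 : (0 <= (0 : R) <= 1) /\ (0 <= (1 : R) <= 1) by rewrite !lexx ler01.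
have unitP (t : R) : 0 <= t <= 1 -> @unit_interval R t by rewrite /unit_interval /= in_itv.
have k_l t : 0 <= t <= 1 -> k (0, t) = l t.
  by move=> t01; rewrite /k /= clamp0 clamp_id //; apply/h_l/unitP.
have k_1 t : 0 <= t <= 1 -> k (1, t) = 1%g.
  by move=> t01; rewrite /k /= clamp1 clamp_id // -l0; apply/h_1/unitP.
have k_s s : 0 <= s <= 1 -> k (s, 0) = 1%g /\ k (s, 1) = 1%g.
  by move=> s01; rewrite /k /= clamp0 clamp1 clamp_id // -l0; apply/h_st/unitP.
have [||H [HC H0 HP]] := lift_square (uC 0) (uC 1) _ (a0 := 0).
- by move=> z; exact: column_neq0.
- by rewrite (k_s _ I01.1).1; exact: is_arg_1.
have HC1 t : continuous (fun s => H (s, t)).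
  move=> s; apply: (@cvg_comp _ _ _ (fun s => (s, t)) H _ (nbhs (s, t))); last exact: HC.
  by apply: (@cvg_pair _ _ _ _ (nbhs s) (nbhs t)); [exact: cvg_id|exact: cvg_cst].
have HC2 s : continuous (fun t => H (s, t)).
  move=> t; apply: (@cvg_comp _ _ _ (fun t => (s, t)) H _ (nbhs (s, t))); last exact: HC.
  by apply: (@cvg_pair _ _ _ _ (nbhs s) (nbhs t)); [exact: cvg_cst|exact: cvg_id].
have cos1 s t : 0 <= s <= 1 -> 0 <= t <= 1 -> k (s, t) = 1%g -> cos (H (s, t)) = 1.
  move=> s01 t01 kst; rewrite -[H _]subr0; apply: is_arg_cos is_arg_1 _.
  by have := HP s t s01 t01; rewrite kst.
(* [k] equals 1 on three sides of the square. Following [H] along [t = 0], then [s = 1], then back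
   along [t = 1] gives [H (0, 1) = 0]. *)
have Hs0 s : 0 <= s <= 1 -> H (s, 0) = 0.
  apply: (ivt_const (HC1 0)) => // {}s s01; apply: cos1 => //; first exact: I01.1.
  exact: (k_s _ s01).1.
have H1t t : 0 <= t <= 1 -> H (1, t) = 0.
  apply: (ivt_const (HC2 1)) => [|{}t t01]; first by apply: Hs0; exact: I01.2.
  by apply: cos1 => //; [exact: I01.2|exact: k_1].
have H01 : H (0, 1) = 0.
  have dC : continuous (fun s : R => H (1 - s, 1)).
    move=> s; apply: (@cvg_comp _ _ _ (fun s : R => 1 - s) (fun s => H (s, 1)) _ (nbhs (1 - s))).
      by apply: cvgB; [exact: cvg_cst|exact: cvg_id].
    exact: HC1.
  have := ivt_const dC _ _ I01.2; rewrite subrr; apply.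
    by rewrite subr0; apply: H1t; exact: I01.2.
  move=> s s01; have s01' : 0 <= 1 - s <= 1 by lra.
  by apply: cos1 => //; [exact: I01.2|exact: (k_s _ s01').2].
have half (g : R -> R) (gC : continuous g) : continuous (fun t => H (0, g t)).
  move=> t; apply: (@cvg_comp _ _ _ g (fun t => H (0, t)) _ (nbhs (g t))).
    exact: gC.
  exact: HC2.
(* On the side [s = 0] the loop is [f], then [f'] reversed, so both angles end at the midpoint value
   of [H]. *)
have E1 : angle_along f (fun t => H (0, t / 2)).
  split.
  - by apply: half => t; apply: cvgM; [exact: cvg_id|exact: cvg_cst].
  - by rewrite mul0r.
  - move=> t t01; have t2 : 0 <= t / 2 <= 1 by lra.
    have := HP 0 (t / 2) I01.1 t2; rewrite k_l // /l -splitr clamp_id //.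
    by rewrite clamp_ge1 ?f'1 ?mulgVK //; lra.
have E2 : angle_along f' (fun t => H (0, 1 - t / 2)).
  split.
  - apply: half => t; apply: cvgB; first exact: cvg_cst.
    by apply: cvgM; [exact: cvg_id|exact: cvg_cst].
  - by rewrite mul0r subr0.
  - move=> t t01; have t2 : 0 <= 1 - t / 2 <= 1 by lra.
    have := HP 0 (1 - t / 2) I01.1 t2; rewrite k_l // /l.
    rewrite (_ : 1 - t / 2 + (1 - t / 2) = 2 - t); last by lra.
    rewrite clamp_ge1; last by lra.
    by rewrite f1 mulgV mul1g (_ : 2 - (2 - t) = t) ?clamp_id //; lra.
rewrite (angle_along_unique fL E1) (angle_along_unique f'L' E2) /=.
by congr (H (_, _)); lra.
Qed.

Lemma theta_ex : exists theta : G -> R, forall x f L,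
  path_from_1 f x -> angle_along f L -> theta x = L 1.
Proof.
have H x : exists a, forall f L, path_from_1 f x -> angle_along f L -> a = L 1.
  have [f fx] := path_ex x; have [L fL] := angle_along_ex fx.
  by exists (L 1) => f' L' fx' fL'; exact: angle_along_indep fx fx' fL fL'.
by have [th thP] := choice H; exists th.
Qed.

End Theta.

Section ThetaTheory.
Variables (R : realType) (G : topologicalGroupType) (p : G -> SL2 R).
Hypothesis hG : is_universal_cover_SL2 p.
Variable theta : G -> R.
Hypothesis thetaP : forall x f L,
  path_from_1 f x -> angle_along p f L -> theta x = L 1.

Lemma theta_arg g : is_arg (p g 0 0) (p g 1 0) (theta g).
Proof.
have [f fg] := path_ex hG g; have [L fL] := angle_along_ex hG fg.
rewrite (thetaP fg fL); have [_ _ f1] := fg; have [_ _ LP] := fL.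
by rewrite -f1; apply: LP; rewrite lexx ler01.
Qed.

Lemma theta_1 : theta 1%g = 0.
Proof.
rewrite (@thetaP 1%g (fun=> 1%g) (fun=> 0)) //.
  by split=> //; exact: cst_continuous.
by split=> // [|t _]; [exact: cst_continuous|exact: is_arg_1].
Qed.

Lemma cover_col g h i : p (g * h)%g i 0 = p g i 0 * p h 0 0 + p g i 1 * p h 1 0.
Proof. by rewrite (cover_mul hG) SL2_mulE. Qed.

(** Dot and cross product of a vector with its image; the mixed terms are absorbed by
    [2 * |x * y| <= x * x + y * y]. *)
Lemma near_id_angle (A : SL2 R) (e x y : R) : 0 < x * x + y * y ->
  (forall i j, `|(1%g : SL2 R) i j - A i j| < e) ->
  let x' := A 0 0 * x + A 0 1 * y in let y' := A 1 0 * x + A 1 1 * y in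
  (1 - 2 * e) * (x * x + y * y) <= x * x' + y * y' /\
  `|x * y' - y * x'| <= 2 * e * (x * x + y * y).
Proof.
move=> xy0 AP /=.
have [Ha Hb Hc Hd] : [/\ `|1 - A 0 0| < e, `|A 0 1| < e, `|A 1 0| < e & `|1 - A 1 1| < e].
  by have := (AP 0 0, AP 0 1, AP 1 0, AP 1 1); rewrite !SL2_1E /= !sub0r !normrN => -[[[]]].
move: (A 0 0) (A 0 1) (A 1 0) (A 1 1) Ha Hb Hc Hd => a b c d.
rewrite !ltr_norml => /andP[a1 a2] /andP[b1 b2] /andP[c1 c2] /andP[d1 d2].
have e0 : 0 < e by lra.
have xx : 0 <= x * x by rewrite -expr2 sqr_ge0.
have yy : 0 <= y * y by rewrite -expr2 sqr_ge0.
have xy : 2 * `|x * y| <= x * x + y * y.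
  have nx : `|x| * `|x| = x * x by rewrite -normrM ger0_norm.
  have ny : `|y| * `|y| = y * y by rewrite -normrM ger0_norm.
  by have := sqr_ge0 (`|x| - `|y|); rewrite expr2 normrM; nra.
have bnd u v : `|u| <= e -> `|u * v| <= e * `|v|.
  by move=> ue; rewrite normrM ler_wpM2r.
have B1 : `|(1 - a) * (x * x)| <= e * (x * x).
  by rewrite -[X in _ <= e * X]ger0_norm //; apply: bnd; rewrite ler_norml; lra.
have B2 : `|(1 - d) * (y * y)| <= e * (y * y).
  by rewrite -[X in _ <= e * X]ger0_norm //; apply: bnd; rewrite ler_norml; lra.
have B3 : `|(b + c) * (x * y)| <= 2 * e * `|x * y|.
  by rewrite normrM ler_wpM2r // ler_norml; lra.
have B4 : `|c * (x * x)| <= e * (x * x).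
  by rewrite -[X in _ <= e * X]ger0_norm //; apply: bnd; rewrite ler_norml; lra.
have B5 : `|b * (y * y)| <= e * (y * y).
  by rewrite -[X in _ <= e * X]ger0_norm //; apply: bnd; rewrite ler_norml; lra.
have B6 : `|(d - a) * (x * y)| <= 2 * e * `|x * y|.
  by rewrite normrM ler_wpM2r // ler_norml; lra.
have E : 2 * e * `|x * y| <= e * (x * x + y * y) by rewrite [2 * e]mulrC -mulrA ler_wpM2l // ltW.
move: B1 B2 B3 B4 B5 B6; rewrite !ler_norml.
move=> /andP[? ?] /andP[? ?] /andP[? ?] /andP[? ?] /andP[? ?] /andP[? ?].
by split; [|apply/andP; split]; lra.
Qed.

(** A path to [g] is multiplied by a path to [v] along which [p] stays near 1. The two lifted angles
    start together and can never be [c] apart, whatever [g] is. *)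
Lemma theta_unif (e : R) : 0 < e ->
  nbhs (1%g : G) [set v | forall g, `|theta (v * g)%g - theta g| <= e].
Proof.
move=> e0; pose c := Num.min e 2^-1.
have c0 : 0 < c by rewrite lt_min e0 invr_gt0 ltr0n.
have [ce c2] : c <= e /\ c <= 2^-1 by rewrite !ge_min !lexx orbT.
have pi2 := @pi_ge2 R.
have sc : 0 < sin c by apply: sin_gt0_pihalf; apply/andP; split; lra.
have cc : 0 < cos c by apply: cos_gt0_pihalf; apply/andP; split; lra.
have sc1 := sin_le1 c.
have cc1 := cos_le1 c.
(* At distance [c] the two bounds of [near_id_angle] would give [(1 - 2 * h) * sin c <= 2 * h],
   impossible for [sin c = 5 * h] and [h <= 1/5]. *)
pose h := sin c / 5.
have W1 : nbhs (1%g : SL2 R) [set A : SL2 R | forall i j, `|(1%g : SL2 R) i j - A i j| < h].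
  by apply/nbhs_SL2P; exists h => //; rewrite divr_gt0.
apply: filterS (small_path hG W1) => v [s [sC s0 s1 sW]] g.
have [f fg] := path_ex hG g; have [L fL] := angle_along_ex hG fg.
have [fC f0 f1] := fg; have [LC L0 LP] := fL.
have sfg : path_from_1 (fun t => s t * f t)%g (v * g)%g.
  split; [|by rewrite s0 f0 mul1g|by rewrite s1 f1].
  by move=> t; apply: cvgMg; [exact: sC|exact: fC].
have [L' sfL] := angle_along_ex hG sfg; have [LC' L0' LP'] := sfL.
rewrite (thetaP sfg sfL) (thetaP fg fL).
apply: le_trans ce; apply/ltW; apply: (ivt0 (d := fun t => L' t - L t)) => //.
- by move=> t; apply: cvgB; [exact: LC'|exact: LC].
- by rewrite L0 L0' subr0.
- move=> t t01; have [r [r0 rc rs]] := is_arg_dot (LP t t01) (LP' t t01).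
  have n0 := column_neq0 p (f t).
  have := near_id_angle n0 (sW t); rewrite /= -!cover_col rc rs => -[dot_ge det_le].
  move: (p (f t) 0 0 * _ + _) n0 dot_ge det_le => n n0 dot_ge det_le.
  by split=> dt; move: dot_ge det_le; rewrite dt ?cosN ?sinN ler_norml => + /andP[];
    rewrite /h; nra.
- by rewrite lexx ler01.
Qed.

Lemma theta_continuous : continuous theta.
Proof.
move=> g U /nbhs_ballP[e /= e0 eU].
have e2 : 0 < e / 2 by rewrite divr_gt0.
have := theta_unif e2; rewrite -(mulgV g) => /nbhs_rmul ge.
change (nbhs g [set x | U (theta x)]); apply: filterS ge => x /(_ g).
rewrite mulgVK => xg; apply: eU; rewrite /ball /= distrC.
by apply: le_lt_trans xg _; rewrite ltr_pdivrMr // ltr_pMr // ltr1n.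
Qed.

Lemma cover_ivt (d : G -> R) (c : R) : continuous d -> d 1%g = 0 -> 0 < c ->
  (forall g, d g <> c /\ d g <> - c) -> forall g, `|d g| < c.
Proof.
move=> dC d1 c0 dc g; have [f [fC f0 <-]] := path_ex hG g.
apply: (ivt0 (d := fun t => d (f t))) => //.
- by move=> t; apply: (@cvg_comp _ _ _ f d _ (nbhs (f t))); [exact: fC|exact: dC].
- by rewrite f0.
- by rewrite lexx ler01.
Qed.

Lemma cover_const (d : G -> R) : continuous d -> d 1%g = 0 ->
  (forall g, cos (d g) = 1) -> forall g, d g = 0.
Proof.
move=> dC d1 dcos g; have [f [fC f0 <-]] := path_ex hG g.
apply: (ivt_const (d := fun t => d (f t))) => //.
- by move=> t; apply: (@cvg_comp _ _ _ f d _ (nbhs (f t))); [exact: fC|exact: dC].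
- by rewrite f0.
- by rewrite lexx ler01.
Qed.

Lemma theta_mul_continuous g : continuous (fun h => theta (g * h)%g).
Proof.
move=> h; apply: (@cvg_comp _ _ _ (fun h => g * h)%g theta _ (nbhs (g * h)%g)).
  by apply: cvgMg; [exact: cvg_cst|exact: cvg_id].
exact: theta_continuous.
Qed.

(** The sines of [theta (g * h) - theta g] and of [theta h] have the same sign, and
    so do their cosines where the sines vanish; hence the two angles never differ by
    [pi]. *)
Lemma theta_quasi g h : `|theta (g * h)%g - theta g - theta h| < pi.
Proof.
move: h; apply: (cover_ivt (d := fun h => theta (g * h)%g - theta g - theta h)).
- move=> h; apply: cvgB; last exact: theta_continuous.
  by apply: cvgB; [exact: theta_mul_continuous|exact: cvg_cst].
- by rewrite mulg1 subrr theta_1 subrr.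
- exact: pi_gt0.
move=> h; have [r [r0]] := is_arg_dot (theta_arg g) (theta_arg (g * h)%g).
have [s [s0 hx hy]] := theta_arg h.
rewrite !cover_col hx hy => rc rs.
have cs := cos2Dsin2 (theta h); have dg := det_SL2 (p g).
have n0 := column_neq0 p g.
set al := theta (g * h)%g - theta g in rc rs *.
move: (theta h) cs rc rs => be cs rc rs {hx hy}.
have opp : sin al = - sin be -> cos al = - cos be -> False.
  move=> sE cE; rewrite sE in rs; rewrite cE in rc.
  (* The cross product of the first columns of [p g] and [p (g * h)] is [det (p g) = 1] times
     [s * sin be]. *)
  have sb : (r + s) * sin be = 0.
    have : (p g 0 0 * p g 1 1 - p g 0 1 * p g 1 0) * (s * sin be) = r * - sin be.
      by rewrite -rs; ring.
    by rewrite dg; lra.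
  have {}sb : sin be = 0.
    by move/eqP: sb; rewrite mulf_eq0 gt_eqF ?addr_gt0 //= => /eqP.
  have : ((p g 0 0 * p g 0 0 + p g 1 0 * p g 1 0) * s + r) * cos be = 0.
    by rewrite sb in rc; lra.
  move/eqP; rewrite mulf_eq0 gt_eqF ?addr_gt0 ?mulr_gt0 //= => /eqP cb.
  by move: cs; rewrite sb cb !expr2 !mul0r addr0 => /esym/eqP; rewrite oner_eq0.
split=> E; apply: opp.
- by rewrite (_ : al = be + pi) ?sinDpi //; lra.
- by rewrite (_ : al = be + pi) ?cosDpi //; lra.
- by rewrite (_ : be = al + pi) ?sinDpi ?opprK //; lra.
- by rewrite (_ : be = al + pi) ?cosDpi ?opprK //; lra.
Qed.

(** Rotation by [pi / 2] shifts every argument by [pi / 2], so both sides agree modulo [2 * pi];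
    they agree at 1, hence everywhere by continuity. The value [theta g0] depends on the lift and
    may be negative. *)
Lemma rotation_ex : exists g0, theta g0 <> 0 /\ forall h, theta (g0 * h)%g = theta g0 + theta h.
Proof.
have [A [a00 a01 a10 a11]] : exists A : SL2 R, [/\ A 0 0 = 0, A 0 1 = -1, A 1 0 = 1 & A 1 1 = 0].
  by apply: SL2_ex; rewrite mulr0 mulN1r opprK add0r.
have [g0 pg0] := cover_surj hG A; exists g0.
have arg0 h : is_arg (p (g0 * h)%g 0 0) (p (g0 * h)%g 1 0) (theta h + pi / 2).
  have [r [r0 hx hy]] := theta_arg h.
  exists r; split=> //; rewrite cover_col pg0 ?a00 ?a01 ?a10 ?a11 hx hy.
    by rewrite cosDpihalf; ring.
  by rewrite sinDpihalf; ring.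
have cosT h : cos (theta h + pi / 2 - theta (g0 * h)%g) = 1.
  by apply: is_arg_cos; [exact: theta_arg|exact: arg0].
have arg1 : cos (pi / 2 - theta g0) = 1.
  by have := cosT 1%g; rewrite mulg1 theta_1 add0r.
split=> [g0_0|h].
  by move: arg1; rewrite g0_0 subr0 cos_pihalf => /eqP; rewrite eq_sym oner_eq0.
apply/eqP; rewrite -subr_eq0; apply/eqP.
apply: (cover_const (d := fun h => theta (g0 * h)%g - (theta g0 + theta h))).
- move=> {}h; apply: cvgB; first exact: theta_mul_continuous.
  by apply: cvgD; [exact: cvg_cst|exact: theta_continuous].
- by rewrite mulg1 theta_1 addr0 subrr.
- move=> {}h; have := cosT h; set x := _ - _ => cx.
  set y := pi / 2 - theta g0 in arg1.
  have sin0 z : cos z = 1 -> sin z = 0 :> R.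
    move=> cz; have := cos2Dsin2 z; rewrite cz expr1n => /eqP.
    by rewrite -subr_eq0 addrC addKr sqrf_eq0 => /eqP.
  rewrite (_ : _ - _ = y - x); last by rewrite /x /y; ring.
  by rewrite cosB cx arg1 (sin0 _ cx) mulr0 addr0 mulr1.
Qed.

End ThetaTheory.

(** * The generalized Bohr compactification of the cover *)

Lemma floor_quasi (R : realType) (x y z q : R) : `|x - y - z| <= q ->
  (`|(Num.floor x - Num.floor y - Num.floor z)%R| <= Num.truncn q + 3)%N.
Proof.
move=> xyz; have q0 : 0 <= q by exact: le_trans xyz.
have qk := truncnS_gt q; rewrite -natr1 in qk.
have /andP[x1 x2] := floor_itv x; have /andP[y1 y2] := floor_itv y.
have /andP[z1 z2] := floor_itv z.
rewrite !intrD in x2 y2 z2.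
move: xyz; rewrite ler_norml => /andP[H1 H2].
move: (Num.floor x) (Num.floor y) (Num.floor z) (Num.truncn q) x1 x2 y1 y2 z1 z2 qk.
move=> a b c k x1 x2 y1 y2 z1 z2 qk.
have U : (a - b - c < k%:Z + 3)%R.
  by rewrite -(ltr_int R) !intrD !intrN -pmulrn; lra.
have V : (- (k%:Z + 3) < a - b - c)%R.
  by rewrite -(ltr_int R) !intrD !intrN intrD -pmulrn; lra.
lia.
Qed.

Section GeneralizedBohr.
Variables (R : realType) (G : topologicalGroupType) (p : G -> SL2 R).
Hypothesis hG : is_universal_cover_SL2 p.
Variables (K : Type) (N : elementary_extension).
Hypothesis monster : is_monster K N.

Lemma generalized_Bohr_hom (B : topologicalGroupType) :
  is_generalized_Bohr_compactification G B ->
  exists f : B -> {quot comp00Z K N},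
    {morph f : x y / (x * y)%g >-> x + y} /\ range f = setT.
Proof.
move=> [S [act [s0 [M [u [prj [univ minM Mu uu quot_prj]]]]]]].
have [th thP] := theta_ex hG.
have [g0 [/eqP c0 g0_mul]] := rotation_ex hG thP.
have th1 := theta_1 hG thP.
set c := th g0 in c0 g0_mul.
pose th' g := th g / c.
have surj (n : int) : exists g, th g = n%:~R * c.
  have pos (m : nat) : exists g, th g = m%:R * c.
    elim: m => [|m [g gm]]; first by exists 1%g; rewrite th1 mul0r.
    by exists (g0 * g)%g; rewrite g0_mul gm -natr1 mulrDl mul1r addrC.
  have neg (m : nat) : exists g, th g = - (m%:R * c).
    elim: m => [|m [g gm]]; first by exists 1%g; rewrite th1 mul0r oppr0.
    exists (g0^-1 * g)%g; have := g0_mul (g0^-1 * g)%g; rewrite mulgA mulgV mul1g gm.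
    by rewrite -natr1 mulrDl mul1r opprD => ->; rewrite addrC addKr.
  case: n => m; first exact: pos.
  by have [g gm] := neg m.+1; exists g; rewrite gm NegzE mulrNz mulNr.
have th'_unif (e : R) : 0 < e ->
    nbhs (1%g : G) [set v | forall g, `|th' (v * g)%g - th' g| <= e].
  move=> e0; have ec : 0 < e * `|c| by rewrite mulr_gt0 ?normr_gt0.
  apply: filterS (theta_unif hG thP ec) => v vP g.
  by rewrite /th' -mulrBl normrM normfV ler_pdivrMr ?normr_gt0.
(* The same [k] has to bound the defect, where 3 pays for the floors, and the separation constant 2
   of [floor_level_sep]. *)
pose k := (Num.truncn (pi / `|c|) + 3)%N.
apply: (@Ellis_quotient_hom K N monster G S act s0 univ (fun g => Num.floor (th' g)) k
  _ _ _ M u minM Mu uu B prj quot_prj).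
- move=> g h; apply: floor_quasi.
  rewrite /th' -!mulrBl normrM normfV ler_wpM2r ?invr_ge0 //.
  exact/ltW/(theta_quasi hG thP).
- by move=> n; have [g gn] := surj n; exists g; rewrite /th' gn mulfK // intrKfloor.
- move=> A A' q Aq A'q.
  have [m [n [Am An mn]]] := floor_level_sep univ th'_unif Aq A'q.
  by exists m, n; split=> //; rewrite (leq_trans mn) // /k; lia.
Qed.

Lemma generalized_Bohr_nontrivial (B : topologicalGroupType) :
  is_generalized_Bohr_compactification G B -> exists x : B, x <> 1%g.
Proof.
move=> /generalized_Bohr_hom[f [fM fT]]; apply: contrapT => B_trivial.
have B1 (x : B) : x = 1%g by apply: contrapT => x1; apply: B_trivial; exists x.
have [x /negP] := comp00Z_proper monster; apply.
have f1 : f 1%g = 0.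
  by apply: (addrI (f 1%g)); rewrite addr0 -fM mulg1.
have [b _ bx] : range f (\pi x) by rewrite fT.
have : \pi_({quot comp00Z K N}) x = \pi_({quot comp00Z K N}) 0.
  by rewrite -bx (B1 b) f1 raddf0.
by move/eqP; rewrite -Quotient.idealrBE subr0.
Qed.

End GeneralizedBohr.

(** * Compactifications of the cover *)

(** The conjugators are covered by sets indexed by the neighbourhoods [Q] of 1 that work for them;
    finitely many suffice and are intersected. *)
Lemma compact_group_conj (B : topologicalGroupType) (U : set B) :
  compact [set: B] -> nbhs (1%g : B) U ->
  nbhs (1%g : B) [set x | forall k, U (k^-1 * x * k)%g].
Proof.
move=> cB U1.
pose P (Q : set B) : set B := [set k | nbhs (1%g : B) Q /\ forall x, Q x -> U (k^-1 * x * k)%g].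
have [k _|s sP] := compact_seq_cover (U := P) cB.
  have kC : (z.1^-1 * z.2 * z.1)%g @[z --> (k, 1%g : B)] --> (k^-1 * 1 * k)%g.
    apply: cvgMg; last exact: cvg_fst.
    by apply: cvgMg; [apply: cvgVg; exact: cvg_fst|exact: cvg_snd].
  have : nbhs (k^-1 * 1 * k)%g U by rewrite mulg1 mulVg.
  move=> /kC[[V W] /= [Vk W1] VWU]; exists W; apply: filterS Vk => h Vh.
  by split=> // x Wx; exact: (VWU (h, x)).
have : nbhs (1%g : B) [set x | forall Q, Q \in s -> nbhs (1%g : B) Q -> Q x].
  apply: filter_seq_all => Q _; have [Q1|nQ] := pselect (nbhs (1%g : B) Q).
    by apply: filterS Q1.
  by apply: filterS filterT => x _ /nQ.
apply: filterS => x xQ k; have [Q Qs [Q1 QU]] := sP k I.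
by apply: QU; exact: xQ.
Qed.

Section BohrTrivial.
Variables (R : realType) (G : topologicalGroupType) (p : G -> SL2 R).
Hypothesis hG : is_universal_cover_SL2 p.
Variables (B : topologicalGroupType) (b : G -> B).
Hypothesis compactB : is_compactification b.

Let b_mul x y : b (x * y)%g = (b x * b y)%g. Proof. by have [_ _ + _] := compactB; apply. Qed.

Let b_continuous : continuous b. Proof. by have [] := compactB. Qed.

Let b_1 : b 1%g = 1%g.
Proof. by apply: (mulgI (b 1%g)); rewrite -b_mul !mulg1. Qed.

Let b_inv x : b x^-1%g = (b x)^-1%g.
Proof. by apply: (mulgI (b x)); rewrite -b_mul !mulgV b_1. Qed.

Lemma eq1_nbhs (y : B) : (forall U, nbhs (1%g : B) U -> U y) -> y = 1%g.
Proof.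
have [[_ hB] _ _ _] := compactB; move=> yU; apply: hB => U V Uy V1.
by exists y; split; [exact: nbhs_singleton|exact: yU].
Qed.

Variable s : SL2 R -> G.
Hypothesis s_1 : s 1%g = 1%g.
Hypothesis s_cover : nbhs (1%g : G) [set v | s (p v) = v].
Hypothesis cover_s :
  nbhs (1%g : SL2 R) [set A | p (s A) = A /\ {for A, continuous s}].

(** Conjugates of [s (f t)] by powers of a lift of [A] tend to [1], and conjugation
    by a compact group cannot move a nontrivial element arbitrarily close to [1]. *)
Lemma contracted_trivial (f : R -> SL2 R) (A : SL2 R) :
  f 0 = 1%g -> f t @[t --> (0 : R)] --> (1%g : SL2 R) ->
  (forall t, (A * f t * A^-1)%g = f (t / 4)) ->
  nbhs (0 : R) [set t | b (s (f t)) = 1%g].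
Proof.
move=> f0 fC fA; have [a pa] := cover_surj hG A.
have sfC : s (f t) @[t --> (0 : R)] --> (1%g : G).
  have [_ sC] := nbhs_singleton cover_s; rewrite -s_1.
  by apply: (@cvg_comp _ _ _ f s _ (nbhs (1%g : SL2 R))).
(* Near 0 the conjugate stays where [s] inverts [p], so the relation [fA] between matrices lifts to
   [G]. *)
have near0 : nbhs (0 : R) [set t |
    s (p (a * s (f t) * a^-1)%g) = (a * s (f t) * a^-1)%g /\ p (s (f t)) = f t].
  have F0 : Filter (nbhs (0 : R)) by exact: nbhs_filter.
  have asC : (a * s (f t) * a^-1)%g @[t --> (0 : R)] --> (a * 1 * a^-1)%g.
    by apply: cvgMg; [apply: cvgMg; [exact: cvg_cst|exact: sfC]|exact: cvg_cst].
  rewrite mulg1 mulgV in asC.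
  have H1 : nbhs (0 : R) [set t | s (p (a * s (f t) * a^-1)%g) = (a * s (f t) * a^-1)%g].
    exact: asC _ s_cover.
  have H2 : nbhs (0 : R) [set t | p (s (f t)) = f t /\ {for f t, continuous s}].
    exact: fC _ cover_s.
  by apply: filterS (filterI H1 H2) => t [? []].
have /nbhs_ballP[d /= d0 dP] := near0; apply/nbhs_ballP; exists d => //= t td.
have step t' : ball 0 d t' -> (a * s (f t') * a^-1)%g = s (f (t' / 4)).
  move=> /dP[<- pst]; congr s.
  by rewrite !(cover_mul hG) (cover_inv hG) pst pa fA.
have pow_le (n : nat) : `|t / 4 ^+ n| <= `|t|.
  rewrite normrM ler_piMr // ger0_norm ?invr_ge0 ?exprn_ge0 //.
  by rewrite invf_le1 ?exprn_gt0 // exprn_ege1 // ler1n.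
have in_ball (n : nat) : ball 0 d (t / 4 ^+ n).
  by move: td; rewrite /ball /= !sub0r !normrN; apply: le_lt_trans; exact: pow_le.
have iter (n : nat) : b (s (f (t / 4 ^+ n))) = (b a ^+ n * b (s (f t)) * (b a ^+ n)^-1)%g.
  elim: n => [|n IH]; first by rewrite expr0 divr1 expg0 invg1 mul1g mulg1.
  have -> : t / 4 ^+ n.+1 = t / 4 ^+ n / 4 by rewrite exprSr invfM mulrA.
  by rewrite -step // !b_mul IH b_inv expgS invgM !mulgA.
have [[cB _] _ _ _] := compactB.
apply: eq1_nbhs => U /(compact_group_conj cB) U'1.
have bsC : b (s (f t)) @[t --> (0 : R)] --> (1%g : B).
  rewrite -b_1; apply: (@cvg_comp _ _ _ (fun t => s (f t)) b _ (nbhs (1%g : G))) => //.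
  exact: b_continuous.
have /nbhs_ballP[e /= e0 eP] : nbhs (0 : R) [set t | forall k, U (k^-1 * b (s (f t)) * k)%g].
  exact: bsC _ U'1.
pose n := (Num.truncn (`|t| / e)).+1.
have tn : ball 0 e (t / 4 ^+ n).
  rewrite /ball /= sub0r normrN normrM [`|_^-1|]ger0_norm ?invr_ge0 ?exprn_ge0 //.
  rewrite ltr_pdivrMr ?exprn_gt0 // -ltr_pdivrMl // mulrC (lt_trans (truncnS_gt _)) //.
  by rewrite -natrX ltr_nat ltn_expl.
have := eP _ tn (b a ^+ n)%g; rewrite iter.
by rewrite !mulgA mulVg mul1g mulgVK.
Qed.

(** Upper and lower unipotents fall under [contracted_trivial], and four of them make up any matrix
    near 1. Fixing one parameter at a nonzero [e] allows solving for the others by division. *)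
Lemma compactification_near_trivial : nbhs (1%g : G) [set v | b v = 1%g].
Proof.
have /choice[up upP] : forall t : R, exists A : SL2 R,
    [/\ A 0 0 = 1, A 0 1 = t, A 1 0 = 0 & A 1 1 = 1].
  by move=> t; apply: SL2_ex; rewrite mulr0 subr0 mulr1.
have /choice[lo loP] : forall t : R, exists A : SL2 R,
    [/\ A 0 0 = 1, A 0 1 = 0, A 1 0 = t & A 1 1 = 1].
  by move=> t; apply: SL2_ex; rewrite mul0r subr0 mulr1.
have up0 : up 0 = 1%g by have [? ? ? ?] := upP 0; apply: SL2_eqP; rewrite SL2_1E.
have lo0 : lo 0 = 1%g by have [? ? ? ?] := loP 0; apply: SL2_eqP; rewrite SL2_1E.
have entry_cvg (a c : R) : (a + t * c) @[t --> (0 : R)] --> a + 0 * c.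
  by apply: (@cvgD R R^o); [exact: cvg_cst|apply: cvgM; [exact: cvg_id|exact: cvg_cst]].
have upC : up t @[t --> (0 : R)] --> (1%g : SL2 R).
  have E t i j : up t i j = (i == j)%:R + t * ((i == 0) && (j == 1))%:R.
    have [? ? ? ?] := upP t.
    by case: (ord2_cases i) (ord2_cases j) => -> [] ->;
      rewrite ?mulr0 ?mulr1 ?addr0 ?add0r.
  rewrite -up0; apply: cvg_SL2 => i j; rewrite E.
  have -> : (fun t => up t i j) =
      fun t => (i == j)%:R + t * ((i == 0) && (j == 1))%:R.
    by apply/funext => t; exact: E.
  exact: entry_cvg.
have loC : lo t @[t --> (0 : R)] --> (1%g : SL2 R).
  have E t i j : lo t i j = (i == j)%:R + t * ((i == 1) && (j == 0))%:R.
    have [? ? ? ?] := loP t.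
    by case: (ord2_cases i) (ord2_cases j) => -> [] ->;
      rewrite ?mulr0 ?mulr1 ?addr0 ?add0r.
  rewrite -lo0; apply: cvg_SL2 => i j; rewrite E.
  have -> : (fun t => lo t i j) =
      fun t => (i == j)%:R + t * ((i == 1) && (j == 0))%:R.
    by apply/funext => t; exact: E.
  exact: entry_cvg.
(* Conjugation by this diagonal matrix divides the parameter of [up] by 4, and conjugation by its
   inverse [C] that of [lo]. *)
have [A [a00 a01 a10 a11]] : exists A : SL2 R,
    [/\ A 0 0 = 2^-1, A 0 1 = 0, A 1 0 = 0 & A 1 1 = 2].
  by apply: SL2_ex; rewrite mul0r subr0 mulVf.
have [C [c00 c01 c10 c11]] : exists A : SL2 R,
    [/\ A 0 0 = 2, A 0 1 = 0, A 1 0 = 0 & A 1 1 = 2^-1].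
  by apply: SL2_ex; rewrite mul0r subr0 mulfV.
have up_triv : nbhs (0 : R) [set t | b (s (up t)) = 1%g].
  apply: (contracted_trivial (A := A) up0 upC) => t.
  have [u00 u01 u10 u11] := upP t; have [v00 v01 v10 v11] := upP (t / 4).
  suff -> : (A * up t)%g = (up (t / 4)%R * A)%g by rewrite mulgK.
  by apply: SL2_eqP; rewrite !SL2_mulE ?a00 ?a01 ?a10 ?a11
    ?u00 ?u01 ?u10 ?u11 ?v00 ?v01 ?v10 ?v11; lra.
have lo_triv : nbhs (0 : R) [set t | b (s (lo t)) = 1%g].
  apply: (contracted_trivial (A := C) lo0 loC) => t.
  have [u00 u01 u10 u11] := loP t; have [v00 v01 v10 v11] := loP (t / 4).
  suff -> : (C * lo t)%g = (lo (t / 4)%R * C)%g by rewrite mulgK.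
  by apply: SL2_eqP; rewrite !SL2_mulE ?c00 ?c01 ?c10 ?c11
    ?u00 ?u01 ?u10 ?u11 ?v00 ?v01 ?v10 ?v11; lra.
(* Products of four elements of [W] stay where [s] inverts [p], so a factorization of matrices lifts
   to one in [G]. *)
have [W W1 W4] : exists2 W, nbhs (1%g : G) W & forall x y z w, W x -> W y -> W z -> W w ->
    s (p (x * y * (z * w))%g) = (x * y * (z * w))%g.
  have := s_cover; rewrite -[in nbhs _ _](mulg1 1%g) => /nbhs_mulg[V [V' [V1 V'1 VV]]].
  have VV1 : nbhs (1 * 1 : G)%g (V `&` V') by rewrite mulg1; exact: filterI.
  have [W [W' [W1 W'1 WW]]] := nbhs_mulg VV1.
  exists (W `&` W'); first exact: filterI.
  move=> x y z w [Wx _] [_ W'y] [Wz _] [_ W'w].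
  by apply: VV; [case: (WW x y Wx W'y)|case: (WW z w Wz W'w)].
have [_ sC] := nbhs_singleton cover_s.
have sfC (f : R -> SL2 R) : f t @[t --> (0 : R)] --> (1%g : SL2 R) ->
    nbhs (0 : R) [set t | W (s (f t))].
  move=> fC; rewrite -s_1 in W1.
  exact: (@cvg_comp _ _ _ f s _ (nbhs (1%g : SL2 R)) _ fC sC W W1).
have pf (f : R -> SL2 R) : f t @[t --> (0 : R)] --> (1%g : SL2 R) ->
    nbhs (0 : R) [set t | p (s (f t)) = f t].
  by move=> /(_ _ cover_s); apply: (@filterS _ (nbhs (0 : R))) => t [].
have : nbhs (0 : R) [set t | [/\ b (s (up t)) = 1%g, W (s (up t)) & p (s (up t)) = up t] /\
    [/\ b (s (lo t)) = 1%g, W (s (lo t)) & p (s (lo t)) = lo t]].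
  have F0 : Filter (nbhs (0 : R)) by exact: nbhs_filter.
  apply: filterS (filterI (filterI up_triv (filterI (sfC _ upC) (pf _ upC)))
    (filterI lo_triv (filterI (sfC _ loC) (pf _ loC)))).
  by move=> t [[? [? ?]] [? [? ?]]].
move=> /nbhs_ballP[d /= d0 dP].
pose e := Num.min 1 (d / 2).
have e0 : 0 < e by rewrite lt_min ltr01 divr_gt0.
have e1 : e <= 1 by rewrite ge_min lexx.
have ed : e <= d / 2 by rewrite ge_min lexx orbT.
move: e e0 e1 ed => e e0 e1 ed.
(* Two of the parameters are quotients by [e], hence the second order in [e]. *)
pose h := e * e / 4.
have : nbhs (1%g : SL2 R) [set g : SL2 R | forall i j, `|(1%g : SL2 R) i j - g i j| < h].
  by apply/nbhs_SL2P; exists h => //; rewrite !mulr_gt0 ?invr_gt0.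
rewrite -(cover_1 hG) => near_p.
have {}near_p := cover_continuous hG near_p.
apply: filterS (filterI s_cover near_p) => v [sv vP] /=.
have {vP} [Ha Hb Hc Hd] :
    [/\ `|1 - p v 0 0| < h, `|p v 0 1| < h, `|p v 1 0| < h & `|1 - p v 1 1| < h].
  have := (vP 0 0, vP 0 1, vP 1 0, vP 1 1).
  by rewrite !(cover_1 hG) !SL2_1E /= !sub0r !normrN => -[[[]]].
have := det_SL2 (p v); have := @SL2_eqP R (p v).
move: (p v 0 0) (p v 0 1) (p v 1 0) (p v 1 1) Ha Hb Hc Hd => g00 g01 g10 g11.
rewrite !ltr_norml => /andP[a1 a2] /andP[b1 b2] /andP[c1 c2] /andP[d1 d2] gE detg.
have h_e : h <= e / 4 by rewrite /h; nra.
have g11_gt : 3 / 4 < g11 by lra.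
have g11_0 : g11 != 0 by rewrite gt_eqF //; lra.
have e_0 : e != 0 by rewrite gt_eqF.
(* [p v] is [up x * lo e * (up z * lo w)] with all parameters in the ball of radius
   [2 e]. *)
pose w := (g10 - e) / g11; pose x := (g00 - g01 * w - 1) / e; pose z := (g11 - 1) / e.
have wE : w * g11 = g10 - e by rewrite divfK.
have xE : x * e = g00 - g01 * w - 1 by rewrite divfK.
have zE : z * e = g11 - 1 by rewrite divfK.
move: w x z wE xE zE => w x z wE xE zE.
have [w1 w2] : - (2 * e) < w /\ w < 2 * e by split; nra.
have he : h = e * e / 4 by [].
have [x1 x2] : - (2 * e) < x /\ x < 2 * e by split; nra.
have [z1 z2] : - (2 * e) < z /\ z < 2 * e by split; nra.
have d2e : 2 * e <= d by lra.
have inb t : - (2 * e) < t -> t < 2 * e -> ball 0 d t.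
  by move=> t1 t2; rewrite /ball /= sub0r normrN ltr_norml; apply/andP; split; lra.
have [[ux Wx px] _] := dP _ (inb x x1 x2).
have [|_ [le We pe]] := dP e; first by apply: inb; lra.
have [[uz Wz pz] _] := dP _ (inb z z1 z2).
have [_ [lw Ww pw]] := dP _ (inb w w1 w2).
have -> : v = (s (up x) * s (lo e) * (s (up z) * s (lo w)))%g.
  rewrite -[LHS]sv -(W4 _ _ _ _ Wx We Wz Ww); congr s.
  rewrite !(cover_mul hG) px pe pz pw.
  have [p00 p01 p10 p11] := upP x; have [q00 q01 q10 q11] := loP e.
  have [r00 r01 r10 r11] := upP z; have [t00 t01 t10 t11] := loP w.
  have M01 : (1 + x * e) * z + x = g01.
    apply: (mulIf e_0); have -> : ((1 + x * e) * z + x) * e = (1 + x * e) * (z * e) + x * e by ring.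
    rewrite xE zE; have -> : (1 + (g00 - g01 * w - 1)) * (g11 - 1) + (g00 - g01 * w - 1) =
      g00 * g11 - g01 * (w * g11) - 1 by ring.
    by rewrite wE; lra.
  apply: gE; rewrite !SL2_mulE ?p00 ?p01 ?p10 ?p11 ?q00 ?q01 ?q10 ?q11 ?r00 ?r01 ?r10 ?r11
    ?t00 ?t01 ?t10 ?t11.
  - have -> : (1 * 1 + x * e) * (1 * 1 + z * w) + (1 * 0 + x * 1) * (0 * 1 + 1 * w) =
      (1 + x * e) + w * ((1 + x * e) * z + x) by ring.
    by rewrite M01 xE; ring.
  - by rewrite -M01; ring.
  - have -> : (0 * 1 + 1 * e) * (1 * 1 + z * w) + (0 * 0 + 1 * 1) * (0 * 1 + 1 * w) =
      e + (z * e + 1) * w by ring.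
    by rewrite zE subrK mulrC wE; ring.
  - have -> : (0 * 1 + 1 * e) * (1 * 0 + z * 1) + (0 * 0 + 1 * 1) * (0 * 0 + 1 * 1) =
      z * e + 1 by ring.
    by rewrite zE subrK.
by rewrite /= !b_mul ux le uz lw !mulg1.
Qed.

End BohrTrivial.

Lemma compactification_trivial (R : realType) (G : topologicalGroupType)
    (p : G -> SL2 R) (hG : is_universal_cover_SL2 p)
    (B : topologicalGroupType) (b : G -> B) :
  is_compactification b -> forall x : B, x = 1%g.
Proof.
move=> compactB; have [[cB hB] bC bM denseb] := compactB.
have b1 : b 1%g = 1%g by apply: (mulgI (b 1%g)); rewrite -bM !mulg1.
have [s [s1 sp ps]] := local_section hG.
have near1 := compactification_near_trivial hG compactB s1 sp ps.
(* The kernel of [b] is open, so [d] is continuous; it never takes the value 1/2, and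
   path-connectedness keeps it at 0. *)
pose d (g : G) : R := if b g == 1%g then 0 else 1.
have dC : continuous d.
  move=> g U /nbhs_singleton Ug; have := near1; rewrite -(mulgV g) => /nbhs_rmul ng.
  change (nbhs g [set x | U (d x)]); apply: filterS ng => x /= xg; suff -> : d x = d g by [].
  by rewrite /d -(mulgVK g x) bM xg mul1g.
have d01 g : d g <> 2^-1 /\ d g <> - 2^-1 by rewrite /d; case: ifP => _; split; lra.
have bg g : b g = 1%g.
  have := cover_ivt hG dC _ _ d01 g; rewrite /d b1 eqxx => /(_ erefl).
  rewrite invr_gt0 ltr0n => /(_ isT); case: eqP => // _.
  by rewrite normr1 ltNge invf_le1 ?ltr0n // ler1n.
move=> x; apply: hB => U V /nbhs_interior Ux /nbhs_singleton V1.
have [||y [Uy [g _ gy]]] := denseb (interior U).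
- by exists x; exact: nbhs_singleton.
- exact: open_interior.
by exists 1%g; split=> //; rewrite -(bg g) gy; exact: nbhs_singleton.
Qed.

Theorem corollary3p30 (R : realType)
    (G : topologicalGroupType) (p : G -> SL2 R) (hG : is_universal_cover_SL2 p)
    (K : Type) (Zstar : elementary_extension) (hZ : is_monster K Zstar) :
  [/\                                                
      forall (B : topologicalGroupType) (b : G -> B),
        is_Bohr_compactification b -> forall x : B, x = 1%g,
                                                                           
                           
      forall B : topologicalGroupType,
        is_generalized_Bohr_compactification G B ->
        (exists x : B, x <> 1%g) /\
        (exists f : B -> {quot (comp00Z K Zstar)},
           {morph f : x y / (x * y)%g >-> x + y} /\ range f = setT),
                                                                              
      exists f : {quot (comp00Z K Zstar)} -> {quot (comp00Z_mod K Zstar)},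
        {morph f : x y / x + y} /\ bijective f,
                                            
      exists g : int -> {quot (comp00 K Zstar)},
        [/\ {morph g : m n / m + n}, injective g &
            range g = [set` comp00Z_mod K Zstar]] &
                                                                                
                                                                  
      exists (B : topologicalGroupType) (b : discreteZ -> B)
             (f : {quot (comp00 K Zstar)} -> B),
        [/\ is_Bohr_compactification b,
            {morph f : x y / x + y >-> (x * y)%g} /\ bijective f,
            forall C : set B, closed C <-> logic_closed (f @^-1` C),
            forall n : int, f (\pi_({quot (comp00 K Zstar)}) (emb n)) = b n &
            dense (f @` [set` comp00Z_mod K Zstar])]].
Proof.
split.
- by move=> B b [compact_b _]; exact: (compactification_trivial hG compact_b).
- move=> B gB; split; first exact: (generalized_Bohr_nontrivial hG hZ gB).
  exact: (generalized_Bohr_hom hG hZ gB).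
- exact: third_isomorphism.
- exact: (copy_of_Z hZ).
exists (bohrZ hZ), (fun n : discreteZ => \pi_({quot comp00 K Zstar}) (emb n)), id.
split.
- exact: bohrZ_is_Bohr_compactification.
- by split; [move=> q r|exists id].
- exact: bohrZ_closedP.
- by [].
- move=> U [q Uq] oU; have [n Un] := nbhs_bohrZ_emb (open_nbhs_nbhs (conj oU Uq)).
  exists (\pi_({quot comp00 K Zstar}) (emb n)); split=> //.
  exists (\pi_({quot comp00 K Zstar}) (emb n)) => //=.
  by rewrite mem_comp00Z_mod (@comp00Z_emb K Zstar _ n) // subrr rpred0.
Qed.
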